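(* Let $s<0$ and $T>0$. Consider the Cauchy problem $$-i\alpha^\nu\partial_\nu\psi=\Box^{-1}\left[\partial^\mu(-2\epsilon_{\mu\nu\lambda}\psi^\dagger\alpha^\lambda\psi)\right]\alpha^\nu\psi,\qquad \psi(0)=\psi_0\in H^s(\mathbb R^2),$$ understood as the integral equation given in the context. Then the flow map $\psi_0\mapsto\psi$ from $H^s(\mathbb R^2)$ to $C([-T,T];H^s(\mathbb R^2))$ cannot be $C^3$ at the origin.
   Context: The equation is posed on Minkowski space $\mathbb R^{1+2}$ with coordinates $(x^0,x^1,x^2)=(t,x)$ and metric of signature $(+,-,-)$ (so $\partial^0=\partial_0=\partial_t$, $\partial^j=-\partial_j$). The Einstein summation convention is used; Greek indices run over $0,1,2$ and Latin indices over $1,2$. $\Box=\partial^\mu\partial_\mu=\partial_t^2-\Delta$. The unknown is the spinor $\psi:\mathbb R^{1+2}\to\mathbb C^2$ (column vector); $\psi^\dagger$ is the complex conjugate transpose. $\epsilon_{\mu\nu\lambda}$ is totally skew-symmetric with $\epsilon_{012}=1$. The matrices are $\alpha^0=I_{2\times2}$, $\alpha^1=\begin{pmatrix}0&1\\1&0\end{pmatrix}$, $\alpha^2=\begin{pmatrix}0&-i\\ i&0\end{pmatrix}$. $H^s(\mathbb R^2)$ is the inhomogeneous $L^2$-based Sobolev space (norm equivalent to $\|(1+|\xi|)^s\widehat f\|_{L^2_\xi}$), here of $\mathbb C^2$-valued functions. The equation is the single spinor equation decoupled from the massless Chern-Simons-Dirac system in the Lorenz gauge ($\Box A_\nu=\partial^\mu(-2\epsilon_{\mu\nu\lambda}\psi^\dagger\alpha^\lambda\psi)$,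 $-i\alpha^\mu\partial_\mu\psi=A_\mu\alpha^\mu\psi$) with $a_\mu=A_\mu(0)=0$. Let $D=|\nabla|$ (Fourier symbol $|\xi|$), $U_\pm(t)=e^{\mp itD}$, $\Pi_\pm(\xi)=\frac12\big(I_{2\times2}\pm\frac{\xi_j\alpha^j}{|\xi|}\big)$ (Fourier multiplier), $R^0_\pm=-1$, $R^j_\pm=\mp\frac{\partial_j}{iD}$. The Cauchy problem is taken in the form of the integral equation $$\psi(t)=\sum_\pm U_\pm(t)\Pi_\pm\psi_0-\frac12\sum_{\pm_1,\pm_2}\int_0^tU_{\pm_1}(t-t')\Pi_{\pm_1}\Big(\alpha^\nu\Big(U_{\pm_2}(t')\big(\pm_2\tfrac1D\epsilon_{0\nu\lambda}\psi_0^\dagger\alpha^\lambda\psi_0\big)\Big)\psi(t')\Big)\,dt'$$ $$\qquad+\,i\sum_{\pm_1,\pm_2}\int_0^tU_{\pm_1}(t-t')\Pi_{\pm_1}\Big(\alpha^\nu\int_0^{t'}U_{\pm_2}(t'-t'')\big[R^\mu_{\pm_2}\epsilon_{\mu\nu\lambda}\psi^\dagger(t'')\alpha^\lambda\psi(t'')\big]\,dt''\,\psi(t')\Big)\,dt',$$ where $\pm_1,\pm_2$ range over independent choices of signs. *)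

(* Defs.v *)
From HB Require Import structures.
From mathcomp Require Import all_boot all_order all_algebra.
From mathcomp Require Import complex.
From mathcomp Require Import all_classical all_reals all_analysis.
From mathcomp Require Import measurable_realfun.

Set Implicit Arguments.
Unset Strict Implicit.
Unset Printing Implicit Defensive.

Import Order.TTheory GRing.Theory Num.Theory.
Import numFieldNormedType.Exports.

Local Open Scope classical_set_scope.
Local Open Scope ring_scope.
Local Open Scope quotient_scope.
Local Open Scope complex_scope.

Local Notation Re := complex.Re (only parsing).
Local Notation Im := complex.Im (only parsing).

Section Sobolev.
Variable R : realType.

Definition plane : Type := (measurableTypeR R * measurableTypeR R)%type.
HB.instance Definition _ := Measurable.on plane.

Definition spinor : Type := 'cV[R[i]]_2.
HB.instance Definition _ := GRing.Zmodule.on spinor.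
HB.instance Definition _ := isPointed.Build spinor 0.

Definition leb : {measure set (measurableTypeR R) -> \bar R} :=
  lebesgue_measure.
Definition leb2 : {measure set plane -> \bar R} := (leb \x leb)%E.

Definition plane_norm (x : plane) : R := Num.sqrt (x.1 ^+ 2 + x.2 ^+ 2).

Definition spinor_norm (v : spinor) : R :=
  Num.sqrt (Normc.normc (v 0 0) ^+ 2 + Normc.normc (v 1 0) ^+ 2).

Definition measurable_spinor (v : plane -> spinor) : Prop :=
  forall i : 'I_2, measurable_fun setT (fun x => Re (v x i 0)) /\
                   measurable_fun setT (fun x => Im (v x i 0)).

Definition weighted (s : R) (v : plane -> spinor) (xi : plane) : R :=
  (1 + plane_norm xi) `^ s * spinor_norm (v xi).

Definition sobolev_norm (s : R) (v : plane -> spinor) : \bar R :=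
  ('N[leb2]_(2%:E)[EFin \o weighted s v])%E.

Definition sobolev (s : R) (v : plane -> spinor) : Prop :=
  measurable_spinor v /\ (sobolev_norm s v < +oo)%E.

Lemma spinor_normE (v : spinor) :
  spinor_norm v = Normc.normc (Normc.normc (v 0 0) +i* Normc.normc (v 1 0)).
Proof. by []. Qed.

Lemma spinor_norm_ge0 (v : spinor) : 0 <= spinor_norm v.
Proof. exact: sqrtr_ge0. Qed.

Lemma normc_ge0 (z : R[i]) : 0 <= Normc.normc z.
Proof. by case: z => a b; exact: sqrtr_ge0. Qed.

Lemma spinor_normD (u v : spinor) :
  spinor_norm (u + v) <= spinor_norm u + spinor_norm v.
Proof.
rewrite [in leRHS]/spinor_norm.
have := @le_normcD R (Normc.normc (u 0 0) +i* Normc.normc (u 1 0))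
                     (Normc.normc (v 0 0) +i* Normc.normc (v 1 0)).
move=> /=; apply: le_trans.
rewrite ler_sqrt ?addr_ge0 ?sqr_ge0// !mxE.
by apply: lerD; rewrite lerXn2r ?nnegrE ?addr_ge0 ?normc_ge0 ?le_normcD.
Qed.

Lemma normc_real (a : R) : Normc.normc a%:C = `|a|.
Proof. by rewrite /= expr0n addr0 sqrtr_sqr. Qed.

Lemma spinor_normZ (a : R) (v : spinor) :
  spinor_norm (a%:C *: v) = `|a| * spinor_norm v.
Proof.
rewrite /spinor_norm !mxE !Normc.normcM !normc_real !exprMn -mulrDr.
by rewrite sqrtrM ?sqr_ge0// sqrtr_sqr normr_id.
Qed.

Lemma spinor_norm_eq0 (v : spinor) : spinor_norm v = 0 -> v = 0.
Proof.
move/eqP; rewrite sqrtr_eq0 => h.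
have {h} : Normc.normc (v 0 0) ^+ 2 + Normc.normc (v 1 0) ^+ 2 == 0.
  by rewrite eq_le h addr_ge0 ?sqr_ge0.
rewrite paddr_eq0 ?sqr_ge0// !expf_eq0/= => /andP[/eqP h0 /eqP h1].
apply/matrixP => i j; rewrite (ord1 j) mxE.
case: i => -[|[|//]] hi; apply: Normc.eq0_normc.
- by rewrite -h0; congr (Normc.normc (v _ _)); apply/val_inj.
- by rewrite -h1; congr (Normc.normc (v _ _)); apply/val_inj.
Qed.

Lemma measurable_normc (f : plane -> R[i]) :
  measurable_fun setT (fun x => Re (f x)) ->
  measurable_fun setT (fun x => Im (f x)) ->
  measurable_fun setT (fun x => Normc.normc (f x)).
Proof.
move=> mr mi.
rewrite (_ : (fun x => _) = (@Num.sqrt R) \o (fun x => Re (f x) ^+ 2 + Im (f x) ^+ 2));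
  last by apply/funext => x /=; case: (f x).
apply: measurableT_comp; first exact: continuous_measurable_fun (@sqrt_continuous R).
by apply: measurable_funD; apply: measurable_funX.
Qed.

Lemma measurable_plane_norm : measurable_fun setT plane_norm.
Proof.
apply: measurableT_comp; first exact: continuous_measurable_fun (@sqrt_continuous R).
by apply: measurable_funD; apply: measurable_funX.
Qed.

Lemma measurable_spinor_norm (v : plane -> spinor) :
  measurable_spinor v -> measurable_fun setT (fun x => spinor_norm (v x)).
Proof.
move=> mv; apply: measurableT_comp.
  exact: continuous_measurable_fun (@sqrt_continuous R).
by apply: measurable_funD; apply: measurable_funX; apply: measurable_normc;
  [exact: (mv 0).1|exact: (mv 0).2|exact: (mv 1).1|exact: (mv 1).2].
Qed.

Lemma measurable_weighted s v :
  measurable_spinor v -> measurable_fun setT (weighted s v).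
Proof.
move=> mv; apply: measurable_funM; last exact: measurable_spinor_norm.
apply: (measurableT_comp (measurable_powR s)).
by apply: measurable_funD => //; exact: measurable_plane_norm.
Qed.

Lemma weighted_ge0 s v xi : 0 <= weighted s v xi.
Proof. by rewrite mulr_ge0 ?powR_ge0 ?spinor_norm_ge0. Qed.

Lemma sobolev_normE s v : sobolev_norm s v =
  ((\int[leb2]_xi (weighted s v xi `^ 2)%:E) `^ 2^-1)%E.
Proof.
rewrite /sobolev_norm unlock; congr (_ `^ _)%E.
by apply: eq_integral => x _; rewrite /= ger0_norm ?weighted_ge0.
Qed.

Lemma measurable_spinorD u v :
  measurable_spinor u -> measurable_spinor v ->
  measurable_spinor (fun xi => u xi + v xi).
Proof.
move=> mu mv i; split.
- rewrite (_ : (fun x => _) = (fun x => Re (u x i 0)) \+ (fun x => Re (v x i 0)));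
    last by apply/funext => x; rewrite mxE /=; case: (u x i 0) => ? ?; case: (v x i 0).
  by apply: measurable_funD; [exact: (mu i).1|exact: (mv i).1].
- rewrite (_ : (fun x => _) = (fun x => Im (u x i 0)) \+ (fun x => Im (v x i 0)));
    last by apply/funext => x; rewrite mxE /=; case: (u x i 0) => ? ?; case: (v x i 0).
  by apply: measurable_funD; [exact: (mu i).2|exact: (mv i).2].
Qed.

Lemma measurable_spinorZ (a : R) v :
  measurable_spinor v -> measurable_spinor (fun xi => a%:C *: v xi).
Proof.
move=> mv i; split.
- rewrite (_ : (fun x => _) = (fun x => a * Re (v x i 0)));
    last by apply/funext => x; rewrite mxE /=; case: (v x i 0) => p q /=; rewrite mul0r subr0.
  by apply: measurable_funM => //; exact: (mv i).1.
- rewrite (_ : (fun x => _) = (fun x => a * Im (v x i 0)));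
    last by apply/funext => x; rewrite mxE /=; case: (v x i 0) => p q /=; rewrite mul0r addr0.
  by apply: measurable_funM => //; exact: (mv i).2.
Qed.

Lemma sobolev_normD s u v : measurable_spinor u -> measurable_spinor v ->
  (sobolev_norm s (fun xi => u xi + v xi)%R
    <= sobolev_norm s u + sobolev_norm s v)%E.
Proof.
move=> mu mv.
have : (1 <= 2 :> R) by rewrite ler1n.
move=> /(minkowski_EFin leb2 (measurable_weighted s mu) (measurable_weighted s mv)).
apply: le_trans; rewrite sobolev_normE unlock.
apply: gt0_ler_poweR; rewrite ?invr_ge0//.
- by rewrite in_itv/= leey andbT; apply: integral_ge0 => x _; rewrite lee_fin powR_ge0.
- by rewrite in_itv/= leey andbT; apply: integral_ge0 => x _; rewrite lee_fin powR_ge0.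
apply: ge0_le_integral => //=.
- by move=> x _; rewrite lee_fin powR_ge0.
- apply/measurable_EFinP/(measurableT_comp (measurable_powR _)).
  by apply: measurable_weighted; exact: measurable_spinorD.
- apply/measurable_EFinP/(measurableT_comp (measurable_powR _)).
  apply: measurableT_comp => //.
  by apply: measurable_funD; exact: measurable_weighted.
- move=> x _; rewrite lee_fin; apply: ge0_ler_powR => //; rewrite ?nnegrE ?weighted_ge0//.
  rewrite ger0_norm ?addr_ge0 ?weighted_ge0//.
  by rewrite -mulrDr ler_wpM2l ?powR_ge0 ?spinor_normD.
Qed.

Lemma sobolev_normZ s (a : R) v : measurable_spinor v ->
  (sobolev_norm s (fun xi => a%:C *: v xi)%R = `|a|%:E * sobolev_norm s v)%E.
Proof.
move=> mv; rewrite !sobolev_normE.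
under eq_integral => x _.
  rewrite /weighted spinor_normZ mulrCA -/(weighted s v x).
  rewrite powRM ?weighted_ge0// EFinM.
  over.
rewrite ge0_integralZl//=.
- rewrite poweRM ?lee_fin ?powR_ge0//; last first.
    by apply: integral_ge0 => x _; rewrite lee_fin powR_ge0.
  by rewrite poweR_EFin -powRrM mulfV ?pnatr_eq0// powRr1.
- apply/measurable_EFinP/(measurableT_comp (measurable_powR _)).
  exact: measurable_weighted.
- by move=> x _; rewrite lee_fin powR_ge0.
Qed.

Lemma sobolev_norm_ae s u v : measurable_spinor u -> measurable_spinor v ->
  {ae leb2, forall xi, u xi = v xi} -> sobolev_norm s u = sobolev_norm s v.
Proof.
move=> mu mv uv; rewrite !sobolev_normE.
apply: (congr1 (fun z => (z `^ 2^-1)%E)).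
apply: ge0_ae_eq_integral => //=.
- apply/measurable_EFinP/(measurableT_comp (measurable_powR _)).
  exact: measurable_weighted.
- apply/measurable_EFinP/(measurableT_comp (measurable_powR _)).
  exact: measurable_weighted.
- by move=> x _; rewrite lee_fin powR_ge0.
- by move=> x _; rewrite lee_fin powR_ge0.
- by apply: filterS uv => x + _; rewrite /weighted => ->.
Qed.

Lemma sobolev_norm_eq0 s v : measurable_spinor v ->
  sobolev_norm s v = 0%E -> {ae leb2, forall xi, v xi = 0}.
Proof.
move=> mv /Lnorm_eq0_eq0 h.
have mw : measurable_fun setT (EFin \o weighted s v).
  by apply/measurable_EFinP; exact: measurable_weighted.
have p2 : (0 < 2%:E :> \bar R)%E by rewrite lte_fin.
move: (h mw p2); apply: filterS => x /(_ I) /eqP; rewrite /= eqe mulf_eq0 => /orP[|/eqP/spinor_norm_eq0//].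
rewrite powR_eq0 => /andP[+ _].
by rewrite gt_eqF// ltr_pwDl// sqrtr_ge0.
Qed.

Lemma sobolev_ge0 s v : (0 <= sobolev_norm s v)%E.
Proof. exact: Lnorm_ge0. Qed.

Lemma measurable_spinor0 : measurable_spinor (fun=> 0).
Proof.
move=> i; split.
- by rewrite (_ : (fun x => _) = cst 0)//; apply/funext => x; rewrite mxE.
- by rewrite (_ : (fun x => _) = cst 0)//; apply/funext => x; rewrite mxE.
Qed.

Lemma sobolev0 s : sobolev s (fun=> 0).
Proof.
split; first exact: measurable_spinor0.
have -> : (fun=> 0) = (fun xi : plane => (0 : R)%:C *: (0 : spinor)).
  by apply/funext => x; rewrite scaler0.
by rewrite sobolev_normZ ?normr0 ?mul0e//; exact: measurable_spinor0.
Qed.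

Lemma sobolevD s u v : sobolev s u -> sobolev s v ->
  sobolev s (fun xi => u xi + v xi).
Proof.
move=> [mu fu] [mv fv]; split; first exact: measurable_spinorD.
by rewrite (le_lt_trans (sobolev_normD s mu mv))// lte_add_pinfty.
Qed.

Lemma sobolevZ s (a : R) v : sobolev s v -> sobolev s (fun xi => a%:C *: v xi).
Proof.
move=> [mv fv]; split; first exact: measurable_spinorZ.
by rewrite sobolev_normZ// lte_mul_pinfty// lee_fin.
Qed.

End Sobolev.

Section SobolevSpace.
Variables (R : realType) (s : R).

Record Hs_rep := HsRep {
  Hs_fun :> plane R -> spinor R;
  Hs_funP : sobolev s Hs_fun
}.
HB.instance Definition _ := gen_eqMixin Hs_rep.
HB.instance Definition _ := gen_choiceMixin Hs_rep.

Definition Hs_ae (f g : Hs_rep) : bool :=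
  `[< {ae @leb2 R, forall xi, f xi = g xi} >].

Lemma Hs_ae_refl : reflexive Hs_ae.
Proof. by move=> f; apply/asboolP; exact: nearW. Qed.

Lemma Hs_ae_sym : symmetric Hs_ae.
Proof.
by move=> f g; apply/idP/idP => /asboolP h; apply/asboolP; apply: filterS h.
Qed.

Lemma Hs_ae_trans : transitive Hs_ae.
Proof.
move=> g f h /asboolP fg /asboolP gh; apply/asboolP.
by apply: filterS2 fg gh => x -> ->.
Qed.

Canonical Hs_ae_equiv := EquivRel Hs_ae Hs_ae_refl Hs_ae_sym Hs_ae_trans.

(* H^s(R^2; C^2).  A tempered distribution in H^s is given by its Fourier
   transform, a measurable function with finite weighted L^2 norm, taken up to
   equality almost everywhere. *)
Definition Hs : Type := {eq_quot Hs_ae}.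
HB.instance Definition _ := Choice.on Hs.
HB.instance Definition _ := EqQuotient.on Hs.

(* A representative of the Fourier transform. *)
Definition hat (f : Hs) : plane R -> spinor R := repr f.

Lemma hatP (f : Hs) : sobolev s (hat f).
Proof. exact: Hs_funP. Qed.

Definition ofhat (v : plane R -> spinor R) (sv : sobolev s v) : Hs :=
  \pi_Hs (HsRep sv).

Lemma hat_ofhat v (sv : sobolev s v) :
  {ae @leb2 R, forall xi, hat (ofhat sv) xi = v xi}.
Proof.
have /eqmodP/asboolP : repr (ofhat sv) = HsRep sv %[mod Hs] by rewrite reprK.
exact.
Qed.

Lemma Hs_eq (f g : Hs) : {ae @leb2 R, forall xi, hat f xi = hat g xi} -> f = g.
Proof.
move=> fg; rewrite -[f]reprK -[g]reprK; apply/eqmodP/asboolP; exact: fg.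
Qed.

Definition Hs0 : Hs := ofhat (sobolev0 s).
Definition HsD (f g : Hs) : Hs := ofhat (sobolevD (hatP f) (hatP g)).
Definition HsZ (a : R) (f : Hs) : Hs := ofhat (sobolevZ a (hatP f)).
Definition HsN (f : Hs) : Hs := HsZ (-1) f.

Lemma hat0 : {ae @leb2 R, forall xi, hat Hs0 xi = 0}.
Proof. exact: hat_ofhat. Qed.

Lemma hatD f g : {ae @leb2 R, forall xi, hat (HsD f g) xi = hat f xi + hat g xi}.
Proof. exact: hat_ofhat. Qed.

Lemma hatZ a f : {ae @leb2 R, forall xi, hat (HsZ a f) xi = a%:C *: hat f xi}.
Proof. exact: hat_ofhat. Qed.

Lemma HsDA : associative HsD.
Proof.
move=> f g h; apply: Hs_eq.
have a1 := hatD f (HsD g h); have a2 := hatD (HsD f g) h.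
have a3 := hatD f g; have a4 := hatD g h.
by near=> x; rewrite (near a1 x)// (near a2 x)// (near a3 x)// (near a4 x)// addrA.
Unshelve. all: by end_near. Qed.

Lemma HsDC : commutative HsD.
Proof.
move=> f g; apply: Hs_eq; have a1 := hatD f g; have a2 := hatD g f.
by near=> x; rewrite (near a1 x)// (near a2 x)// addrC.
Unshelve. all: by end_near. Qed.

Lemma Hs0D : left_id Hs0 HsD.
Proof.
move=> f; apply: Hs_eq; have a1 := hatD Hs0 f; have a2 := hat0.
by near=> x; rewrite (near a1 x)// (near a2 x)// add0r.
Unshelve. all: by end_near. Qed.

Lemma HsND : left_inverse Hs0 HsN HsD.
Proof.
move=> f; apply: Hs_eq; have a1 := hatD (HsN f) f; have a2 := hat0.
have a3 := hatZ (-1) f.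
near=> x; rewrite (near a1 x)// (near a2 x)// (near a3 x)//.
by rewrite rmorphN rmorph1 scaleN1r addNr.
Unshelve. all: by end_near. Qed.

HB.instance Definition _ := GRing.isZmodule.Build Hs HsDA HsDC Hs0D HsND.

Lemma HsZA a b f : HsZ a (HsZ b f) = HsZ (a * b) f.
Proof.
apply: Hs_eq; have a1 := hatZ a (HsZ b f); have a2 := hatZ b f.
have a3 := hatZ (a * b) f.
near=> x; rewrite (near a1 x)// (near a2 x)// (near a3 x)//.
by rewrite rmorphM scalerA.
Unshelve. all: by end_near. Qed.

Lemma Hs1Z : left_id 1 HsZ.
Proof.
move=> f; apply: Hs_eq; have a1 := hatZ 1 f.
by near=> x; rewrite (near a1 x)// rmorph1 scale1r.
Unshelve. all: by end_near. Qed.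

Lemma HsZDr : right_distributive HsZ +%R.
Proof.
move=> a f g; apply: Hs_eq; have a1 := hatZ a (HsD f g); have a2 := hatD f g.
have a3 := hatD (HsZ a f) (HsZ a g); have a4 := hatZ a f; have a5 := hatZ a g.
near=> x; rewrite (near a1 x)// (near a2 x)// (near a3 x)//.
by rewrite (near a4 x)// (near a5 x)// scalerDr.
Unshelve. all: by end_near. Qed.

Lemma HsZDl f : {morph HsZ^~ f : a b / a + b}.
Proof.
move=> a b; apply: Hs_eq; have a1 := hatZ (a + b) f.
have a3 := hatD (HsZ a f) (HsZ b f); have a4 := hatZ a f; have a5 := hatZ b f.
near=> x; rewrite (near a1 x)// (near a3 x)// (near a4 x)// (near a5 x)//.
by rewrite rmorphD scalerDl.
Unshelve. all: by end_near. Qed.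

HB.instance Definition _ :=
  GRing.Zmodule_isLmodule.Build R Hs HsZA Hs1Z HsZDr HsZDl.

Definition Hs_norm (f : Hs) : R := fine (sobolev_norm s (hat f)).

Lemma Hs_normE f : (Hs_norm f)%:E = sobolev_norm s (hat f).
Proof.
by rewrite fineK// ge0_fin_numE ?sobolev_ge0//; exact: (hatP f).2.
Qed.

Lemma Hs_normD f g : Hs_norm (f + g) <= Hs_norm f + Hs_norm g.
Proof.
rewrite -lee_fin EFinD !Hs_normE (sobolev_norm_ae s _ _ (hatD f g)).
- by apply: sobolev_normD; [exact: (hatP f).1|exact: (hatP g).1].
- exact: (hatP (f + g)).1.
- by apply: measurable_spinorD; [exact: (hatP f).1|exact: (hatP g).1].
Qed.

Lemma Hs_normZ a f : Hs_norm (a *: f) = `|a| * Hs_norm f.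
Proof.
apply: EFin_inj; rewrite EFinM !Hs_normE (sobolev_norm_ae s _ _ (hatZ a f)).
- by rewrite sobolev_normZ//; exact: (hatP f).1.
- exact: (hatP (a *: f)).1.
- by apply: measurable_spinorZ; exact: (hatP f).1.
Qed.

Lemma Hs_norm_eq0 f : Hs_norm f = 0 -> f = 0.
Proof.
move=> f0; apply: Hs_eq.
have a1 : {ae @leb2 R, forall xi, hat f xi = 0}.
  by apply: (@sobolev_norm_eq0 _ s); [exact: (hatP f).1|rewrite -Hs_normE f0].
by apply: filterS2 a1 hat0 => x -> ->.
Qed.

HB.instance Definition _ :=
  Lmodule_isNormed.Build R Hs Hs_normD Hs_normZ Hs_norm_eq0.

End SobolevSpace.

Section ContinuousCurves.
Variables (R : realType) (T : R) (V : normedModType R).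

(* C([-T, T]; V).  A function on [-T, T] is encoded as a function on R that
   vanishes outside [-T, T]. *)
Definition is_curve : {pred (R -> V)} := mem [set u : R -> V |
  {within `[- T, T], continuous u} /\ forall t, t \notin `[- T, T] -> u t = 0].

Record curve := Curve { curve_fun :> R -> V; curveP : curve_fun \in is_curve }.
HB.instance Definition _ := [isSub for curve_fun].
HB.instance Definition _ := [Choice of curve by <:].

Lemma is_curve_submod : submod_closed is_curve.
Proof.
split.
  by apply/mem_set; split => //; exact: continuous_subspaceT (fun=> cvg_cst 0).
move=> a u v /set_mem[cu u0] /set_mem[cv v0]; apply/mem_set; split.
  move=> t; apply: cvgD; last exact: cv.
  by apply: cvgZr; exact: cu.
by move=> t tT; rewrite /= !fctE u0// v0// scaler0 addr0.
Qed.

HB.instance Definition _ :=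
  GRing.isSubmodClosed.Build R (R -> V) is_curve is_curve_submod.
HB.instance Definition _ := [SubChoice_isSubLmodule of curve by <:].

Definition curve_norm (u : curve) : R := sup (range (fun t => `|u t|)).

Lemma curve_bounded (u : curve) : has_ubound (range (fun t => `|u t|)).
Proof.
have [cu u0] := set_mem (curveP u).
have /compact_bounded : compact (u @` `[- T, T]).
  by apply: continuous_compact => //; exact: segment_compact.
move=> [M [_ hM]]; exists (Num.max 0 (M + 1)) => _ [t _ <-].
have [tT|tT] := boolP (t \in `[- T, T]); last by rewrite u0// normr0 le_max lexx.
rewrite le_max; apply/orP; right; apply: hM; first by rewrite ltrDl.
by exists t.
Qed.

Lemma curve_norm_ub (u : curve) t : `|u t| <= curve_norm u.
Proof. by apply: ub_le_sup; [exact: curve_bounded|exists t]. Qed.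

Lemma curve_norm_le (u : curve) M : (forall t, `|u t| <= M) -> curve_norm u <= M.
Proof.
move=> uM; apply: ge_sup; first by exists `|u 0|; exists 0.
by move=> _ [t _ <-].
Qed.

Lemma curve_normD (u v : curve) : curve_norm (u + v) <= curve_norm u + curve_norm v.
Proof.
apply: curve_norm_le => t; rewrite /= !fctE.
by apply: le_trans (ler_normD _ _) _; rewrite lerD ?curve_norm_ub.
Qed.

Lemma curve_normZ (a : R) (u : curve) : curve_norm (a *: u) = `|a| * curve_norm u.
Proof.
have le_Z b (v : curve) : curve_norm (b *: v) <= `|b| * curve_norm v.
  apply: curve_norm_le => t; rewrite /= !fctE normrZ.
  by rewrite ler_wpM2l ?curve_norm_ub.
have [->|a0] := eqVneq a 0.
  apply/eqP; rewrite eq_le le_Z/= normr0 mul0r.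
  by apply: le_trans (curve_norm_ub _ 0); rewrite normr_ge0.
apply/eqP; rewrite eq_le le_Z/= -ler_pdivlMl ?normr_gt0// -normfV.
by have := le_Z a^-1 (a *: u); rewrite scalerA mulVf// scale1r.
Qed.

Lemma curve_norm_eq0 (u : curve) : curve_norm u = 0 -> u = 0.
Proof.
move=> u0; apply/val_inj/funext => t; apply/eqP.
by rewrite -normr_le0; have := curve_norm_ub u t; rewrite u0.
Qed.

HB.instance Definition _ :=
  Lmodule_isNormed.Build R curve curve_normD curve_normZ curve_norm_eq0.

End ContinuousCurves.

Section ThriceDifferentiable.
Variables (R : realType) (E F : normedModType R).

Definition bounded_linear (L : E -> F) : Prop :=
  linear L /\ exists M : R, forall h, `|L h| <= M * `|h|.

Definition bounded_bilinear (B : E -> E -> F) : Prop :=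
  [/\ forall h, linear (B h), forall k, linear (B ^~ k) &
      exists M : R, forall h k, `|B h k| <= M * `|h| * `|k| ].

Definition bounded_trilinear (C : E -> E -> E -> F) : Prop :=
  [/\ forall h k, linear (C h k), forall h l, linear (fun k => C h k l),
      forall k l, linear (fun h => C h k l) &
      exists M : R, forall h k l, `|C h k l| <= M * `|h| * `|k| * `|l| ].

(* D1, D2, D3 are the Frechet derivatives of order 1, 2, 3, the spaces
   L(E, L(E, F)) and L(E, L(E, L(E, F))) being identified with spaces of
   bounded multilinear maps.  The o(h) conditions on D1 and D2 and the
   continuity of D3 are in operator norm. *)
Definition C3_at (f : E -> F) (x : E) : Prop :=
  exists (D1 : E -> E -> F) (D2 : E -> E -> E -> F) (D3 : E -> E -> E -> E -> F),
    (\forall y \near x,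
      [/\ bounded_linear (D1 y),
          bounded_bilinear (D2 y) &
          bounded_trilinear (D3 y) ] /\
      forall e : R, 0 < e -> \forall h \near (0 : E),
        [/\ `|f (y + h) - f y - D1 y h| <= e * `|h|,
            forall k, `|D1 (y + h) k - D1 y k - D2 y h k| <= e * `|h| * `|k| &
            forall k l, `|D2 (y + h) k l - D2 y k l - D3 y h k l|
                          <= e * `|h| * `|k| * `|l| ]) /\
    (forall e : R, 0 < e -> \forall y \near x, forall h k l,
      `|D3 y h k l - D3 x h k l| <= e * `|h| * `|k| * `|l|).

End ThriceDifferentiable.

Section IntegralEquation.
Variable R : realType.
Local Notation plane := (plane R).
Local Notation spinor := (spinor R).
Local Notation C := R[i].

Definition dotp (x y : plane) : R := x.1 * y.1 + x.2 * y.2.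

Definition imC : C := 0 +i* 1.

Definition expi (a : R) : C := cos a +i* sin a.

Definition integralC d (X : measurableType d) (mu : {measure set X -> \bar R})
    (D : set X) (f : X -> C) : C :=
  (\int[mu]_(x in D) Re (f x)) +i* (\int[mu]_(x in D) Im (f x)).

(* The oriented integral from 0 to t. *)
Definition integral0 (t : R) (f : R -> C) : C :=
  if 0 <= t then integralC (@leb R) `[0, t] f
  else - integralC (@leb R) `[t, 0] f.

Definition integral0s (t : R) (f : R -> spinor) : spinor :=
  \col_i integral0 t (fun t' => f t' i 0).

Definition integrableC (F : plane -> C) : Prop :=
  (@leb2 R).-integrable setT (EFin \o (fun xi => Re (F xi))) /\
  (@leb2 R).-integrable setT (EFin \o (fun xi => Im (F xi))).

Definition inv_fourier (F : plane -> C) (x : plane) : C :=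
  ((2 * pi) ^+ 2)^-1%:C *
    integralC (@leb2 R) setT (fun xi => expi (dotp x xi) * F xi).

(* The Fourier transform of a function of the form inv_fourier F with F
   integrable; F is then unique up to equality almost everywhere.  (Such a
   function need not be integrable: D^-1 (psi^dagger psi) is not.) *)
Definition fourier (h : plane -> C) : plane -> C :=
  xget (fun=> 0) [set F | integrableC F /\ h = inv_fourier F].

Definition multiplier (m : plane -> C) (h : plane -> C) : plane -> C :=
  inv_fourier (fun xi => m xi * fourier h xi).

Definition multiplier_mx (m : plane -> 'M[C]_2) (h : plane -> spinor)
    (x : plane) : spinor :=
  \col_i \sum_j multiplier (fun xi => m xi i j) (fun y => h y j 0) x.

(* The sign true stands for +, false for -. *)
Definition sg (b : bool) : R := if b then 1 else -1.

(* Skew-symmetric, with epsilon 0 1 2 = 1. *)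
Definition epsilon (mu nu lam : 'I_3) : C :=
  ((nu%:R - mu%:R) * (lam%:R - mu%:R) * (lam%:R - nu%:R)) / 2%:R.

Definition alpha (mu : 'I_3) : 'M[C]_2 :=
  if mu == 0 then 1%:M
  else if mu == 1 then \matrix_(i, j) (i != j)%:R
  else \matrix_(i, j) (if i == j then 0 else if (i < j)%N then - imC else imC).

Definition freq (xi : plane) (j : 'I_3) : R :=
  if j == 1 then xi.1 else xi.2.

Definition U_symbol (b : bool) (t : R) (xi : plane) : C :=
  expi (- sg b * t * plane_norm xi).

Definition U (b : bool) (t : R) : (plane -> C) -> plane -> C :=
  multiplier (U_symbol b t).

Definition Us (b : bool) (t : R) : (plane -> spinor) -> plane -> spinor :=
  multiplier_mx (fun xi => (U_symbol b t xi)%:M).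

Definition Pi (b : bool) : (plane -> spinor) -> plane -> spinor :=
  multiplier_mx (fun xi => 2^-1%:C *: (1%:M +
    (sg b)%:C *: \sum_(j < 3 | j != 0) (freq xi j / plane_norm xi)%:C *: alpha j)).

Definition Dinv : (plane -> C) -> plane -> C :=
  multiplier (fun xi => (plane_norm xi)^-1%:C).

(* For mu = j this is -+ d_j / (i D), with d_j of symbol i xi_j. *)
Definition Riesz (b : bool) (mu : 'I_3) : (plane -> C) -> plane -> C :=
  multiplier (fun xi =>
    if mu == 0 then -1 else (- sg b * freq xi mu / plane_norm xi)%:C).

Definition current (lam : 'I_3) (psi : plane -> spinor) (x : plane) : C :=
  ((map_mx (@conjc R) (psi x))^T *m alpha lam *m psi x) 0 0.

(* The potential produced by the initial data. *)
Definition A_data (b : bool) (psi0 : plane -> spinor) (nu : 'I_3) (t : R) :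
    plane -> C :=
  U b t (fun y => (sg b)%:C *
    Dinv (fun z => \sum_(lam < 3) epsilon 0 nu lam * current lam psi0 z) y).

Definition A_nonlin (b : bool) (psi : R -> plane -> spinor) (nu : 'I_3) (t : R)
    (x : plane) : C :=
  integral0 t (fun t' => U b (t - t') (fun y => \sum_(mu < 3)
    Riesz b mu (fun z =>
      \sum_(lam < 3) epsilon mu nu lam * current lam (psi t') z) y) x).

Definition potential_mul (A : 'I_3 -> plane -> C) (psi : plane -> spinor)
    (x : plane) : spinor :=
  \sum_(nu < 3) alpha nu *m (A nu x *: psi x).

Definition integral_equation (T : R) (psi0 : plane -> spinor)
    (psi : R -> plane -> spinor) : Prop :=
  forall t, t \in `[- T, T] -> forall x,
    psi t x =
      \sum_(b : bool) Us b t (Pi b psi0) x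
      - 2^-1%:C *: \sum_(b1 : bool) \sum_(b2 : bool)
          integral0s t (fun t' => Us b1 (t - t') (Pi b1
            (potential_mul (fun nu => A_data b2 psi0 nu t') (psi t'))) x)
      + imC *: \sum_(b1 : bool) \sum_(b2 : bool)
          integral0s t (fun t' => Us b1 (t - t') (Pi b1
            (potential_mul (fun nu => A_nonlin b2 psi nu t') (psi t'))) x).

(* For s > 1 an element of H^s has an integrable Fourier transform and hence a
   continuous representative, which is this function. *)
Definition pointwise (s : R) (f : Hs s) (x : plane) : spinor :=
  \col_i inv_fourier (fun xi => hat f xi i 0) x.

Definition same_distribution (s s' : R) (f : Hs s) (g : Hs s') : Prop :=
  {ae @leb2 R, forall xi, hat f xi = hat g xi}.

(* For s < 0 the products in the integral equation have no direct meaning on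
   H^s.  A flow map on H^s is one that yields the solution of the integral
   equation for small data in some H^sigma with sigma > 1, where every term of
   the equation is classically defined. *)
Definition flow_map (s T : R) (S : Hs s -> curve T (Hs s)) : Prop :=
  exists sigma r : R, [/\ 1 < sigma, 0 < r &
    forall f0 : Hs sigma, `|f0| < r ->
      exists f : curve T (Hs sigma),
        integral_equation T (pointwise f0) (fun t => pointwise (f t)) /\
        forall psi0 : Hs s, same_distribution psi0 f0 ->
          forall t, t \in `[- T, T] -> same_distribution (S psi0 t) (f t)].

End IntegralEquation.

(* Main.v *)
Require Import Defs.
From HB Require Import structures.
From mathcomp Require Import all_boot all_order all_algebra.
From mathcomp Require Import complex.
From mathcomp Require Import all_classical all_reals all_analysis.
From mathcomp Require Import measurable_realfun.
From mathcomp Require Import ring lra.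

(** Why the flow map is not of class C^3.

    The data are d h, where h has the Fourier transform (1_Q0, 1_Q1) for two
    squares of side N at distance about N from the origin and on opposite sides
    of it, and the solution is observed on Q0 at time t = e/N with e a small
    absolute constant. Over such a time no wave of frequency O(N) oscillates, so
    the propagators are close to the identity and the solution can be expanded
    explicitly ([pair_solution]): up to a linear term and a relative error O(e)
    its first component is t^2 conj(phi_1) phi_1 phi_0. Indeed, the current
    K_nu of the data produces the potential i t K_nu through the term with the
    initial data ([wn_data_lead]) and - 2 i t K_nu through the other nonlinear
    term ([wn_nonlin_lead]), together - i t K_nu ([wn_potential_lead]); the
    algebra of the Pauli matrices leaves a single product ([interaction_lead]);
    and the integral of 2 s from 0 to t is t^2. All transforms in this product
    are nonnegative, and its frequencies cover a large part of Q0, which gives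
    the lower bound d^3 t^2 N^6 = d^3 e^2 N^4, up to a constant, for its integral
    over Q0 ([pair_cubic_ge]).

    On the other hand, if the flow map has three continuous derivatives at 0, the
    third difference of its values at d h, 2 d h, 3 d h, 4 d h is at most
    M |h|^3 d^3, with M and the admissible range of d |h| fixed
    ([third_difference]). Third differences remove the linear term. With data of
    size |h| = O(N^(1 + s)) and a functional of norm O(N^(1 - s)) the bound is
    d^3 N^(4 + 2 s). Since s < 0, the comparison e^2 N^4 = O(N^(4 + 2 s)) fails
    for large N ([growth]). The size d may depend on N in an arbitrary way, so
    that smallness of the data never competes with the choice of N.

    The expansion takes place in the Wiener algebra, the functions with integrable
    Fourier transform normed by the integral of its modulus. It contains the
    smooth solutions that a flow map must produce, it is an algebra, and Fourier
    multipliers with bounded symbols act on it. The transform of such a function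
    is well defined because an integrable function with vanishing Fourier
    integral is zero ([fourier_unique0]). The time integrals in the equation are
    pointwise in x; that their transforms are the integrals of the transforms is
    [time_integral_transform]. This turns the equation into scalar Duhamel
    formulas in the Wiener algebra ([component_equation]). A bootstrap keeps the
    solution comparable to its data up to time t ([solution_bound],
    [solution_close]), and the symbol of the inverse of D in the potential is
    harmless because it only meets frequencies of size at least N
    ([far_data]). *)

Import Order.TTheory GRing.Theory Num.Theory.
Import numFieldNormedType.Exports.

Local Open Scope classical_set_scope.
Local Open Scope ring_scope.
Local Open Scope complex_scope.

Set Implicit Arguments.
Unset Strict Implicit.
Unset Printing Implicit Defensive.

Local Notation Re := complex.Re (only parsing).
Local Notation Im := complex.Im (only parsing).
Local Notation nc := Normc.normc.

(** * Complex-valued integration *)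

Section ComplexNorm.
Variable R : realType.
Implicit Types z w : R[i].

Lemma nc_ge0 z : 0 <= nc z.
Proof. exact: normc_ge0. Qed.

Lemma nc0 : nc (0 : R[i]) = 0.
Proof. exact: Normc.normc0. Qed.

Lemma Re_le_nc z : `|Re z| <= nc z.
Proof.
case: z => a b /=; rewrite -sqrtr_sqr ler_sqrt ?addr_ge0 ?sqr_ge0//.
by rewrite lerDl sqr_ge0.
Qed.

Lemma Im_le_nc z : `|Im z| <= nc z.
Proof.
case: z => a b /=; rewrite -sqrtr_sqr ler_sqrt ?addr_ge0 ?sqr_ge0//.
by rewrite lerDr sqr_ge0.
Qed.

Lemma nc_le z : nc z <= `|Re z| + `|Im z|.
Proof.
case: z => a b /=.
rewrite -(ler_pXn2r (ltn0Sn 1)) ?nnegrE ?sqrtr_ge0 ?addr_ge0//.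
rewrite sqr_sqrtr ?addr_ge0 ?sqr_ge0// sqrrD !real_normK ?num_real//.
by rewrite addrAC lerDl mulrn_wge0// mulr_ge0.
Qed.

Lemma ncD z w : nc (z + w) <= nc z + nc w.
Proof. exact: le_normcD. Qed.

Lemma ncN z : nc (- z) = nc z.
Proof. exact: normcN. Qed.

Lemma ncB z w : nc (z - w) <= nc z + nc w.
Proof. by rewrite -[in leRHS](ncN w) ncD. Qed.

Lemma ncM z w : nc (z * w) = nc z * nc w.
Proof. exact: Normc.normcM. Qed.

Lemma nc_conj z : nc (conjc z) = nc z.
Proof. by case: z => a b /=; rewrite sqrrN. Qed.

Lemma nc_real (a : R) : nc a%:C = `|a|.
Proof. exact: normc_real. Qed.

Lemma ncR (a : R) : 0 <= a -> nc a%:C = a.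
Proof. by move=> a0; rewrite nc_real ger0_norm. Qed.

Lemma nc_i : nc (imC R) = 1.
Proof. by rewrite /imC /= expr0n/= add0r expr1n sqrtr1. Qed.

Lemma nc_sum (I : Type) (r : seq I) (P : pred I) (F : I -> R[i]) :
  nc (\sum_(i <- r | P i) F i) <= \sum_(i <- r | P i) nc (F i).
Proof.
elim/big_ind2 : _ => //; first by rewrite nc0.
by move=> a b c d ab cd; rewrite (le_trans (ncD _ _))// lerD.
Qed.

Lemma nc_expi (a : R) : nc (expi a) = 1.
Proof. by rewrite /expi /= cos2Dsin2 sqrtr1. Qed.

Lemma ReD z w : Re (z + w) = Re z + Re w. Proof. by case: z => ? ?; case: w. Qed.
Lemma ImD z w : Im (z + w) = Im z + Im w. Proof. by case: z => ? ?; case: w. Qed.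
Lemma ReM z w : Re (z * w) = Re z * Re w - Im z * Im w.
Proof. by case: z => ? ?; case: w. Qed.
Lemma ImM z w : Im (z * w) = Re z * Im w + Im z * Re w.
Proof. by case: z => a b; case: w => c d /=; rewrite addrC. Qed.
Lemma complexP z w : Re z = Re w -> Im z = Im w -> z = w.
Proof. by case: z; case: w => a b c d /= -> ->. Qed.

Lemma expiD (a b : R) : expi (a + b) = expi a * expi b.
Proof.
by apply: complexP; rewrite ?ReM ?ImM /expi /= ?cosD ?sinD// addrC.
Qed.

Lemma expi0 : expi 0 = 1 :> R[i].
Proof. by rewrite /expi cos0 sin0. Qed.

Lemma expiN (a : R) : expi (- a) = conjc (expi a).
Proof. by rewrite /expi cosN sinN. Qed.

Lemma conj_realM (a : R) z : conjc (a%:C * z) = a%:C * conjc z.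
Proof. by case: z => x y; apply: complexP => /=; ring. Qed.

Lemma sin_bound (a : R) : `|sin a| <= `|a|.
Proof.
wlog a0 : a / 0 < a.
  move=> h; have [a0|a0|<-] := ltgtP 0 a; first exact: h.
    by rewrite -normrN -sinN -[leRHS]normrN h// oppr_gt0.
  by rewrite sin0.
have [c _] := @MVT R sin cos 0 a a0 (fun x _ => is_derive_sin x)
  (continuous_subspaceT (@continuous_sin R)).
rewrite sin0 !subr0 => ->.
by rewrite normrM ler_piMl// cos_max.
Qed.

Lemma cos_sub1_bound (a : R) : `|cos a - 1| <= `|a|.
Proof.
wlog a0 : a / 0 < a.
  move=> h; have [a0|a0|<-] := ltgtP 0 a; first exact: h.
    by rewrite -cosN -[leRHS]normrN h// oppr_gt0.
  by rewrite cos0 subrr.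
have [c _] := @MVT R cos (fun x => - sin x) 0 a a0 (fun x _ => is_derive_cos x)
  (continuous_subspaceT (@continuous_cos R)).
rewrite cos0 !subr0 => ->.
by rewrite normrM normrN ler_piMl// sin_max.
Qed.

(** A quadratic remainder is all that is needed, and the mean value theorem
    yields it from the bound on [cos a - 1]. *)
Lemma sin_sub_bound (a : R) : 0 <= a -> `|sin a - a| <= a ^+ 2.
Proof.
rewrite le_eqVlt => /predU1P[<-|a0]; first by rewrite sin0 subrr normr0 sqr_ge0.
have [c] := @MVT R sin cos 0 a a0 (fun x _ => is_derive_sin x)
  (continuous_subspaceT (@continuous_sin R)).
rewrite in_itv/= => /andP[c0 ca]; rewrite sin0 !subr0 => ->.
rewrite -{2}[a]mul1r -mulrBl normrM (gtr0_norm a0) expr2 ler_pM2r//.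
by rewrite (le_trans (cos_sub1_bound _))// gtr0_norm// ltW.
Qed.

Lemma expi_sub1 (a : R) : nc (expi a - 1) <= 2 * `|a|.
Proof.
apply: le_trans (nc_le _) _; rewrite mulr_natl mulr2n lerD//.
  exact: cos_sub1_bound.
by rewrite /expi /= subr0 sin_bound.
Qed.

Lemma nc_rotate z : exists2 w : R[i], nc w <= 1 & Re (w * z) = nc z.
Proof.
have [z0|z0] := eqVneq (nc z) 0.
  exists 0; first by rewrite nc0.
  by rewrite z0 mul0r.
have zp : 0 < nc z by rewrite lt_neqAle eq_sym z0 nc_ge0.
exists (((nc z)^-1)%:C * conjc z).
  by rewrite ncM nc_conj nc_real gtr0_norm ?invr_gt0// mulVf.
have sq : nc z ^+ 2 = Re z ^+ 2 + Im z ^+ 2.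
  by case: (z) => a b /=; rewrite sqr_sqrtr// addr_ge0 ?sqr_ge0.
have -> : Re (((nc z)^-1)%:C * conjc z * z) = (nc z)^-1 * (Re z ^+ 2 + Im z ^+ 2).
  by rewrite !(ReM, ImM) /=; case: (z) => a b /=; ring.
by rewrite -sq expr2 mulrA mulVf// mul1r.
Qed.

End ComplexNorm.

Section ComplexIntegral.
Context d (X : measurableType d) (R : realType).
Variable mu : {measure set X -> \bar R}.
Implicit Types (f g : X -> R[i]) (D : set X).

Definition cmeasurable D f :=
  measurable_fun D (fun x => Re (f x)) /\ measurable_fun D (fun x => Im (f x)).

Definition cintegrable D f :=
  mu.-integrable D (EFin \o (fun x => Re (f x))) /\
  mu.-integrable D (EFin \o (fun x => Im (f x))).

Lemma cmeasurableD D f g : cmeasurable D f -> cmeasurable D g ->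
  cmeasurable D (fun x => f x + g x).
Proof.
move=> [f1 f2] [g1 g2]; split.
  by under eq_fun do rewrite ReD; exact: measurable_funD.
by under eq_fun do rewrite ImD; exact: measurable_funD.
Qed.

Lemma cmeasurableM D f g : cmeasurable D f -> cmeasurable D g ->
  cmeasurable D (fun x => f x * g x).
Proof.
move=> [f1 f2] [g1 g2]; split.
  under eq_fun do rewrite ReM.
  by apply: measurable_funB; exact: measurable_funM.
under eq_fun do rewrite ImM.
by apply: measurable_funD; exact: measurable_funM.
Qed.

Lemma cmeasurable_cst D (z : R[i]) : cmeasurable D (fun=> z).
Proof. by split; exact: measurable_cst. Qed.

Lemma cmeasurable_real D (h : X -> R) :
  measurable_fun D h -> cmeasurable D (fun x => (h x)%:C).
Proof. by move=> mh; split => //=; exact: measurable_cst. Qed.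

Lemma cmeasurable_conj D f : cmeasurable D f ->
  cmeasurable D (fun x => conjc (f x)).
Proof.
move=> [f1 f2]; split.
  by rewrite (_ : (fun x => _) = (fun x => Re (f x)))//;
    apply/funext => x; case: (f x).
rewrite (_ : (fun x => _) = (fun x => - Im (f x))).
  exact: measurableT_comp.
by apply/funext => x; case: (f x).
Qed.

Lemma cmeasurable_expi D (h : X -> R) :
  measurable_fun D h -> cmeasurable D (fun x => expi (h x)).
Proof.
move=> mh; split.
  by apply: measurableT_comp mh; exact: continuous_measurable_fun (@continuous_cos R).
by apply: measurableT_comp mh; exact: continuous_measurable_fun (@continuous_sin R).
Qed.

Lemma cmeasurable_sum D (I : Type) (r : seq I) (P : pred I) (F : I -> X -> R[i]) :
  (forall i, cmeasurable D (F i)) ->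
  cmeasurable D (fun x => \sum_(i <- r | P i) F i x).
Proof.
move=> mF; elim: r => [|a r ih].
  by under eq_fun do rewrite big_nil; exact: cmeasurable_cst.
under eq_fun do rewrite big_cons.
by case: (P a) => //; exact: cmeasurableD.
Qed.

Lemma measurable_nc D f : cmeasurable D f ->
  measurable_fun D (fun x => nc (f x)).
Proof.
move=> [f1 f2].
rewrite (_ : (fun x => _) = (@Num.sqrt R) \o (fun x => Re (f x) ^+ 2 + Im (f x) ^+ 2));
  last by apply/funext => x /=; case: (f x).
apply: measurableT_comp; first exact: continuous_measurable_fun (@sqrt_continuous R).
by apply: measurable_funD; apply: measurable_funX.
Qed.

Lemma integrable_le D (f g : X -> R) : measurable D -> measurable_fun D f ->
  mu.-integrable D (EFin \o g) -> (forall x, D x -> `|f x| <= g x) ->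
  mu.-integrable D (EFin \o f).
Proof.
move=> mD mf ig fg; apply: le_integrable ig => //; first exact/measurable_EFinP.
by move=> x Dx /=; rewrite lee_fin (le_trans (fg _ Dx))// ler_norm.
Qed.

Lemma rintegrableZ D (r : R) (f : X -> R) : measurable D ->
  mu.-integrable D (EFin \o f) ->
  mu.-integrable D (EFin \o (fun x => r * f x)).
Proof.
move=> mD fi.
rewrite (_ : EFin \o _ = (fun x => r%:E * (EFin \o f) x))%E//.
exact: integrableZl.
Qed.

Lemma cintegrable_le D f (g : X -> R) : measurable D -> cmeasurable D f ->
  mu.-integrable D (EFin \o g) -> (forall x, D x -> nc (f x) <= g x) ->
  cintegrable D f.
Proof.
move=> mD [f1 f2] ig fg; split; apply: integrable_le ig _ => // x Dx.
  by rewrite (le_trans (Re_le_nc _))// fg.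
by rewrite (le_trans (Im_le_nc _))// fg.
Qed.

Lemma cintegrable_meas D f : cintegrable D f -> cmeasurable D f.
Proof.
by move=> [/(measurable_int mu)/measurable_EFinP ? /(measurable_int mu)/measurable_EFinP ?].
Qed.

Lemma cintegrable_nc D f : measurable D -> cintegrable D f ->
  mu.-integrable D (EFin \o (fun x => nc (f x))).
Proof.
move=> mD cf; have [i1 i2] := cf.
have : mu.-integrable D (EFin \o (fun x => `|Re (f x)| + `|Im (f x)|)).
  rewrite (_ : EFin \o _ = (abse \o (EFin \o (fun x => Re (f x)))) \+
    (abse \o (EFin \o (fun x => Im (f x)))))%E//.
  by apply: integrableD => //; exact: integrable_abse.
move/integrable_le; apply => //; first exact: measurable_nc (cintegrable_meas cf).
by move=> x _; rewrite ger0_norm ?nc_ge0// nc_le.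
Qed.

Lemma cintegrableD D f g : measurable D -> cintegrable D f -> cintegrable D g ->
  cintegrable D (fun x => f x + g x).
Proof.
move=> mD f1 g1; apply: (@cintegrable_le _ _ (fun x => nc (f x) + nc (g x))) => //.
- by apply: cmeasurableD; exact: cintegrable_meas.
- rewrite (_ : EFin \o _ = (EFin \o (fun x => nc (f x))) \+ (EFin \o (fun x => nc (g x))))%E//.
  by apply: integrableD => //; exact: cintegrable_nc.
- by move=> x _; exact: ncD.
Qed.

Lemma cintegrableMl D (m : X -> R[i]) f (M : R) : measurable D ->
  cmeasurable D m -> (forall x, D x -> nc (m x) <= M) -> cintegrable D f ->
  cintegrable D (fun x => m x * f x).
Proof.
move=> mD mm mM cf.
have h := rintegrableZ M mD (cintegrable_nc mD cf).
apply: (@cintegrable_le _ _ (fun x => M * nc (f x))) => //.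
  by apply: cmeasurableM => //; exact: cintegrable_meas.
by move=> x Dx; rewrite ncM ler_wpM2r ?nc_ge0 ?mM.
Qed.

Lemma cintegrableZ D (z : R[i]) f : measurable D -> cintegrable D f ->
  cintegrable D (fun x => z * f x).
Proof.
move=> mD; apply: (@cintegrableMl _ (fun=> z) _ (nc z)) => //.
Qed.

Lemma cintegrableN D f : measurable D -> cintegrable D f ->
  cintegrable D (fun x => - f x).
Proof.
move=> mD /(@cintegrableZ _ (-1) _ mD).
by under eq_fun do rewrite mulN1r.
Qed.

Lemma cintegrableB D f g : measurable D -> cintegrable D f -> cintegrable D g ->
  cintegrable D (fun x => f x - g x).
Proof. by move=> mD f1 g1; apply: cintegrableD => //; exact: cintegrableN. Qed.

Lemma cintegrable0 D : cintegrable D (fun=> 0).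
Proof.
by split; rewrite (_ : EFin \o _ = cst 0)%E//; exact: integrable0.
Qed.

Lemma cintegralD D f g : measurable D -> cintegrable D f -> cintegrable D g ->
  integralC mu D (fun x => f x + g x) = integralC mu D f + integralC mu D g.
Proof.
move=> mD [f1 f2] [g1 g2]; apply: complexP; rewrite ?ReD ?ImD /=.
  by under eq_Rintegral do rewrite ReD; rewrite RintegralD.
by under eq_Rintegral do rewrite ImD; rewrite RintegralD.
Qed.

Lemma cintegralZ D (z : R[i]) f : measurable D -> cintegrable D f ->
  integralC mu D (fun x => z * f x) = z * integralC mu D f.
Proof.
move=> mD [f1 f2]; rewrite /integralC; apply: complexP.
  rewrite ReM /=; under eq_Rintegral do rewrite ReM.
  by rewrite RintegralB ?RintegralZl//; exact: rintegrableZ.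
rewrite ImM /=; under eq_Rintegral do rewrite ImM.
by rewrite RintegralD ?RintegralZl//; exact: rintegrableZ.
Qed.

Lemma cintegralN D f : measurable D -> cintegrable D f ->
  integralC mu D (fun x => - f x) = - integralC mu D f.
Proof.
move=> mD f1; rewrite -mulN1r -cintegralZ//.
by under eq_fun do rewrite -mulN1r.
Qed.

Lemma cintegralB D f g : measurable D -> cintegrable D f -> cintegrable D g ->
  integralC mu D (fun x => f x - g x) = integralC mu D f - integralC mu D g.
Proof.
by move=> mD f1 g1; rewrite cintegralD ?cintegralN//; exact: cintegrableN.
Qed.

Lemma eq_cintegral D f g : {in D, f =1 g} -> integralC mu D f = integralC mu D g.
Proof.
by move=> fg; congr (_ +i* _); apply: eq_Rintegral => x Dx; rewrite fg.
Qed.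

Lemma cintegral0 D : integralC mu D (fun=> 0) = 0.
Proof. by rewrite /integralC /Rintegral integral0. Qed.

(** Rotating the integral onto the positive real axis reduces the triangle
    inequality to monotonicity of a real integral. *)
Lemma nc_cintegral D f : measurable D -> cintegrable D f ->
  nc (integralC mu D f) <= \int[mu]_(x in D) nc (f x).
Proof.
move=> mD cf; set I := integralC mu D f.
have [w w1 wI] := nc_rotate I.
rewrite -wI -cintegralZ//= le_Rintegral//.
- by have [] := cintegrableZ w mD cf.
- exact: cintegrable_nc.
- move=> x Dx; rewrite (le_trans (ler_norm _))// (le_trans (Re_le_nc _))//.
  by rewrite ncM ler_piMl ?nc_ge0.
Qed.

Lemma ae_eq_cintegral f g : cmeasurable setT f -> cmeasurable setT g ->
  {ae mu, forall x, f x = g x} -> integralC mu setT f = integralC mu setT g.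
Proof.
move=> [f1 f2] [g1 g2] fg; rewrite /integralC /Rintegral; congr (fine _ +i* fine _).
  apply: ae_eq_integral => //; [exact/measurable_EFinP|exact/measurable_EFinP|].
  by apply: filterS fg => x -> _.
apply: ae_eq_integral => //; [exact/measurable_EFinP|exact/measurable_EFinP|].
by apply: filterS fg => x -> _.
Qed.

Lemma ae_eq_Rintegral (f g : X -> R) : measurable_fun setT f -> measurable_fun setT g ->
  {ae mu, forall x, f x = g x} -> \int[mu]_x f x = \int[mu]_x g x.
Proof.
move=> f1 g1 fg; rewrite /Rintegral; congr fine.
apply: ae_eq_integral => //; [exact/measurable_EFinP|exact/measurable_EFinP|].
by apply: filterS fg => x -> _.
Qed.

Lemma dominated_cvg0 D (u : nat -> X -> R) (g : X -> R) : measurable D ->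
  (forall n, measurable_fun D (u n)) ->
  mu.-integrable D (EFin \o g) ->
  (forall n x, D x -> 0 <= u n x <= g x) ->
  (forall x, D x -> u ^~ x @ \oo --> (0 : R)) ->
  \int[mu]_(x in D) u n x @[n --> \oo] --> (0 : R).
Proof.
move=> mD mu_ ig ug u0.
have := @dominated_convergence _ _ _ mu D mD (fun n x => (u n x)%:E) (fun=> 0%E) (EFin \o g).
case.
- by move=> n; exact/measurable_EFinP.
- exact: measurable_cst.
- by apply: nearW => x Dx; apply: cvg_EFin; [exact: nearW|exact: u0].
- exact: ig.
- apply: nearW => x n Dx /=; rewrite lee_fin; have /andP[a b] := ug n x Dx.
  by rewrite ger0_norm.
- move=> _ _; rewrite integral0 => h.
  have := fine_cvg h; apply.
Qed.

(** Convergence is expressed through real sequences of moduli, which spares a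
    topology on the complex numbers. *)
Lemma cdominated_cvg D (u : nat -> X -> R[i]) f (g : X -> R) : measurable D ->
  (forall n, cmeasurable D (u n)) -> cmeasurable D f ->
  mu.-integrable D (EFin \o g) ->
  (forall n x, D x -> nc (u n x) <= g x) ->
  (forall x, D x -> nc (u n x - f x) @[n --> \oo] --> (0 : R)) ->
  [/\ cintegrable D f, (forall x, D x -> nc (f x) <= g x),
   \int[mu]_(x in D) nc (u n x - f x) @[n --> \oo] --> (0 : R) &
   nc (integralC mu D (u n) - integralC mu D f) @[n --> \oo] --> (0 : R)].
Proof.
move=> mD mu_ mf ig ug u0.
have fg x : D x -> nc (f x) <= g x.
  move=> Dx; apply/ler_addgt0Pr => e e0.
  have /cvgrPdist_lt/(_ _ e0)[N _ /(_ N (leqnn _))] := u0 x Dx.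
  rewrite /= sub0r normrN ger0_norm ?nc_ge0// => h.
  have -> : f x = u N x - (u N x - f x) by rewrite subKr.
  by rewrite (le_trans (ncB _ _))// lerD ?ug// ltW.
have cf : cintegrable D f by exact: cintegrable_le ig fg.
have cu n : cintegrable D (u n) by apply: cintegrable_le ig (ug n).
have c1 : \int[mu]_(x in D) nc (u n x - f x) @[n --> \oo] --> (0 : R).
  apply: (@dominated_cvg0 _ _ (fun x => 2 * g x)) => //.
  - by move=> n; apply: measurable_nc; apply: cintegrable_meas; exact: cintegrableB.
  - exact: rintegrableZ.
  - move=> n x Dx; rewrite nc_ge0/= mulr_natl mulr2n.
    by rewrite (le_trans (ncB _ _))// lerD ?ug ?fg.
split => //.
apply: (@squeeze_cvgr _ _ _ _ (cst 0)) c1; last exact: cvg_cst.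
apply: nearW => n; apply/andP; split; first exact: nc_ge0.
rewrite -cintegralB//; apply: nc_cintegral => //.
exact: cintegrableB.
Qed.

End ComplexIntegral.

(** * Fubini and the symmetries of the plane measure *)

Section ComplexFubini.
Context d1 d2 (T1 : measurableType d1) (T2 : measurableType d2) (R : realType).
Variable m1 : {sigma_finite_measure set T1 -> \bar R}.
Variable m2 : {sigma_finite_measure set T2 -> \bar R}.

Lemma integrable_fine d (X : measurableType d) (mu : {measure set X -> \bar R})
    (F : X -> \bar R) : mu.-integrable setT F ->
  mu.-integrable setT (EFin \o (fun x => fine (F x))) /\
  \int[mu]_x fine (F x) = fine (\int[mu]_x F x)%E.
Proof.
move=> iF; have mF := measurable_int mu iF.
have mf : measurable_fun setT (EFin \o (fun x => fine (F x))).
  by apply/measurable_EFinP; exact: measurableT_comp.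
split.
  apply: le_integrable iF => // x _ /=.
  by case: (F x) => [r||] //=; rewrite ?normr0 ?leey.
rewrite /Rintegral; congr fine; apply: ae_eq_integral => //.
have := integrable_ae measurableT iF; apply: filterS => x /(_ I) fx _ /=.
by rewrite fineK.
Qed.

Lemma Rfubini (f : T1 * T2 -> R) :
  (m1 \x m2)%E.-integrable setT (EFin \o f) ->
  [/\ m1.-integrable setT (EFin \o (fun x => \int[m2]_y f (x, y))),
      m2.-integrable setT (EFin \o (fun y => \int[m1]_x f (x, y))),
   \int[m1]_x \int[m2]_y f (x, y) = \int[(m1 \x m2)%E]_z f z &
   \int[m2]_y \int[m1]_x f (x, y) = \int[(m1 \x m2)%E]_z f z].
Proof.
move=> fi.
have [iF eF] := integrable_fine (integrable_fubini_F fi).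
have iG0 : m2.-integrable setT (fubini_G m1 (EFin \o f)).
  apply/integrableP; split; first exact: (measurable_fubini_G fi).
  have mf := measurable_int _ fi.
  have /(integrable21ltyP m1 m2 mf) := fi; apply: le_lt_trans.
  apply: ge0_le_integral => //.
  - by apply: measurableT_comp => //; exact: (measurable_fubini_G fi).
  - apply: (measurable_fun_fubini_tonelli_G (abse \o (EFin \o f))) => //=.
    exact: measurableT_comp.
  - move=> y _; apply: le_abse_integral => //.
    by apply: measurableT_comp => //.
have [iG eG] := integrable_fine iG0.
split => //.
- by rewrite [LHS]eF integral12_prod_meas1.
- by rewrite [LHS]eG integral21_prod_meas1.
Qed.

Lemma cfubini (f : T1 * T2 -> R[i]) :
  cintegrable (m1 \x m2)%E setT f ->
  [/\ cintegrable m1 setT (fun x => integralC m2 setT (fun y => f (x, y))),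
      cintegrable m2 setT (fun y => integralC m1 setT (fun x => f (x, y))) &
   integralC m1 setT (fun x => integralC m2 setT (fun y => f (x, y))) =
   integralC m2 setT (fun y => integralC m1 setT (fun x => f (x, y))) /\
   {ae m2, forall y, cintegrable m1 setT (fun x => f (x, y))}].
Proof.
move=> [f1 f2]; have k1 := ae_integrable2 f1; have k2 := ae_integrable2 f2.
move: f1 f2 => /Rfubini[a1 b1 c1 e1] /Rfubini[a2 b2 c2 e2]; split => //; split.
  by apply: complexP => /=; rewrite ?c1 ?c2 ?e1 ?e2.
by apply: filterS2 k1 k2 => y l1 l2.
Qed.

(** Tonelli's criterion, with an integrable dominating function whose inner
    integrals are known. *)
Lemma integrable_prod (f : T1 * T2 -> R) (g : T1 -> R) :
  measurable_fun setT f -> (forall z, 0 <= f z) ->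
  (forall x, m2.-integrable setT (EFin \o (fun y => f (x, y)))) ->
  (forall x, \int[m2]_y f (x, y) = g x) ->
  m1.-integrable setT (EFin \o g) ->
  (m1 \x m2)%E.-integrable setT (EFin \o f).
Proof.
move=> mf f0 fi fg gi.
have mEf : measurable_fun setT (EFin \o f) by exact/measurable_EFinP.
apply/(integrable12ltyP m1 m2 mEf).
under eq_integral => x _.
  under eq_integral => y _ do rewrite /= ger0_norm//.
  have := fg x; rewrite /Rintegral => h.
  have -> : (\int[m2]_y (f (x, y))%:E)%E = (g x)%:E.
    by rewrite -h fineK//; have := integrable_fin_num measurableT (fi x).
  over.
have := integrable_fin_num measurableT gi; rewrite fin_numElt => /andP[_].
done.
Qed.

End ComplexFubini.

Section MeasurePreserving.
Context d (X : measurableType d) (R : realType).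
Variable mu : {measure set X -> \bar R}.
Variable phi : X -> X.
Hypothesis mphi : measurable_fun setT phi.
Hypothesis muphi : forall A, measurable A -> mu (phi @^-1` A) = mu A.

Let eint (g : X -> \bar R) : measurable_fun setT g -> (forall x, 0 <= g x)%E ->
  (\int[mu]_x g (phi x) = \int[mu]_x g x)%E.
Proof.
move=> mg g0.
pose m0 := pushforward mu phi : {measure set X -> \bar R}.
pose m := m0 mphi.
have := @eq_measure_integral _ _ _ setT mu m g.
rewrite ge0_integral_pushforward// => -> // A mA _; exact: muphi.
Qed.

Lemma integrable_preserving (f : X -> R) :
  mu.-integrable setT (EFin \o f) ->
  mu.-integrable setT (EFin \o (fun x => f (phi x))) /\
  \int[mu]_x f (phi x) = \int[mu]_x f x.
Proof.
move=> fi.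
have mf := measurable_int _ fi.
have mfc : measurable_fun setT (EFin \o (fun x => f (phi x))).
  rewrite (_ : _ \o _ = (EFin \o f) \o phi)//.
  exact: measurableT_comp mf mphi.
split.
  apply/integrableP; split => //.
  have /integrableP[_] := fi; rewrite -(eint (g := fun x => `|(f x)%:E|%E))//.
    exact: measurableT_comp.
have mpos : measurable_fun setT (EFin \o f)^\+%E by exact: measurable_funepos.
have mneg : measurable_fun setT (EFin \o f)^\-%E by exact: measurable_funeneg.
rewrite /Rintegral; congr fine.
rewrite integralE [RHS]integralE; congr (_ - _)%E.
  rewrite -(eint mpos (fun x => funepos_ge0 _ x)); apply: eq_integral => x _.
  exact: (congr1 (@^~ x) (funepos_comp (EFin \o f) phi)).
rewrite -(eint mneg (fun x => funeneg_ge0 _ x)); apply: eq_integral => x _.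
exact: (congr1 (@^~ x) (funeneg_comp (EFin \o f) phi)).
Qed.

Lemma cintegrable_preserving (f : X -> R[i]) :
  cintegrable mu setT f ->
  cintegrable mu setT (fun x => f (phi x)) /\
  integralC mu setT (fun x => f (phi x)) = integralC mu setT f.
Proof.
move=> [/integrable_preserving[a1 b1] /integrable_preserving[a2 b2]].
by split => //; rewrite /integralC b1 b2.
Qed.

End MeasurePreserving.

Section Invariance.
Variable R : realType.
Local Notation plane := (plane R).

Definition sleb : {sigma_finite_measure set (measurableTypeR R) -> \bar R} :=
  lebesgue_measure.
(** The plane measure is a product, but with [leb] known only as a measure;
    giving the same set function a sigma-finite structure makes the theorems of
    Tonelli, Fubini and Radon-Nikodym applicable to it. *)
Definition fleb2 : set plane -> \bar R := leb2 R.

HB.instance Definition _ := Measure.on fleb2.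

Lemma fleb2_sigma_finite : sigma_finite setT fleb2.
Proof.
have /sigma_finiteP[F [TF ndF Foo]] := sigma_finiteT sleb.
exists (fun n => F n `*` F n).
  rewrite -setXTT TF predeqE => -[x y]; split.
    move=> [/= [n _ Fnx] [k _ Gky]]; exists (maxn n k) => //; split.
    - by move: x Fnx; exact/subsetPset/ndF/leq_maxl.
    - by move: y Gky; exact/subsetPset/ndF/leq_maxr.
  by move=> [n _ []/= ? ?]; split; exists n.
move=> k; have [? ?] := Foo k.
split; first exact: measurableX.
rewrite /fleb2 /leb2 [ltLHS](@product_measure1E _ _ _ _ R sleb sleb)//.
by rewrite lte_mul_pinfty// ge0_fin_numE.
Qed.

HB.instance Definition _ := Measure_isSigmaFinite.Build _ _ _ fleb2
  fleb2_sigma_finite.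

Definition sleb2 : {sigma_finite_measure set plane -> \bar R} := fleb2.

Definition affine (s c x : R) : R := c + s * x.

Lemma measurable_affine s c :
  measurable_fun setT (affine s c : measurableTypeR R -> measurableTypeR R).
Proof. by apply: measurable_funD => //; exact: measurable_funM. Qed.

Lemma leb_affine (s c : R) (A : set (measurableTypeR R)) : s ^+ 2 = 1 ->
  measurable A -> leb R (affine s c @^-1` A) = leb R A.
Proof.
move=> s1 mA.
pose phi : measurableTypeR R -> measurableTypeR R := affine s c.
have mphi : measurable_fun setT phi by exact: measurable_affine.
pose m0 := pushforward (leb R) phi : {measure set (measurableTypeR R) -> \bar R}.
pose m := m0 mphi.
apply/esym; apply: (@lebesgue_measure_unique R m) => // _ [[a b] _ <-].
rewrite /m /m0 /= /pushforward.
have [se|se] : s = 1 \/ s = -1.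
  by move/eqP : s1; rewrite sqrf_eq1 => /orP[] /eqP; [left|right].
- have -> : phi @^-1` `]a, b] = `]a - c, b - c]%classic.
    apply/seteqP; split => x /=; rewrite /phi /affine !in_itv/= se mul1r;
      move=> /andP[u v]; apply/andP; split; lra.
  rewrite /leb !lebesgue_measure_itv /= !lte_fin ltrD2r.
  by case: ifP => // _; congr EFin; lra.
- have -> : phi @^-1` `]a, b] = `[c - b, c - a[%classic.
    apply/seteqP; split => x /=; rewrite /phi /affine !in_itv/= se mulN1r;
      move=> /andP[u v]; apply/andP; split; lra.
  rewrite /leb !lebesgue_measure_itv /= !lte_fin.
  have -> : (c - b < c - a) = (a < b) by rewrite ltrD2l ltrN2.
  by case: ifP => // _; congr EFin; lra.
Qed.

(** For s = 1 these are the translations, for s = -1 the point reflections: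
    the changes of variables behind convolutions and complex conjugates. *)
Definition paffine (s : R) (c xi : plane) : plane :=
  (affine s c.1 xi.1, affine s c.2 xi.2).

Lemma measurable_paffine s c : measurable_fun setT (paffine s c).
Proof.
apply/measurable_fun_pairP; split.
  rewrite (_ : _ \o _ = affine s c.1 \o fst)//.
  by apply: measurableT_comp measurable_fst; exact: measurable_affine.
rewrite (_ : _ \o _ = affine s c.2 \o snd)//.
by apply: measurableT_comp measurable_snd; exact: measurable_affine.
Qed.

Lemma leb2_affine (s : R) (c : plane) (A : set plane) : s ^+ 2 = 1 ->
  measurable A -> leb2 R (paffine s c @^-1` A) = leb2 R A.
Proof.
move=> s1 mA.
pose phi : plane -> plane := paffine s c.
have mphi : measurable_fun setT phi by exact: measurable_paffine.
pose m0 := pushforward (leb2 R) phi : {measure set plane -> \bar R}.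
pose m := m0 mphi.
apply/esym; apply: (@product_measure_unique _ _ _ _ R sleb sleb m) => // B C mB mC.
rewrite /m /m0 /= /pushforward.
have -> : phi @^-1` (B `*` C) = (affine s c.1 @^-1` B) `*` (affine s c.2 @^-1` C).
  by apply/seteqP; split => x.
rewrite (@product_measure1E _ _ _ _ R sleb sleb) /=; last 2 first.
- by rewrite -[X in measurable X]setTI; exact: measurable_affine.
- by rewrite -[X in measurable X]setTI; exact: measurable_affine.
by congr (_ * _)%E; exact: leb_affine.
Qed.

Lemma cintegrable_affine (s : R) (c : plane) (f : plane -> R[i]) : s ^+ 2 = 1 ->
  cintegrable (leb2 R) setT f ->
  cintegrable (leb2 R) setT (fun x => f (paffine s c x)) /\
  integralC (leb2 R) setT (fun x => f (paffine s c x)) = integralC (leb2 R) setT f.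
Proof.
move=> s1; apply: cintegrable_preserving; first exact: measurable_paffine.
by move=> A; exact: leb2_affine.
Qed.

Lemma integrable_affine (s : R) (c : plane) (f : plane -> R) : s ^+ 2 = 1 ->
  (leb2 R).-integrable setT (EFin \o f) ->
  (leb2 R).-integrable setT (EFin \o (fun x => f (paffine s c x))) /\
  \int[leb2 R]_x f (paffine s c x) = \int[leb2 R]_x f x.
Proof.
move=> s1; apply: integrable_preserving; first exact: measurable_paffine.
by move=> A; exact: leb2_affine.
Qed.

End Invariance.

(** * Uniqueness of the Fourier transform *)

Section StepLimit.
Variable R : realType.

Lemma bernoulli_ineq (h : R) (n : nat) : -1 <= h -> 1 + n%:R * h <= (1 + h) ^+ n.
Proof.
move=> h1; elim: n => [|n ih]; first by rewrite mul0r addr0 expr0.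
rewrite exprS; apply: (@le_trans _ _ ((1 + h) * (1 + n%:R * h))); last first.
  by rewrite ler_wpM2l//; lra.
have n0 : 0 <= n%:R * h ^+ 2 by rewrite mulr_ge0 ?sqr_ge0.
by rewrite -natr1; nra.
Qed.

Lemma pow_sub_le (u : R) (a : nat) : 0 <= u <= 1 ->
  (1 - u) ^+ a <= (1 + a%:R * u)^-1.
Proof.
move=> /andP[u0 u1].
have p1 : 0 < 1 + a%:R * u by rewrite ltr_pwDl// mulr_ge0.
rewrite -[leRHS]mul1r ler_pdivlMr//.
apply: (@le_trans _ _ ((1 - u) ^+ a * (1 + u) ^+ a)).
  by rewrite ler_wpM2l ?exprn_ge0 ?subr_ge0// bernoulli_ineq//; lra.
by rewrite -exprMn exprn_ile1//; nra.
Qed.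

(** Iterating [1 - p ^ 2n] sharpens the profile of p into a step at p = 1/2;
    the extra factor n in the exponent decides the value at the step itself. *)
Lemma step_cvg (p : R) : 0 <= p <= 1 ->
  (1 - p ^+ (2 * n)) ^+ (n * 2 ^ (2 * n)) @[n --> \oo]
    --> (if p < 1 / 2 then 1 else 0 : R).
Proof.
move=> /andP[p0 p1].
have u01 n : 0 <= p ^+ (2 * n) <= 1 by rewrite exprn_ge0// exprn_ile1.
have auE n : (n * 2 ^ (2 * n))%:R * p ^+ (2 * n) = n%:R * (2 * p) ^+ (2 * n).
  by rewrite natrM natrX exprMn mulrA.
case: ifPn => [p2|]; last rewrite -leNgt => p2.
- have r0 : 0 <= 2 * p by lra.
  have [h h0 hr] : exists2 h : R, 0 < h & (2 * p) * (1 + h) <= 1.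
    have [pz|pz] := eqVneq p 0; first by exists 1 => //; rewrite pz; lra.
    have pp : 0 < 2 * p by rewrite mulr_gt0// lt_neqAle eq_sym pz.
    exists ((2 * p)^-1 - 1); first by rewrite subr_gt0 invf_gt1//; lra.
    by rewrite addrC subrK mulfV// gt_eqF.
  have nr n : n%:R * (2 * p) ^+ n <= h^-1.
    rewrite -[leRHS]mul1r ler_pdivlMr//.
    have := @bernoulli_ineq h n; rewrite (le_trans _ (ltW h0))// => /(_ isT) b.
    apply: (@le_trans _ _ ((1 + h) ^+ n * (2 * p) ^+ n)).
      rewrite mulrAC ler_wpM2r ?exprn_ge0//; lra.
    by rewrite -exprMn exprn_ile1// mulrC// mulr_ge0//; lra.
  have lb n : 1 - h^-1 * (2 * p) ^+ n <= (1 - p ^+ (2 * n)) ^+ (n * 2 ^ (2 * n)).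
    have /andP[a b] := u01 n.
    apply: (@le_trans _ _ (1 + (n * 2 ^ (2 * n))%:R * - p ^+ (2 * n))); last first.
      by apply: bernoulli_ineq; lra.
    rewrite mulrN auE lerD2l lerN2 mul2n -addnn exprD mulrA ler_wpM2r//.
    exact: exprn_ge0.
  apply: (@squeeze_cvgr _ _ _ _ (fun n => 1 - h^-1 * (2 * p) ^+ n) (cst 1)).
  + apply: nearW => n; rewrite lb/= exprn_ile1//.
      by have /andP[a b] := u01 n; lra.
    by have /andP[a b] := u01 n; lra.
  + rewrite -[X in _ --> X](subr0 1); apply: cvgB; first exact: cvg_cst.
    rewrite -[X in _ --> X](mulr0 h^-1); apply: cvgM; first exact: cvg_cst.
    by apply: cvg_expr; rewrite ger0_norm//; lra.
  + exact: cvg_cst.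
- apply: (@squeeze_cvgr _ _ _ _ (cst 0) (@harmonic R)); last 2 first.
  + exact: cvg_cst.
  + exact: cvg_harmonic.
  apply: nearW => n; have /andP[a b] := u01 n; rewrite /= exprn_ge0 ?subr_ge0//=.
  rewrite (le_trans (pow_sub_le _ (u01 n)))// lef_pV2 ?posrE//; last first.
    by rewrite ltr_pwDl// mulr_ge0.
  rewrite auE -nat1r lerD2l ler_peMr// exprn_ege1//; lra.
Qed.

End StepLimit.

Section Uniqueness.
Variable R : realType.
Local Notation plane := (plane R).
Local Notation mu := (leb2 R).

Lemma measurable_dotp (x : plane) : measurable_fun setT (dotp x).
Proof.
apply: measurable_funD; apply: measurable_funM => //.
Qed.

Lemma dotpD (x y z : plane) : dotp (x.1 + y.1, x.2 + y.2) z = dotp x z + dotp y z.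
Proof. by rewrite /dotp /=; ring. Qed.

Lemma dotpZ (a : R) (y z : plane) : dotp (a * y.1, a * y.2) z = a * dotp y z.
Proof. by rewrite /dotp /=; ring. Qed.

Variable G : plane -> R[i].
Hypothesis iG : cintegrable mu setT G.
Hypothesis G0 : forall x, integralC mu setT (fun xi => expi (dotp x xi) * G xi) = 0.

(** The multipliers m for which m G still has no Fourier coefficients. Asking
    for all x, not only for x = 0, makes the class stable under characters, and
    dominated convergence closes it under bounded limits. *)
Definition annihilates (m : plane -> R[i]) :=
  [/\ cmeasurable setT m, exists M, forall xi, nc (m xi) <= M &
    forall x, integralC mu setT (fun xi => m xi * (expi (dotp x xi) * G xi)) = 0].

Lemma cintegrable_annihilates m x : annihilates m ->
  cintegrable mu setT (fun xi => m xi * (expi (dotp x xi) * G xi)).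
Proof.
case=> mm [M mM] _; apply: (@cintegrableMl _ _ _ _ _ _ _ M) => //.
apply: (@cintegrableMl _ _ _ _ _ _ _ 1) => //.
  by apply: cmeasurable_expi; exact: measurable_dotp.
by move=> xi _; rewrite nc_expi.
Qed.

Lemma annihilates1 : annihilates (fun=> 1).
Proof.
split; [exact: cmeasurable_cst|by exists (nc (1 : R[i]))|move=> x].
by under eq_fun do rewrite mul1r.
Qed.

Lemma annihilatesD m m' : annihilates m -> annihilates m' ->
  annihilates (fun xi => m xi + m' xi).
Proof.
move=> am am'; have [mm [M mM] m0] := am; have [mm' [M' mM'] m0'] := am'.
split; [exact: cmeasurableD|exists (M + M') => xi|move=> x].
  by rewrite (le_trans (ncD _ _))// lerD.
under eq_fun do rewrite mulrDl.
rewrite cintegralD ?m0 ?m0' ?addr0//; exact: cintegrable_annihilates.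
Qed.

Lemma annihilatesZ z m : annihilates m -> annihilates (fun xi => z * m xi).
Proof.
move=> am; have [mm [M mM] m0] := am.
split; [|exists (nc z * M) => xi|move=> x].
- by apply: cmeasurableM => //; exact: cmeasurable_cst.
- by rewrite ncM ler_wpM2l ?nc_ge0.
under eq_fun do rewrite -mulrA.
rewrite cintegralZ ?m0 ?mulr0//; exact: cintegrable_annihilates.
Qed.

Lemma annihilatesB m m' : annihilates m -> annihilates m' ->
  annihilates (fun xi => m xi - m' xi).
Proof.
move=> am /(annihilatesZ (-1)) am'; have := annihilatesD am am'.
by under eq_fun do rewrite mulN1r.
Qed.

Lemma annihilates_char m y : annihilates m ->
  annihilates (fun xi => m xi * expi (dotp y xi)).
Proof.
move=> [mm [M mM] m0]; split; [|exists M => xi|move=> x].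
- by apply: cmeasurableM => //; apply: cmeasurable_expi; exact: measurable_dotp.
- by rewrite ncM nc_expi mulr1.
rewrite -[RHS](m0 (x.1 + y.1, x.2 + y.2)); congr (integralC _ _ _).
by apply/funext => xi; rewrite dotpD expiD; ring.
Qed.

Lemma annihilates_lim (u : nat -> plane -> R[i]) m M :
  (forall n, annihilates (u n)) -> cmeasurable setT m ->
  (forall n xi, nc (u n xi) <= M) ->
  (forall xi, nc (u n xi - m xi) @[n --> \oo] --> (0 : R)) ->
  annihilates m.
Proof.
move=> au mm uM um.
have me x : cmeasurable setT (fun xi => expi (dotp x xi) * G xi).
  apply: cmeasurableM; last exact: cintegrable_meas iG.
  by apply: cmeasurable_expi; exact: measurable_dotp.
have key x := @cdominated_cvg _ _ _ mu setT
  (fun n xi => u n xi * (expi (dotp x xi) * G xi))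
  (fun xi => m xi * (expi (dotp x xi) * G xi)) (fun xi => M * nc (G xi)) measurableT
  (fun n => cintegrable_meas (cintegrable_annihilates x (au n)))
  (cmeasurableM mm (me x)) (rintegrableZ M measurableT (cintegrable_nc measurableT iG)).
split => //.
  exists M => xi; apply/ler_addgt0Pr => e e0.
  have /cvgrPdist_lt/(_ _ e0)[N _ /(_ N (leqnn _))] := um xi.
  rewrite /= sub0r normrN ger0_norm ?nc_ge0// => h.
  have -> : m xi = u N xi - (u N xi - m xi) by rewrite subKr.
  by rewrite (le_trans (ncB _ _))// lerD ?uM// ltW.
move=> x; have [||_ _ _ h] := key x.
- by move=> n xi _; rewrite !ncM nc_expi mul1r ler_wpM2r ?nc_ge0.
- move=> xi _.
  have -> : (fun n => nc (u n xi * (expi (dotp x xi) * G xi) -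
      m xi * (expi (dotp x xi) * G xi))) = (fun n => nc (u n xi - m xi) * nc (G xi)).
    by apply/funext => n; rewrite -mulrBl !ncM nc_expi mul1r.
  by rewrite -(mul0r (nc (G xi))); apply: cvgM => //; exact: cvg_cst.
apply: Normc.eq0_normc.
have {}h : nc (- integralC mu setT (fun xi => m xi * (expi (dotp x xi) * G xi)))
    @[n --> \oo] --> (0 : R).
  apply: cvg_trans h; apply: near_eq_cvg; apply: nearW => n.
  by have [_ _ ->] := au n; rewrite sub0r.
by rewrite -ncN; apply: (cvg_unique _ (cvg_cst _) h).
Qed.

(** A trigonometric polynomial with values in [0, 1] that lies below 1/2 exactly
    where the sine is positive. *)
Definition wave (y : plane) (c : R) (xi : plane) : R :=
  1 / 2 - 1 / 2 * sin (dotp y xi - c).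

Lemma wave01 y c xi : 0 <= wave y c xi <= 1.
Proof.
rewrite /wave; have := sin_le1 (dotp y xi - c).
by have := sin_geN1 (dotp y xi - c); move=> a b; apply/andP; split; lra.
Qed.

Lemma annihilates_wave m y c : annihilates m ->
  annihilates (fun xi => m xi * (wave y c xi)%:C).
Proof.
move=> am.
have -> : (fun xi => m xi * (wave y c xi)%:C) = (fun xi =>
    (1 / 2)%:C * m xi + ((0 +i* (1 / 4)) * expi (- c) * (m xi * expi (dotp y xi))
     - (0 +i* (1 / 4)) * expi c * (m xi * expi (dotp (-1 * y.1, -1 * y.2) xi)))).
  apply/funext => xi; rewrite dotpZ mulN1r /wave.
  set t := dotp y xi; rewrite sinB /expi cosN sinN (cosN t) (sinN t).
  by case: (m xi) => a b; apply: complexP; rewrite !(ReD, ImD, ReM, ImM) /=; field.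
apply: annihilatesD; first exact: annihilatesZ.
apply: annihilatesB; apply: annihilatesZ; exact: annihilates_char.
Qed.

Lemma annihilates_wave_pow m y c k : annihilates m ->
  annihilates (fun xi => m xi * (wave y c xi ^+ k)%:C).
Proof.
move=> am; elim: k => [|k /(annihilates_wave y c)].
  by under eq_fun do rewrite expr0 mulr1.
by under eq_fun do rewrite -mulrA -rmorphM -exprSr.
Qed.

Lemma annihilates_sharp m y c k j : annihilates m ->
  annihilates (fun xi => m xi * ((1 - wave y c xi ^+ k) ^+ j)%:C).
Proof.
move=> am; elim: j => [|j ih].
  by under eq_fun do rewrite expr0 mulr1.
have := annihilatesB ih (annihilates_wave_pow y c k ih).
congr annihilates; apply/funext => xi.
by rewrite exprSr mulrBr mulr1 rmorphB /= rmorphM /= mulrBr mulrA.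
Qed.

(** In contrast to the indicators that annihilate G, the sets with this
    property are closed under intersections. *)
Definition stable (A : set plane) :=
  measurable A /\
  forall m, annihilates m -> annihilates (fun xi => m xi * (\1_A xi : R)%:C).

Lemma cmeasurable_indic (A : set plane) : measurable A ->
  cmeasurable setT (fun xi => (\1_A xi : R)%:C).
Proof. by move=> mA; apply: cmeasurable_real; exact: measurable_indic. Qed.

Lemma nc_indic (A : set plane) xi : nc ((\1_A xi : R)%:C) <= 1.
Proof. by rewrite nc_real indicE; case: (_ \in _); rewrite ?normr1 ?normr0. Qed.

Lemma annihilates_rlim m (w : nat -> plane -> R) (A : set plane) :
  annihilates m -> measurable A ->
  (forall n, annihilates (fun xi => m xi * (w n xi)%:C)) ->
  (forall n xi, `|w n xi| <= 1) ->
  (forall xi, w n xi @[n --> \oo] --> (\1_A xi : R)) ->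
  annihilates (fun xi => m xi * (\1_A xi : R)%:C).
Proof.
move=> [mm [M mM] _] mA aw w1 wA.
apply: (@annihilates_lim (fun n xi => m xi * (w n xi)%:C) _ M) => //.
- by apply: cmeasurableM => //; exact: cmeasurable_indic.
- by move=> n xi; rewrite ncM nc_real (le_trans _ (mM xi))// ler_piMr ?nc_ge0.
- move=> xi.
  have -> : (fun n => nc (m xi * (w n xi)%:C - m xi * (\1_A xi)%:C)) =
      (fun n => nc (m xi) * `|w n xi - \1_A xi|).
    by apply/funext => n; rewrite -mulrBr -rmorphB ncM nc_real.
  rewrite -(mulr0 (nc (m xi))); apply: cvgM; first exact: cvg_cst.
  by apply/norm_cvg0P; rewrite -(subrr (\1_A xi : R)); apply: cvgB => //; exact: cvg_cst.
Qed.

(** The powers of [step_cvg] turn the profile [wave] into the indicator of the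
    set where it is less than 1/2. *)
Lemma stable_wave y c : stable [set xi | 0 < sin (dotp y xi - c)].
Proof.
set A := [set xi | _].
have mA : measurable A.
  rewrite (_ : A = (fun xi => sin (dotp y xi - c)) @^-1` `]0, +oo[); last first.
    by apply/seteqP; split => xi /=; rewrite /A /= in_itv/= andbT.
  rewrite -[X in measurable X]setTI.
  have mf : measurable_fun setT (fun xi => sin (dotp y xi - c)).
    apply: measurableT_comp; first exact: continuous_measurable_fun (@continuous_sin R).
    by apply: measurable_funB => //; exact: measurable_dotp.
  exact: mf.
split => // m am.
apply: (@annihilates_rlim _ (fun n xi => (1 - wave y c xi ^+ (2 * n)) ^+ (n * 2 ^ (2 * n)))) => //.
- by move=> n; exact: annihilates_sharp.
- move=> n xi; have /andP[a b] := wave01 y c xi.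
  have b0 : 0 <= 1 - wave y c xi ^+ (2 * n) by rewrite subr_ge0 exprn_ile1.
  rewrite ger0_norm ?exprn_ge0// exprn_ile1// gerBl exprn_ge0//.
- move=> xi; have := step_cvg (wave01 y c xi).
  congr (_ --> _); rewrite indicE.
  have -> : (wave y c xi < 1 / 2) = (xi \in A).
    apply/idP/idP => [h|].
      by apply/mem_set; rewrite /A /=; move: h; rewrite /wave; lra.
    by move/set_mem; rewrite /A /= /wave; lra.
  by case: (_ \in _).
Qed.

(** Long waves look like half-planes: at any given point the sine of
    [a (dotp y xi - c)] has the sign of [dotp y xi - c] once a is small. *)
Lemma stable_half y c : stable [set xi | c < dotp y xi].
Proof.
set A := [set xi | _].
have mA : measurable A.
  rewrite (_ : A = dotp y @^-1` `]c, +oo[); last first.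
    by apply/seteqP; split => xi /=; rewrite /A /= in_itv/= andbT.
  by rewrite -[X in measurable X]setTI; exact: measurable_dotp.
split => // m am.
pose a (n : nat) : R := n.+1%:R^-1.
pose B n := [set xi | 0 < sin (dotp (a n * y.1, a n * y.2) xi - a n * c)].
apply: (@annihilates_rlim _ (fun n => \1_(B n))) => //.
- by move=> n; have [_] := stable_wave (a n * y.1, a n * y.2) (a n * c); apply.
- by move=> n xi; rewrite indicE; case: (_ \in _); rewrite ?normr1 ?normr0.
move=> xi; set s := dotp y xi - c.
have BE n : (xi \in B n) = (0 < sin (a n * s)).
  have e : dotp (a n * y.1, a n * y.2) xi - a n * c = a n * s.
    by rewrite dotpZ /s mulrBr.
  by apply/idP/idP => [/set_mem|h]; [|apply/mem_set]; rewrite /B /= e.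
have a0 n : 0 < a n by rewrite invr_gt0.
have near_small : \forall n \near \oo, a n * `|s| < pi.
  have : a n * `|s| @[n --> \oo] --> 0 * `|s|.
    by apply: cvgM; [exact: cvg_harmonic|exact: cvg_cst].
  by rewrite mul0r => /cvgr_lt; apply; exact: pi_gt0.
apply: (@cvg_trans _ ((cst (\1_A xi : R)) @ \oo)); last exact: cvg_cst.
apply: near_eq_cvg; near=> n.
rewrite /= !indicE BE.
have -> : (xi \in A) = (0 < s).
  rewrite /s subr_gt0.
  by apply/idP/idP => [/set_mem//|h]; apply/mem_set.
have h : a n * `|s| < pi by near: n.
have [s0|s0|s0] := ltgtP 0 s.
- rewrite gtr0_norm in h => //.
  by rewrite sin_gt0_pi// h mulr_gt0.
- rewrite ltr0_norm in h => //.
  have : 0 < sin (- (a n * s)).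
    by apply: sin_gt0_pi; rewrite -mulrN h andbT mulr_gt0// oppr_gt0.
  by rewrite sinN oppr_gt0 => /ltW; rewrite leNgt => /negbTE ->.
- by rewrite -s0 mulr0 sin0 ltxx.
Unshelve. all: by end_near. Qed.

(** Successive multiplication by the indicators of the complements gives finite
    unions, and bounded limits pass to countable ones. *)
Lemma stable_sigma_algebra : sigma_algebra setT stable.
Proof.
split.
- split; first exact: measurable0.
  move=> m am; have := annihilatesZ 0 am; congr annihilates; apply/funext => xi.
  by rewrite indicE in_set0 mul0r mulr0.
- move=> A [mA sA]; rewrite setTD; split; first exact: measurableC.
  move=> m am; have := annihilatesB am (sA m am).
  congr annihilates; apply/funext => xi.
  rewrite -{1}[m xi]mulr1 -mulrBr.
  by rewrite !indicE in_setC; case: (_ \in _); rewrite ?subrr ?subr0.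
- move=> A sA; have mA n : measurable (A n) by have [] := sA n.
  have mU : measurable (\bigcup_k A k) by exact: bigcupT_measurable.
  split => // m am.
  pose w n (xi : plane) : R := 1 - \prod_(i < n) (1 - \1_(A i) xi).
  have wE n xi : w n xi = (xi \in \bigcup_(i < n) A i)%:R.
    rewrite /w; have [h|h] := boolP (xi \in _).
      have [i /= ni Ai] := set_mem h.
      rewrite (bigD1 (Ordinal ni))//= indicE (mem_set Ai) subrr mul0r subr0//.
    rewrite big1 ?subrr// => i _; rewrite indicE.
    suff /negbTE -> : xi \notin A i by rewrite subr0.
    apply: contra h => /set_mem Ai; apply/mem_set; exists i => //=.
  apply: (@annihilates_rlim _ w) => //.
  + move=> n.
    have h : annihilates (fun xi => m xi * (\prod_(i < n) (1 - \1_(A i) xi) : R)%:C).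
      elim: n => [|n ih].
        by under eq_fun do rewrite big_ord0 mulr1.
      have := annihilatesB ih ((sA n).2 _ ih); congr annihilates; apply/funext => xi.
      by rewrite big_ord_recr/= mulrBr mulr1 rmorphB /= rmorphM /= mulrBr mulrA.
    have := annihilatesB am h; congr annihilates; apply/funext => xi.
    by rewrite /w rmorphB /= mulrBr mulr1.
  + by move=> n xi; rewrite wE; case: (_ \in _); rewrite ?normr1 ?normr0.
  + move=> xi; apply: (@cvg_trans _ ((cst (\1_(\bigcup_k A k) xi : R)) @ \oo));
      last exact: cvg_cst.
    apply: near_eq_cvg; rewrite indicE.
    have [h|h] := boolP (xi \in _).
      have [i _ Ai] := set_mem h; exists i.+1 => // n /= ni.
      rewrite wE (_ : _ \in _ = true)//; apply/mem_set; exists i => //=.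
    apply: nearW => n /=; rewrite wE.
    suff /negbTE -> : xi \notin \bigcup_(i < n) A i by [].
    by apply: contra h => /set_mem[i _ Ai]; apply/mem_set; exists i.
Qed.

Lemma stable_preimage (y : plane) (B : set (measurableTypeR R)) :
  measurable B -> stable (dotp y @^-1` B).
Proof.
have [s0 sC sU] := stable_sigma_algebra.
rewrite RGenOInfty.measurableE => mB.
apply: (@smallest_sub _ _ _ [set B | stable (dotp y @^-1` B)] _ _ B mB) => //.
  split.
  - by rewrite /= preimage_set0.
  - by move=> A sA; rewrite /= setTD preimage_setC -setTD; exact: sC.
  - by move=> A sA; rewrite /= preimage_bigcup; exact: sU.
move=> _ [c ->] /=; rewrite (_ : _ @^-1` _ = [set xi | c < dotp y xi]).
  exact: stable_half.
by apply/seteqP; split => xi /=; rewrite in_itv/= andbT.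
Qed.

Lemma stable_measurable (A : set plane) : measurable A -> stable A.
Proof.
have [s0 sC sU] := stable_sigma_algebra.
have /= := measurable_prod_measurableType => -> mA.
apply: (@smallest_sub _ _ _ stable _ _ A mA); first exact: stable_sigma_algebra.
move=> _ [B mB [C mC <-]].
have [mB' sB] := stable_preimage (1, 0) mB.
have [mC' sC'] := stable_preimage (0, 1) mC.
have BE : B `*` C = (dotp (1, 0) @^-1` B) `&` (dotp (0, 1) @^-1` C).
  by apply/seteqP; split => -[u v]; rewrite /dotp /= !mul1r !mul0r addr0 add0r.
rewrite BE; split; first exact: measurableI.
move=> m /sB/sC'; congr annihilates; apply/funext => xi.
by rewrite -mulrA -rmorphM indicI.
Qed.

(** The multipliers annihilating G contain the trigonometric polynomials, hence,
    through bounded limits, all indicators; and an integrable function whose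
    integral over every measurable set vanishes is zero. This makes the Fourier
    transform of a function of the form [inv_fourier F] well defined. *)
Lemma fourier_unique0 : {ae mu, forall xi, G xi = 0}.
Proof.
have key A : measurable A -> integralC mu setT (fun xi => (\1_A xi : R)%:C * G xi) = 0.
  move=> mA; have [_ /(_ _ annihilates1)[_ _ /(_ (0, 0))]] := stable_measurable mA.
  move=> <-; congr (integralC _ _ _); apply/funext => xi.
  by rewrite mul1r /dotp /= !mul0r addr0 expi0 mul1r.
have [i1 i2] := iG.
have z (f : plane -> R) : mu.-integrable setT (EFin \o f) ->
    (forall A, measurable A -> \int[mu]_xi (\1_A xi * f xi) = 0) ->
    {ae mu, forall xi, f xi = 0}.
  move=> fi f0.
  have : ae_eq mu setT (EFin \o f) (cst 0%E).
    apply: integral_ae_eq => //.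
    move=> A _ mA; rewrite integral0.
    have iA : mu.-integrable A (EFin \o f) by exact: integrableS fi.
    have := f0 A mA; rewrite /Rintegral => h.
    rewrite -[LHS]fineK; last exact: integrable_fin_num iA.
    congr EFin; rewrite -[RHS]h; congr fine; rewrite integral_mkcond; apply: eq_integral => xi _.
    by rewrite /patch /= indicE; case: (_ \in _); rewrite ?mul1r ?mul0r.
  by apply: filterS => xi /(_ I) /= [].
have h1 : {ae mu, forall xi, Re (G xi) = 0}.
  apply: z => // A mA; have := key A mA => /(congr1 (@complex.Re R)) /= <-.
  by apply: eq_Rintegral => xi _; rewrite ReM /= mul0r subr0.
have h2 : {ae mu, forall xi, Im (G xi) = 0}.
  apply: z => // A mA; have := key A mA => /(congr1 (@complex.Im R)) /= <-.
  by apply: eq_Rintegral => xi _; rewrite ImM /= mul0r addr0.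
by apply: filterS2 h1 h2 => xi a b; exact: complexP.
Qed.

End Uniqueness.

(** * The Wiener algebra *)

Section AlmostEverywhere.
Context d (X : measurableType d) (R : realType).
Variable mu : {measure set X -> \bar R}.

Lemma ae_le_Rintegral (f g : X -> R) :
  mu.-integrable setT (EFin \o f) -> mu.-integrable setT (EFin \o g) ->
  (forall x, 0 <= f x) -> {ae mu, forall x, f x <= g x} ->
  \int[mu]_x f x <= \int[mu]_x g x.
Proof.
move=> fi gi f0 fg.
have mf : measurable_fun setT f by apply/measurable_EFinP; exact: measurable_int fi.
have mg : measurable_fun setT g by apply/measurable_EFinP; exact: measurable_int gi.
have mm : measurable_fun setT (fun x => Num.min (f x) (g x)).
  by apply: measurable_minr.
have -> : \int[mu]_x f x = \int[mu]_x Num.min (f x) (g x).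
  by apply: ae_eq_Rintegral => //; apply: filterS fg => x; rewrite minEle => ->.
apply: le_Rintegral => //; last by move=> x _; rewrite ge_min lexx orbT.
apply: (@integrable_le _ _ _ mu setT _ (fun x => f x + `|g x|)) => //.
  rewrite (_ : EFin \o _ = (EFin \o f) \+ (abse \o (EFin \o g)))%E//.
  by apply: integrableD => //; exact: integrable_abse.
move=> x _; have fx := f0 x; rewrite minEle; case: ifP => _.
  by rewrite ger0_norm// lerDl.
by rewrite lerDr.
Qed.

Lemma cintegrable_ae_le (G : X -> R[i]) (g : X -> R) : cmeasurable setT G ->
  mu.-integrable setT (EFin \o g) -> {ae mu, forall x, nc (G x) <= g x} ->
  cintegrable mu setT G.
Proof.
move=> [g1 g2] gi Gg; have /integrableP[mg fg] := gi.
have key (f : X -> R) : measurable_fun setT f -> (forall x, `|f x| <= nc (G x)) ->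
    mu.-integrable setT (EFin \o f).
  move=> mf fG; apply/integrableP; split; first exact/measurable_EFinP.
  apply: le_lt_trans fg; apply: ae_ge0_le_integral => //.
  - by apply: measurableT_comp => //; exact/measurable_EFinP.
  - by apply: measurableT_comp => //; exact/measurable_EFinP.
  - apply: filterS Gg => x Gx _ /=; rewrite lee_fin.
    by rewrite (le_trans (fG x))// (le_trans Gx)// ler_norm.
by split; apply: key => // x; [exact: Re_le_nc|exact: Im_le_nc].
Qed.

End AlmostEverywhere.

Section Wiener.
Variable R : realType.
Local Notation plane := (plane R).
Local Notation mu := (leb2 R).
Implicit Types (h : plane -> R[i]) (F G m : plane -> R[i]).

(** The factor in the inversion formula; every product of functions costs one. *)
Definition c0 : R := ((2 * pi) ^+ 2)^-1.

Lemma c0_gt0 : 0 < c0.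
Proof. by rewrite invr_gt0 exprn_gt0// mulr_gt0// pi_gt0. Qed.

Lemma c0_ge0 : 0 <= c0. Proof. exact: ltW c0_gt0. Qed.

(** All operations below are computed on transforms. Carrying the transform as
    an argument, instead of the chosen one [fourier h], avoids arguing almost
    everywhere at each step. *)
Definition rep h F := cintegrable mu setT F /\ h = inv_fourier F.

Definition wiener h := exists F, rep h F.

Definition L1norm F : R := \int[mu]_xi nc (F xi).

(** The norm of the Wiener algebra. Multipliers with bounded symbols act on it
    and it is submultiplicative, so that all the terms of the equation can be
    estimated by this norm alone. *)
Definition wn h : R := L1norm (fourier h).

Lemma L1norm_ge0 F : 0 <= L1norm F.
Proof. by apply: Rintegral_ge0 => x _; exact: nc_ge0. Qed.

Lemma wn_ge0 h : 0 <= wn h. Proof. exact: L1norm_ge0. Qed.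

Lemma cmeasurable_char (x : plane) : cmeasurable setT (fun xi => expi (dotp x xi)).
Proof. by apply: cmeasurable_expi; exact: measurable_dotp. Qed.

Lemma cintegrable_char F (x : plane) : cintegrable mu setT F ->
  cintegrable mu setT (fun xi => expi (dotp x xi) * F xi).
Proof.
move=> iF; apply: (@cintegrableMl _ _ _ _ _ _ _ 1) => //.
  exact: cmeasurable_char.
by move=> xi _; rewrite nc_expi.
Qed.

Lemma rep_unique h F G : rep h F -> rep h G -> {ae mu, forall xi, F xi = G xi}.
Proof.
move=> [iF hF] [iG hG].
have iFG : cintegrable mu setT (fun xi => F xi - G xi) by exact: cintegrableB.
have /(fourier_unique0 iFG) : forall x,
    integralC mu setT (fun xi => expi (dotp x xi) * (F xi - G xi)) = 0.
  move=> x; under eq_fun do rewrite mulrBr.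
  rewrite cintegralB//; [|exact: cintegrable_char..].
  have : inv_fourier F x = inv_fourier G x by rewrite -hF -hG.
  rewrite /inv_fourier => /mulfI -> //; first by rewrite subrr.
  have := c0_gt0; rewrite /c0 => c0p; apply/eqP => /(congr1 (@complex.Re R)) /= e.
  by rewrite e ltxx in c0p.
by apply: filterS => xi /eqP; rewrite subr_eq0 => /eqP.
Qed.

Lemma wiener_fourier h : wiener h -> rep h (fourier h).
Proof. by move=> [F rF]; exact: (@xgetPex _ (fun=> 0) _ (ex_intro _ F rF)). Qed.

Lemma rep_wiener h F : rep h F -> wiener h. Proof. by exists F. Qed.

Lemma rep_fourier h F : rep h F -> {ae mu, forall xi, fourier h xi = F xi}.
Proof.
by move=> rF; apply: (@rep_unique h) => //; apply: wiener_fourier; exists F.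
Qed.

Lemma ae_eq_L1norm F G : cmeasurable setT F -> cmeasurable setT G ->
  {ae mu, forall xi, F xi = G xi} -> L1norm F = L1norm G.
Proof.
move=> mF mG FG; apply: ae_eq_Rintegral; [exact: measurable_nc..|].
by apply: filterS FG => xi ->.
Qed.

Lemma wn_rep h F : rep h F -> wn h = L1norm F.
Proof.
move=> rF; have [iF _] := rF; have [iH _] := wiener_fourier (rep_wiener rF).
by apply: ae_eq_L1norm; [exact: cintegrable_meas iH|exact: cintegrable_meas iF|
  exact: rep_fourier].
Qed.

Lemma rep_ae h F G : rep h F -> cmeasurable setT G ->
  {ae mu, forall xi, F xi = G xi} -> rep h G.
Proof.
move=> [iF hF] mG FG; have mF := cintegrable_meas iF.
split.
  apply: (cintegrable_ae_le mG (cintegrable_nc measurableT iF)).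
  by apply: filterS FG => xi ->.
rewrite hF; apply/funext => x; rewrite /inv_fourier; congr (_ * _).
apply: ae_eq_cintegral; [|
  |by apply: filterS FG => xi ->];
  by apply: cmeasurableM => //; exact: cmeasurable_char.
Qed.

Lemma rep0 : rep (fun=> 0) (fun=> 0).
Proof.
split; first exact: cintegrable0.
apply/funext => x; rewrite /inv_fourier.
by under eq_fun do rewrite mulr0; rewrite cintegral0 mulr0.
Qed.

Lemma repD h F h' F' : rep h F -> rep h' F' ->
  rep (fun x => h x + h' x) (fun xi => F xi + F' xi).
Proof.
move=> [iF ->] [iF' ->]; split; first exact: cintegrableD.
apply/funext => x; rewrite /inv_fourier -mulrDr.
under [in RHS]eq_fun do rewrite mulrDr.
by rewrite cintegralD//; exact: cintegrable_char.
Qed.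

Lemma repZ z h F : rep h F -> rep (fun x => z * h x) (fun xi => z * F xi).
Proof.
move=> [iF ->]; split; first exact: cintegrableZ.
apply/funext => x; rewrite /inv_fourier mulrCA; congr (_ * _).
rewrite -cintegralZ//; last exact: cintegrable_char.
by congr integralC; apply/funext => xi; rewrite mulrCA.
Qed.

Lemma repN h F : rep h F -> rep (fun x => - h x) (fun xi => - F xi).
Proof.
move=> /(repZ (-1)).
by under eq_fun do rewrite mulN1r; under [X in rep _ X]eq_fun do rewrite mulN1r.
Qed.

Lemma repB h F h' F' : rep h F -> rep h' F' ->
  rep (fun x => h x - h' x) (fun xi => F xi - F' xi).
Proof. by move=> rF rF'; apply: repD => //; exact: repN. Qed.

Lemma rep_sum (I : Type) (r : seq I) (P : pred I) (h F : I -> plane -> R[i]) :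
  (forall i, rep (h i) (F i)) ->
  rep (fun x => \sum_(i <- r | P i) h i x) (fun xi => \sum_(i <- r | P i) F i xi).
Proof.
move=> rF; elim: r => [|a r ih].
  under eq_fun do rewrite big_nil; under [X in rep _ X]eq_fun do rewrite big_nil.
  exact: rep0.
under eq_fun do rewrite big_cons; under [X in rep _ X]eq_fun do rewrite big_cons.
by case: (P a) => //; exact: repD.
Qed.

Lemma wiener0 : wiener (fun=> 0). Proof. by eexists; exact: rep0. Qed.

Lemma wienerD h h' : wiener h -> wiener h' -> wiener (fun x => h x + h' x).
Proof. by move=> [F rF] [F' rF']; eexists; exact: repD rF rF'. Qed.

Lemma wienerZ z h : wiener h -> wiener (fun x => z * h x).
Proof. by move=> [F rF]; eexists; exact: repZ rF. Qed.

Lemma wienerN h : wiener h -> wiener (fun x => - h x).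
Proof. by move=> [F rF]; eexists; exact: repN rF. Qed.

Lemma wienerB h h' : wiener h -> wiener h' -> wiener (fun x => h x - h' x).
Proof. by move=> [F rF] [F' rF']; eexists; exact: repB rF rF'. Qed.

Lemma wiener_sum (I : Type) (r : seq I) (P : pred I) (h : I -> plane -> R[i]) :
  (forall i, wiener (h i)) -> wiener (fun x => \sum_(i <- r | P i) h i x).
Proof.
by move=> wh; eexists; apply: rep_sum => i; exact: wiener_fourier (wh i).
Qed.

Lemma wn0 : wn (fun=> 0) = 0.
Proof.
rewrite (wn_rep rep0) /L1norm /Rintegral.
by under eq_integral do rewrite nc0; rewrite integral0.
Qed.

Lemma wnD h h' : wiener h -> wiener h' -> wn (fun x => h x + h' x) <= wn h + wn h'.
Proof.
move=> [F rF] [F' rF']; rewrite (wn_rep (repD rF rF')) (wn_rep rF) (wn_rep rF').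
have [iF _] := rF; have [iF' _] := rF'.
rewrite /L1norm -RintegralD//; [|exact: cintegrable_nc..].
apply: le_Rintegral => //.
- by apply: cintegrable_nc => //; exact: cintegrableD.
- rewrite (_ : EFin \o _ = (EFin \o (fun x => nc (F x))) \+ (EFin \o (fun x => nc (F' x))))%E//.
  by apply: integrableD => //; exact: cintegrable_nc.
- by move=> x _; exact: ncD.
Qed.

Lemma wnZ z h : wiener h -> wn (fun x => z * h x) = nc z * wn h.
Proof.
move=> [F rF]; rewrite (wn_rep (repZ z rF)) (wn_rep rF); have [iF _] := rF.
rewrite /L1norm -RintegralZl//; last exact: cintegrable_nc.
by apply: eq_Rintegral => x _; rewrite ncM.
Qed.

Lemma wnN h : wiener h -> wn (fun x => - h x) = wn h.
Proof.
move=> wh; rewrite -[RHS]mul1r -[X in _ = X * _](Normc.normc1 R) -ncN -wnZ//.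
by congr wn; apply/funext => x; rewrite mulN1r.
Qed.

Lemma wn_dist h h' : wiener h -> wiener h' -> `|wn h - wn h'| <= wn (fun x => h x - h' x).
Proof.
move=> wh wh'; have wd := wienerB wh wh'; have wd' := wienerB wh' wh.
have e : wn (fun x => h' x - h x) = wn (fun x => h x - h' x).
  by rewrite -wnN//; congr wn; apply/funext => x; rewrite opprB.
rewrite ler_norml lerNl opprB !lerBlDr -{1}e; apply/andP; split.
  have := wnD wd' wh; congr (wn _ <= _).
  by apply/funext => x; rewrite subrK.
have := wnD wd wh'; congr (wn _ <= _).
by apply/funext => x; rewrite subrK.
Qed.

Lemma wn_sum (I : Type) (r : seq I) (P : pred I) (h : I -> plane -> R[i]) :
  (forall i, wiener (h i)) ->
  wn (fun x => \sum_(i <- r | P i) h i x) <= \sum_(i <- r | P i) wn (h i).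
Proof.
move=> wh; elim: r => [|a r ih].
  by under eq_fun do rewrite big_nil; rewrite wn0 big_nil.
under eq_fun do rewrite big_cons; rewrite big_cons; case: (P a) => //.
by rewrite (le_trans (wnD _ _))//; [exact: wiener_sum|rewrite lerD2l].
Qed.

Lemma nc_le_wn h x : wiener h -> nc (h x) <= c0 * wn h.
Proof.
move=> [F rF]; rewrite (wn_rep rF); have [iF ->] := rF.
rewrite /inv_fourier ncM ncR ?invr_ge0 ?exprn_ge0 ?mulr_ge0 ?pi_ge0//.
rewrite ler_wpM2l ?c0_ge0// (le_trans (nc_cintegral _ _))//.
  exact: cintegrable_char.
rewrite le_eqVlt; apply/orP; left; apply/eqP.
by apply: eq_Rintegral => xi _; rewrite ncM nc_expi mul1r.
Qed.

(** Bounds for Fourier multipliers need only hold where the transform of h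
    does not vanish. *)
Lemma rep_multiplier_ae m h F (M : R) : rep h F -> cmeasurable setT m ->
  {ae mu, forall xi, nc (m xi * F xi) <= M * nc (F xi)} ->
  rep (multiplier m h) (fun xi => m xi * F xi) /\ wn (multiplier m h) <= M * wn h.
Proof.
move=> rF mm mM; have [iF _] := rF.
have mF : cmeasurable setT (fun xi => m xi * F xi).
  by apply: cmeasurableM => //; exact: cintegrable_meas iF.
have imF : cintegrable mu setT (fun xi => m xi * F xi).
  apply: cintegrable_ae_le mM => //.
  by apply: rintegrableZ => //; exact: cintegrable_nc.
have [iH _] := wiener_fourier (rep_wiener rF).
have r : rep (multiplier m h) (fun xi => m xi * F xi).
  split => //; rewrite /multiplier.
  apply/funext => x; rewrite /inv_fourier; congr (_ * _).
  apply: ae_eq_cintegral.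
  - apply: cmeasurableM; first exact: cmeasurable_char.
    by apply: cmeasurableM => //; exact: cintegrable_meas iH.
  - by apply: cmeasurableM => //; exact: cmeasurable_char.
  - by apply: filterS (rep_fourier rF) => xi ->.
split => //; rewrite (wn_rep r) (wn_rep rF) /L1norm.
rewrite -RintegralZl//; last exact: cintegrable_nc.
apply: ae_le_Rintegral => //; first exact: cintegrable_nc.
- by apply: rintegrableZ => //; exact: cintegrable_nc.
- by move=> xi; exact: nc_ge0.
Qed.

Definition bounded_symbol m M := cmeasurable setT m /\ forall xi, nc (m xi) <= M.

Lemma rep_multiplier m h F M : rep h F -> bounded_symbol m M ->
  rep (multiplier m h) (fun xi => m xi * F xi).
Proof.
move=> rF [mm mM].
have [] := @rep_multiplier_ae m h F M rF mm _ => //.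
by apply: nearW => xi; rewrite ncM ler_wpM2r ?nc_ge0.
Qed.

Lemma wiener_multiplier m h M : wiener h -> bounded_symbol m M ->
  wiener (multiplier m h).
Proof. by move=> [F rF] bm; eexists; exact: rep_multiplier rF bm. Qed.

Lemma wn_multiplier m h M : wiener h -> bounded_symbol m M ->
  wn (multiplier m h) <= M * wn h.
Proof.
move=> [F rF] [mm mM].
have [] := @rep_multiplier_ae m h F M rF mm _ => //.
by apply: nearW => xi; rewrite ncM ler_wpM2r ?nc_ge0.
Qed.

(** The continuous functionals on the Wiener algebra used to test the solution
    and to characterize time integrals. *)
Definition pair m h : R[i] := integralC mu setT (fun xi => m xi * fourier h xi).

Lemma pair_rep m h F : cmeasurable setT m -> rep h F ->
  pair m h = integralC mu setT (fun xi => m xi * F xi).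
Proof.
move=> mm rF; have [iF _] := rF; have [iH _] := wiener_fourier (rep_wiener rF).
apply: ae_eq_cintegral.
- by apply: cmeasurableM => //; exact: cintegrable_meas iH.
- by apply: cmeasurableM => //; exact: cintegrable_meas iF.
- by apply: filterS (rep_fourier rF) => xi ->.
Qed.

Lemma cintegrable_bs m M F : bounded_symbol m M -> cintegrable mu setT F ->
  cintegrable mu setT (fun xi => m xi * F xi).
Proof. by move=> [mm mM] iF; apply: (@cintegrableMl _ _ _ _ _ _ _ M). Qed.

Lemma pairD m M h h' : bounded_symbol m M -> wiener h -> wiener h' ->
  pair m (fun x => h x + h' x) = pair m h + pair m h'.
Proof.
move=> bm [F rF] [F' rF']; have [mm _] := bm.
rewrite (pair_rep mm (repD rF rF')) (pair_rep mm rF) (pair_rep mm rF').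
under eq_fun do rewrite mulrDr.
have [iF _] := rF; have [iF' _] := rF'.
by rewrite cintegralD//; exact: cintegrable_bs bm _.
Qed.

Lemma pairZ m M z h : bounded_symbol m M -> wiener h ->
  pair m (fun x => z * h x) = z * pair m h.
Proof.
move=> bm [F rF]; have [mm _] := bm.
rewrite (pair_rep mm (repZ z rF)) (pair_rep mm rF).
under eq_fun do rewrite mulrCA.
have [iF _] := rF.
by rewrite cintegralZ//; exact: cintegrable_bs bm _.
Qed.

Lemma pairB m M h h' : bounded_symbol m M -> wiener h -> wiener h' ->
  pair m (fun x => h x - h' x) = pair m h - pair m h'.
Proof.
move=> bm wh wh'; rewrite (pairD bm wh (wienerN wh')); congr (_ + _).
rewrite -mulN1r -(pairZ _ bm wh'); congr pair.
by apply/funext => x; rewrite mulN1r.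
Qed.

Lemma pair_sum m M (I : Type) (r : seq I) (P : pred I) (h : I -> plane -> R[i]) :
  bounded_symbol m M -> (forall i, wiener (h i)) ->
  pair m (fun x => \sum_(i <- r | P i) h i x) = \sum_(i <- r | P i) pair m (h i).
Proof.
move=> bm wh; elim: r => [|a r ih].
  under eq_fun do rewrite big_nil; rewrite big_nil.
  rewrite (pair_rep bm.1 rep0); under eq_fun do rewrite mulr0.
  by rewrite cintegral0.
under eq_fun do rewrite big_cons; rewrite big_cons; case: (P a) => //.
by rewrite (pairD bm)// ?ih//; exact: wiener_sum.
Qed.

Lemma nc_pair m M h : bounded_symbol m M -> wiener h -> nc (pair m h) <= M * wn h.
Proof.
move=> bm wh; have [mm mM] := bm; have [iH _] := wiener_fourier wh.
rewrite (le_trans (nc_cintegral _ (cintegrable_bs bm iH)))// /wn /L1norm.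
rewrite -RintegralZl//; last exact: cintegrable_nc.
apply: le_Rintegral => //.
- by apply: cintegrable_nc => //; exact: cintegrable_bs bm iH.
- by apply: rintegrableZ => //; exact: cintegrable_nc.
- by move=> xi _; rewrite ncM ler_wpM2r ?nc_ge0.
Qed.

Lemma bounded_symbolM m M m' M' : bounded_symbol m M -> bounded_symbol m' M' ->
  bounded_symbol (fun xi => m xi * m' xi) (M * M').
Proof.
move=> [mm mM] [mm' mM']; split; first exact: cmeasurableM.
by move=> xi; rewrite ncM ler_pM ?nc_ge0.
Qed.

Lemma bounded_symbolD m M m' M' : bounded_symbol m M -> bounded_symbol m' M' ->
  bounded_symbol (fun xi => m xi + m' xi) (M + M').
Proof.
move=> [mm mM] [mm' mM']; split; first exact: cmeasurableD.
by move=> xi; rewrite (le_trans (ncD _ _))// lerD.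
Qed.

Lemma bounded_symbolZ z m M : bounded_symbol m M ->
  bounded_symbol (fun xi => z * m xi) (nc z * M).
Proof.
move=> [mm mM]; split; first by apply: cmeasurableM => //; exact: cmeasurable_cst.
by move=> xi; rewrite ncM ler_wpM2l ?nc_ge0.
Qed.

Lemma pair_multiplier m M m' M' h : bounded_symbol m M -> bounded_symbol m' M' ->
  wiener h -> pair m (multiplier m' h) = pair (fun xi => m xi * m' xi) h.
Proof.
move=> bm bm' [F rF].
rewrite (pair_rep bm.1 (rep_multiplier rF bm')).
rewrite (pair_rep (bounded_symbolM bm bm').1 rF).
by congr integralC; apply/funext => xi; rewrite mulrA.
Qed.

Lemma multiplierD m M h h' : bounded_symbol m M -> wiener h -> wiener h' ->
  multiplier m (fun x => h x + h' x) = (fun x => multiplier m h x + multiplier m h' x).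
Proof.
move=> bm [F rF] [F' rF'].
have [_ ->] := rep_multiplier (repD rF rF') bm.
have [_ ->] := repD (rep_multiplier rF bm) (rep_multiplier rF' bm).
by congr inv_fourier; apply/funext => xi; rewrite mulrDr.
Qed.

Lemma multiplierZ m M z h : bounded_symbol m M -> wiener h ->
  multiplier m (fun x => z * h x) = (fun x => z * multiplier m h x).
Proof.
move=> bm [F rF].
have [_ ->] := rep_multiplier (repZ z rF) bm.
have [_ ->] := repZ z (rep_multiplier rF bm).
by congr inv_fourier; apply/funext => xi; rewrite mulrCA.
Qed.

Lemma multiplier_sum m M (I : Type) (r : seq I) (P : pred I) (h : I -> plane -> R[i]) :
  bounded_symbol m M -> (forall i, wiener (h i)) ->
  multiplier m (fun x => \sum_(i <- r | P i) h i x) =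
  (fun x => \sum_(i <- r | P i) multiplier m (h i) x).
Proof.
move=> bm wh.
have [_ ->] := rep_multiplier (rep_sum r P (fun i => wiener_fourier (wh i))) bm.
have [_ ->] := rep_sum r P (fun i => rep_multiplier (wiener_fourier (wh i)) bm).
by congr inv_fourier; apply/funext => xi; rewrite mulr_sumr.
Qed.

Lemma multiplier_comp m M m' M' h : bounded_symbol m M -> bounded_symbol m' M' ->
  wiener h -> multiplier m (multiplier m' h) = multiplier (fun xi => m xi * m' xi) h.
Proof.
move=> bm bm' [F rF].
have [_ ->] := rep_multiplier (rep_multiplier rF bm') bm.
have [_ ->] := rep_multiplier rF (bounded_symbolM bm bm').
by congr inv_fourier; apply/funext => xi; rewrite mulrA.
Qed.

Lemma multiplier_cst z h : wiener h -> multiplier (fun=> z) h = (fun x => z * h x).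
Proof.
move=> [F rF].
have bz : bounded_symbol (fun=> z) (nc z) by split => //; exact: cmeasurable_cst.
have [_ ->] := rep_multiplier rF bz.
by have [_ ->] := repZ z rF.
Qed.

Lemma rep_conj h F : rep h F ->
  rep (fun x => conjc (h x)) (fun xi => conjc (F (paffine (-1) (0, 0) xi))).
Proof.
move=> [iF ->].
have s1 : (-1 : R) ^+ 2 = 1 by rewrite sqrrN expr1n.
have [iF' eF'] := cintegrable_affine (0, 0) s1 iF.
have conjI (f : plane -> R[i]) : cintegrable mu setT f ->
    cintegrable mu setT (fun xi => conjc (f xi)).
  move=> If; apply: (cintegrable_le measurableT
    (cmeasurable_conj (cintegrable_meas If)) (cintegrable_nc measurableT If)).
  by move=> x _; rewrite nc_conj.
split; first exact: conjI.
apply/funext => x; rewrite /inv_fourier conj_realM; congr (_ * _).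
have [iE eE] := cintegrable_affine (0, 0) s1 (cintegrable_char x iF).
rewrite -eE /integralC; apply: complexP => /=.
  apply: eq_Rintegral => xi _.
  rewrite (_ : dotp x (paffine _ _ xi) = - dotp x xi).
    by rewrite expiN !ReM; case: (expi _) => a b; case: (F _) => c d /=; ring.
  by rewrite /dotp /paffine /affine /=; ring.
rewrite -mulN1r -RintegralZl//; last by have [] := iE.
apply: eq_Rintegral => xi _.
rewrite (_ : dotp x (paffine _ _ xi) = - dotp x xi).
  by rewrite expiN !ImM; case: (expi _) => a b; case: (F _) => c d /=; ring.
by rewrite /dotp /paffine /affine /=; ring.
Qed.

Lemma wiener_conj h : wiener h -> wiener (fun x => conjc (h x)).
Proof. by move=> [F rF]; eexists; exact: rep_conj rF. Qed.

Lemma wn_conj h : wiener h -> wn (fun x => conjc (h x)) = wn h.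
Proof.
move=> [F rF]; rewrite (wn_rep (rep_conj rF)) (wn_rep rF).
have s1 : (-1 : R) ^+ 2 = 1 by rewrite sqrrN expr1n.
rewrite /L1norm; under eq_Rintegral do rewrite nc_conj.
by have [_] := integrable_affine (0, 0) s1 (cintegrable_nc measurableT rF.1).
Qed.

Definition shift (eta xi : plane) : plane := paffine 1 (- eta.1, - eta.2) xi.

Definition conv F G (xi : plane) : R[i] :=
  integralC mu setT (fun eta => F eta * G (shift eta xi)).

Lemma measurable_shift : measurable_fun setT (fun z : plane * plane => shift z.1 z.2).
Proof.
have mp : measurable_fun setT (fst : plane * plane -> plane) by exact: measurable_fst.
have mq : measurable_fun setT (snd : plane * plane -> plane) by exact: measurable_snd.
have m1 : measurable_fun setT (fst : plane -> measurableTypeR R) by exact: measurable_fst.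
have m2 : measurable_fun setT (snd : plane -> measurableTypeR R) by exact: measurable_snd.
apply/measurable_fun_pairP; split.
  rewrite (_ : _ \o _ = (fun z : plane * plane => - z.1.1 + 1 * z.2.1))//.
  apply: measurable_funD.
    by apply: measurableT_comp => //; exact: (measurableT_comp m1 mp).
  by apply: measurable_funM => //; exact: (measurableT_comp m1 mq).
rewrite (_ : _ \o _ = (fun z : plane * plane => - z.1.2 + 1 * z.2.2))//.
apply: measurable_funD.
  by apply: measurableT_comp => //; exact: (measurableT_comp m2 mp).
by apply: measurable_funM => //; exact: (measurableT_comp m2 mq).
Qed.

Lemma cmeasurable_conv_kernel F G : cmeasurable setT F -> cmeasurable setT G ->
  cmeasurable setT (fun z : plane * plane => F z.1 * G (shift z.1 z.2)).
Proof.
move=> [F1 F2] [G1 G2].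
have mp : measurable_fun setT (fst : plane * plane -> plane) by exact: measurable_fst.
apply: cmeasurableM; split.
- exact: (measurableT_comp F1 mp).
- exact: (measurableT_comp F2 mp).
- exact: (measurableT_comp G1 measurable_shift).
- exact: (measurableT_comp G2 measurable_shift).
Qed.

Lemma integral_shift (f : plane -> R[i]) eta : cintegrable mu setT f ->
  cintegrable mu setT (fun xi => f (shift eta xi)) /\
  integralC mu setT (fun xi => f (shift eta xi)) = integralC mu setT f.
Proof. by apply: cintegrable_affine; rewrite expr1n. Qed.

Lemma Rintegral_shift (f : plane -> R) eta : mu.-integrable setT (EFin \o f) ->
  mu.-integrable setT (EFin \o (fun xi => f (shift eta xi))) /\
  \int[mu]_xi f (shift eta xi) = \int[mu]_xi f xi.
Proof. by apply: integrable_affine; rewrite expr1n. Qed.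

Lemma integrable_conv_kernel F G : cintegrable mu setT F -> cintegrable mu setT G ->
  (@sleb2 R \x @sleb2 R)%E.-integrable setT
    (EFin \o (fun z : plane * plane => nc (F z.1 * G (shift z.1 z.2)))).
Proof.
move=> iF iG.
have mF := cintegrable_meas iF; have mG := cintegrable_meas iG.
have nG := cintegrable_nc measurableT iG.
apply: (@integrable_prod _ _ _ _ R (@sleb2 R) (@sleb2 R) _ (fun eta => L1norm G * nc (F eta))).
- by apply: measurable_nc; exact: cmeasurable_conv_kernel.
- by move=> z; exact: nc_ge0.
- move=> eta /=; have [i1 _] := Rintegral_shift eta nG.
  have := rintegrableZ (nc (F eta)) measurableT i1; congr (_.-integrable).
  by apply/funext => xi /=; rewrite ncM.
- move=> eta /=; have [i1 e1] := Rintegral_shift eta nG.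
  rewrite mulrC /L1norm -e1 -RintegralZl//.
  by apply: eq_Rintegral => xi _; rewrite ncM.
- by apply: rintegrableZ => //; exact: cintegrable_nc.
Qed.

Lemma plane_Rfubini (f : plane * plane -> R) :
  (@sleb2 R \x @sleb2 R)%E.-integrable setT (EFin \o f) ->
  mu.-integrable setT (EFin \o (fun y => \int[mu]_x f (x, y))) /\
  \int[mu]_x \int[mu]_y f (x, y) = \int[mu]_y \int[mu]_x f (x, y).
Proof.
move=> /Rfubini[_ iG e1 e2]; split; first exact: iG.
exact: (etrans e1 (esym e2)).
Qed.

Lemma plane_fubini (f : plane * plane -> R[i]) :
  cintegrable (@sleb2 R \x @sleb2 R)%E setT f ->
  [/\ cintegrable mu setT (fun y => integralC mu setT (fun x => f (x, y))),
   integralC mu setT (fun x => integralC mu setT (fun y => f (x, y))) =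
   integralC mu setT (fun y => integralC mu setT (fun x => f (x, y))) &
   {ae mu, forall y, cintegrable mu setT (fun x => f (x, y))}].
Proof.
move=> /cfubini[_ i [e a]]; split; [exact: i|exact: e|exact: a].
Qed.

(** Multiplying two inversion formulas and substituting xi for the sum of the
    frequencies gives the convolution of the transforms; Tonelli's theorem gives
    its integrability and the submultiplicativity of the norm at once. *)
Lemma rep_mul h F h' F' : rep h F -> rep h' F' ->
  rep (fun x => h x * h' x) (fun xi => c0%:C * conv F F' xi) /\
  wn (fun x => h x * h' x) <= c0 * (wn h * wn h').
Proof.
move=> rF rG; have [iF hF] := rF; have [iG hG] := rG.
have mF := cintegrable_meas iF; have mG := cintegrable_meas iG.
have nG := cintegrable_nc measurableT iG.
have nF := cintegrable_nc measurableT iF.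
have iK := integrable_conv_kernel iF iG.
have mK := cmeasurable_conv_kernel mF mG.
have cK : cintegrable (@sleb2 R \x @sleb2 R)%E setT
    (fun z : plane * plane => F z.1 * F' (shift z.1 z.2)).
  by apply: cintegrable_le iK _.
have [iconv _ aeK] := plane_fubini cK.
have r : rep (fun x => h x * h' x) (fun xi => c0%:C * conv F F' xi).
  split; first exact: (cintegrableZ _ _ iconv).
  apply/funext => x; rewrite hF hG /inv_fourier -/c0.
  transitivity (c0%:C * (c0%:C *
      integralC mu setT (fun xi => expi (dotp x xi) * conv F F' xi))); last first.
    congr (_ * _); rewrite -cintegralZ//; last exact: (cintegrable_char x iconv).
    by congr integralC; apply/funext => xi; rewrite mulrCA.
  rewrite mulrACA [RHS]mulrA; congr (_ * _).
  have mexp : cmeasurable setT (fun z : plane * plane => expi (dotp x z.2)).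
    apply: cmeasurable_expi.
    have mq : measurable_fun setT (snd : plane * plane -> plane) by exact: measurable_snd.
    exact: (measurableT_comp (measurable_dotp x) mq).
  have cK' : cintegrable (@sleb2 R \x @sleb2 R)%E setT
      (fun z : plane * plane => expi (dotp x z.2) * (F z.1 * F' (shift z.1 z.2))).
    by apply: (@cintegrableMl _ _ _ _ _ _ _ 1) => // z _; rewrite nc_expi.
  have [iconv' fub _] := plane_fubini cK'.
  transitivity (integralC mu setT (fun xi => integralC mu setT
      (fun eta => expi (dotp x xi) * (F eta * F' (shift eta xi))))); last first.
    apply: ae_eq_cintegral.
    - exact: (cintegrable_meas iconv').
    - apply: cmeasurableM; first exact: cmeasurable_char.
      exact: (cintegrable_meas iconv).
    - by apply: filterS aeK => xi k; rewrite cintegralZ.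
  set B := integralC mu setT (fun xi => expi (dotp x xi) * F' xi).
  have eB : integralC mu setT (fun xi => expi (dotp x xi) * F xi) * B =
      integralC mu setT (fun eta => B * (expi (dotp x eta) * F eta)).
    by rewrite (cintegralZ B measurableT (cintegrable_char x iF)) mulrC.
  apply: (etrans eB); apply: etrans fub.
  congr integralC; apply/funext => eta.
  have [i1 e1] := integral_shift eta (cintegrable_char x iG).
  rewrite mulrC /B -e1; apply: etrans (esym (cintegralZ _ measurableT i1)) _.
  congr integralC; apply/funext => xi.
  rewrite /= mulrACA -expiD; congr (expi _ * _).
  by rewrite /dotp /shift /paffine /affine /=; ring.
split => //; rewrite (wn_rep r) (wn_rep rF) (wn_rep rG).
have -> : L1norm (fun xi => c0%:C * conv F F' xi) = c0 * L1norm (conv F F').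
  rewrite /L1norm -RintegralZl//; last exact: (cintegrable_nc measurableT iconv).
  by apply: eq_Rintegral => xi _; rewrite ncM ncR// c0_ge0.
rewrite ler_wpM2l ?c0_ge0//.
have [j2 e12] := plane_Rfubini iK.
apply: (@le_trans _ _ (\int[mu]_xi \int[mu]_eta nc (F eta * F' (shift eta xi)))).
  apply: (ae_le_Rintegral (cintegrable_nc measurableT iconv) j2).
    by move=> xi; exact: nc_ge0.
  by apply: filterS aeK => xi k; exact: (nc_cintegral measurableT k).
rewrite -[leLHS]e12 le_eqVlt; apply/orP; left; apply/eqP.
rewrite [RHS]mulrC; apply: etrans (RintegralZl (L1norm F') measurableT nF).
apply: eq_Rintegral => eta _; have [i1 e1] := Rintegral_shift eta nG.
rewrite /L1norm -e1 mulrC; apply: etrans (RintegralZl (nc (F eta)) measurableT i1).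
by apply: eq_Rintegral => xi _; rewrite ncM.
Qed.

Lemma wienerM h h' : wiener h -> wiener h' -> wiener (fun x => h x * h' x).
Proof. by move=> [F rF] [F' rF']; have [r _] := rep_mul rF rF'; eexists; exact: r. Qed.

Lemma wnM h h' : wiener h -> wiener h' ->
  wn (fun x => h x * h' x) <= c0 * (wn h * wn h').
Proof. by move=> [F rF] [F' rF']; have [_ r] := rep_mul rF rF'. Qed.

End Wiener.

(** * Curves in the Wiener algebra and their time integrals *)

Section Sequences.
Variable R : realType.

(** Retracts the line onto [0, a], so that a function continuous on [0, a] is
    studied through a function continuous everywhere. *)
Definition clamp (a t : R) : R := Num.max 0 (Num.min t a).

Lemma clamp_in (a t : R) : 0 <= a -> 0 <= clamp a t <= a.
Proof. by move=> a0; rewrite /clamp le_max lexx/= ge_max a0 ge_min lexx orbT. Qed.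

Lemma clamp_id (a t : R) : 0 <= t <= a -> clamp a t = t.
Proof.
by move=> /andP[t0 ta]; rewrite /clamp (min_idPl ta) (max_idPr t0).
Qed.

Lemma cvg_dist0 (u v : nat -> R) (l : R) : (forall n, `|u n - l| <= v n) ->
  v @ \oo --> (0 : R) -> u @ \oo --> l.
Proof.
move=> uv v0; apply: (@squeeze_cvgr _ _ _ _ (fun n => l - v n) (fun n => l + v n)).
- by apply: nearW => n; rewrite -ler_distl.
- by rewrite -[X in _ --> X](subr0 l); apply: cvgB => //; exact: cvg_cst.
- by rewrite -[X in _ --> X](addr0 l); apply: cvgD => //; exact: cvg_cst.
Qed.

Lemma eq_cvgn (u v : nat -> R) (l : R) : (forall n, u n = v n) ->
  u @ \oo --> l -> v @ \oo --> l.
Proof. by move=> /funext ->. Qed.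

Lemma cvgn_dist (u : nat -> R) (l : R) : u @ \oo --> l -> `|u n - l| @[n --> \oo] --> (0 : R).
Proof.
move=> ul; have : u n - l @[n --> \oo] --> l - l by apply: cvgB => //; exact: cvg_cst.
by rewrite subrr => /cvg_norm; rewrite normr0.
Qed.

Lemma clamp_lip (a x y : R) : `|clamp a x - clamp a y| <= `|x - y|.
Proof.
have hmax (p q : R) : `|Num.max 0 p - Num.max 0 q| <= `|p - q|.
  have h1 := ler_norm (p - q); have h2 := ler_norm (q - p).
  rewrite distrC in h2; rewrite ler_norml.
  by case: (leP 0 p) => p0; case: (leP 0 q) => q0; apply/andP; split; lra.
have hmin (p q : R) : `|Num.min p a - Num.min q a| <= `|p - q|.
  have h1 := ler_norm (p - q); have h2 := ler_norm (q - p).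
  rewrite distrC in h2; rewrite ler_norml.
  by case: (leP p a) => p0; case: (leP q a) => q0; apply/andP; split; lra.
exact: le_trans (hmax _ _) (hmin _ _).
Qed.

(** Continuity on [0, a] by sequences, the form in which dominated convergence
    produces and consumes it. *)
Definition seqcont (a : R) (f : R -> R) := forall (t : R) (s : nat -> R),
  0 <= t <= a -> (forall n, 0 <= s n <= a) -> s @ \oo --> t ->
  f (s n) @[n --> \oo] --> f t.

Lemma seqcont_clamp (a : R) f : 0 <= a -> seqcont a f -> continuous (f \o clamp a).
Proof.
move=> a0 fc t; apply/(@cvg_nbhsP R R^o) => u ut.
apply: (fc (clamp a t) (fun n => clamp a (u n))); [exact: clamp_in|..].
  by move=> n; exact: clamp_in.
by apply: cvg_dist0 (cvgn_dist ut) => n; exact: clamp_lip.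
Qed.

Lemma sub_itv0 (a : R) (D : set R) : D `<=` `[0, a] -> forall s, D s -> 0 <= s <= a.
Proof. by move=> Da s /Da /=; rewrite in_itv. Qed.

Lemma seqcont_measurable a f (D : set (measurableTypeR R)) : 0 <= a ->
  seqcont a f -> D `<=` `[0, a] -> measurable_fun D f.
Proof.
move=> a0 fc Da.
apply: (@eq_measurable_fun _ _ _ _ _ (f \o clamp a)).
  by move=> s /set_mem Ds /=; rewrite clamp_id//; exact: sub_itv0 Ds.
apply: measurable_funTS; apply: continuous_measurable_fun; exact: seqcont_clamp.
Qed.

Lemma seqcont_bounded a f : 0 <= a -> seqcont a f ->
  exists B, forall t : R, 0 <= t <= a -> f t <= B.
Proof.
move=> a0 fc.
have [c _ hc] := EVT_max a0 (continuous_subspaceT (seqcont_clamp a0 fc)).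
exists (f (clamp a c)) => t ta; have := hc t; rewrite /= in_itv/= => /(_ ta).
by rewrite (clamp_id ta).
Qed.

Lemma leb_sub_finite (a : R) (D : set (measurableTypeR R)) : 0 <= a ->
  measurable D -> D `<=` `[0, a] -> (leb R D < +oo)%E.
Proof.
move=> a0 mD Da; apply: (@le_lt_trans _ _ (leb R `[0, a]%classic)).
  by apply: le_measure; rewrite ?inE.
have -> : leb R `[0, a]%classic = _ := lebesgue_measure_itv `[0, a].
by case: ifP => _; rewrite /= ?ltry.
Qed.

Lemma seqcont_integrable a f (D : set (measurableTypeR R)) : 0 <= a ->
  seqcont a f -> measurable D -> D `<=` `[0, a] ->
  (leb R).-integrable D (EFin \o f).
Proof.
move=> a0 fc mD Da; apply: measurable_bounded_integrable => //.
- exact: leb_sub_finite Da.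
- exact: seqcont_measurable Da.
have fc' : seqcont a (fun t => `|f t|).
  by move=> t s h1 h2 h3; apply: cvg_norm; exact: fc.
have [B hB] := seqcont_bounded a0 fc'.
exists B; split; first exact: num_real.
by move=> x Bx t /= Dt; rewrite (le_trans (hB _ (sub_itv0 Da Dt)))// ltW.
Qed.

End Sequences.

Section Curves.
Variable R : realType.
Local Notation plane := (plane R).
Local Notation mu := (leb2 R).
Implicit Types (h : R -> plane -> R[i]).

(** Continuity for the norm [wn]. The Wiener algebra is kept as a predicate on
    functions of x, as the integral equation is stated pointwise in x. *)
Definition wcont (a : R) h :=
  (forall t : R, 0 <= t <= a -> wiener (h t)) /\
  forall (t : R) (s : nat -> R),
    0 <= t <= a -> (forall n, 0 <= s n <= a) -> s @ \oo --> t ->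
    wn (fun x => h (s n) x - h t x) @[n --> \oo] --> (0 : R).

Lemma wcont_sub (a b : R) h : b <= a -> wcont a h -> wcont b h.
Proof.
move=> ba [wh hc]; have sub t : 0 <= t <= b -> 0 <= t <= a.
  by move=> /andP[-> tb]; rewrite (le_trans tb ba).
by split => [t /sub/wh//|t s /sub t0 sn]; apply: hc => // n; exact: sub.
Qed.

Lemma eq_wcont (a : R) h h' : (forall t, 0 <= t <= a -> h t = h' t) -> wcont a h -> wcont a h'.
Proof.
move=> e [wh hc]; split => [t ta|t s ta sa st]; first by rewrite -e//; exact: wh.
by apply: eq_cvgn (hc t s ta sa st) => n; rewrite !e.
Qed.

Lemma wcont_cst a (h : plane -> R[i]) : wiener h -> wcont a (fun=> h).
Proof.
move=> wh; split => // t s _ _ _.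
have -> : (fun n : nat => wn (fun x => h x - h x)) = cst (0 : R).
  by apply/funext => n; under eq_fun do rewrite subrr; rewrite wn0.
exact: cvg_cst.
Qed.

Lemma wcontD a h h' : wcont a h -> wcont a h' -> wcont a (fun t x => h t x + h' t x).
Proof.
move=> [wh hc] [wh' hc']; split => [t ta|t s ta sa st].
  by apply: wienerD; [exact: wh|exact: wh'].
apply: (@squeeze_cvgr _ _ _ _ (cst 0) (fun n => wn (fun x => h (s n) x - h t x) +
    wn (fun x => h' (s n) x - h' t x))).
- apply: nearW => n; rewrite wn_ge0/=.
  have -> : (fun x => h (s n) x + h' (s n) x - (h t x + h' t x)) =
    (fun x => (h (s n) x - h t x) + (h' (s n) x - h' t x)).
    by apply/funext => x; rewrite opprD addrACA.
  by apply: wnD; apply: wienerB; (try exact: wh); exact: wh'.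
- exact: cvg_cst.
- by rewrite -(addr0 (0 : R)); apply: cvgD; [exact: hc|exact: hc'].
Qed.

(** The symbols need only converge pointwise: dominated convergence against the
    transform of [h t] gives convergence in norm. *)
Lemma wcont_symbol (a : R) h (m : R -> plane -> R[i]) M : wcont a h ->
  (forall t : R, 0 <= t <= a -> bounded_symbol (m t) M) ->
  (forall (t : R) (s : nat -> R) xi, 0 <= t <= a -> (forall n, 0 <= s n <= a) ->
    s @ \oo --> t -> nc (m (s n) xi - m t xi) @[n --> \oo] --> (0 : R)) ->
  wcont a (fun t => multiplier (m t) (h t)).
Proof.
move=> [wh hc] bm mc; split => [t ta|t s ta sa st].
  by apply: wiener_multiplier (bm t ta); exact: wh.
have M0 : 0 <= M by have [_ /(_ (0, 0))] := bm t ta; apply: le_trans; exact: nc_ge0.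
have rF := wiener_fourier (wh t ta); set F := fourier (h t) in rF.
have iF := rF.1.
have bd n : bounded_symbol (fun xi => m (s n) xi - m t xi) (M + M).
  have [m1 b1] := bm _ (sa n); have [m2 b2] := bm t ta; split.
    apply: cmeasurableD => //; have := cmeasurableM (cmeasurable_cst setT (-1)) m2.
    by under eq_fun do rewrite mulN1r.
  by move=> xi; rewrite (le_trans (ncB _ _))// lerD.
apply: (@squeeze_cvgr _ _ _ _ (cst 0) (fun n => M * wn (fun x => h (s n) x - h t x) +
    L1norm (fun xi => (m (s n) xi - m t xi) * F xi))).
- apply: nearW => n; rewrite wn_ge0/=.
  have wd := wienerB (wh _ (sa n)) (wh t ta).
  have r2 := rep_multiplier rF (bd n).
  have -> : (fun x => multiplier (m (s n)) (h (s n)) x - multiplier (m t) (h t) x) =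
     (fun x => multiplier (m (s n)) (fun x => h (s n) x - h t x) x +
       multiplier (fun xi => m (s n) xi - m t xi) (h t) x).
    have r3 := wiener_fourier (wh _ (sa n)).
    have [_ ->] := repB (rep_multiplier r3 (bm _ (sa n))) (rep_multiplier rF (bm t ta)).
    have [_ ->] := repD (rep_multiplier (repB r3 rF) (bm _ (sa n))) r2.
    by congr inv_fourier; apply/funext => xi; rewrite /F; ring.
  rewrite (le_trans (wnD _ _))//.
  + exact: wiener_multiplier (bm _ (sa n)).
  + exact: rep_wiener r2.
  + by apply: lerD; [exact: wn_multiplier (bm _ (sa n))|rewrite (wn_rep r2)].
- exact: cvg_cst.
- rewrite -(addr0 (0 : R)); apply: cvgD.
    by rewrite -(mulr0 M); apply: cvgM; [exact: cvg_cst|exact: hc].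
  apply: (@dominated_cvg0 _ _ _ mu setT _ (fun xi => (M + M) * nc (F xi))) => //.
  + move=> n; apply: measurable_nc; apply: cmeasurableM; first by have [] := bd n.
    exact: cintegrable_meas iF.
  + by apply: rintegrableZ => //; exact: cintegrable_nc.
  + move=> n xi _; rewrite nc_ge0/= ncM ler_wpM2r ?nc_ge0//.
    by have [_] := bd n; apply.
  + move=> xi _; under eq_fun do rewrite ncM.
    by rewrite -(mul0r (nc (F xi))); apply: cvgM; [exact: mc|exact: cvg_cst].
Qed.

Lemma wcont_multiplier a h m M : wcont a h -> bounded_symbol m M ->
  wcont a (fun t => multiplier m (h t)).
Proof.
move=> wh bm; apply: (wcont_symbol (m := fun=> m) wh (fun _ _ => bm)) => t s xi _ _ _.
by under eq_fun do rewrite subrr nc0; exact: cvg_cst.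
Qed.

Lemma wcontZ a h z : wcont a h -> wcont a (fun t x => z * h t x).
Proof.
move=> [wh hc]; split => [t ta|t s ta sa st]; first exact: wienerZ (wh t ta).
have -> : (fun n => wn (fun x => z * h (s n) x - z * h t x)) =
    (fun n => nc z * wn (fun x => h (s n) x - h t x)).
  apply/funext => n; rewrite -wnZ; last by apply: wienerB; exact: wh.
  by congr wn; apply/funext => x; rewrite mulrBr.
by rewrite -(mulr0 (nc z)); apply: cvgM; [exact: cvg_cst|exact: hc].
Qed.

Lemma wcont_sum a (I : Type) (r : seq I) (P : pred I) (h : I -> R -> plane -> R[i]) :
  (forall i, wcont a (h i)) -> wcont a (fun t x => \sum_(i <- r | P i) h i t x).
Proof.
move=> wh; elim: r => [|i r ih].
  apply: eq_wcont (wcont_cst a (@wiener0 R)) => t _.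
  by apply/funext => x; rewrite big_nil.
have [Pi|Pi] := boolP (P i).
  apply: eq_wcont (wcontD (wh i) ih) => t _.
  by apply/funext => x; rewrite big_cons Pi.
apply: eq_wcont ih => t _.
by apply/funext => x; rewrite big_cons (negbTE Pi).
Qed.

Lemma wcont_conj a h : wcont a h -> wcont a (fun t x => conjc (h t x)).
Proof.
move=> [wh hc]; split => [t ta|t s ta sa st]; first exact: wiener_conj (wh t ta).
apply: eq_cvgn (hc t s ta sa st) => n.
rewrite -wn_conj; last by apply: wienerB; exact: wh.
by congr wn; apply/funext => x; rewrite rmorphB.
Qed.

Lemma wcont_seqcont_wn a h : wcont a h -> seqcont a (fun t => wn (h t)).
Proof.
move=> [wh hc] t s ta sa st; apply: cvg_dist0 (hc t s ta sa st) => n.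
by apply: wn_dist; exact: wh.
Qed.

Lemma wcont_bounded a h : 0 <= a -> wcont a h ->
  exists B, forall t : R, 0 <= t <= a -> wn (h t) <= B.
Proof. by move=> a0 /wcont_seqcont_wn; exact: seqcont_bounded. Qed.

Lemma wcontM a h h' : 0 <= a -> wcont a h -> wcont a h' ->
  wcont a (fun t x => h t x * h' t x).
Proof.
move=> a0 ch ch'; have [wh hc] := ch; have [wh' hc'] := ch'.
have [B hB] := wcont_bounded a0 ch.
split => [t ta|t s ta sa st]; first by apply: wienerM; [exact: wh|exact: wh'].
apply: (@squeeze_cvgr _ _ _ _ (cst 0) (fun n =>
   c0 R * (wn (fun x => h (s n) x - h t x) * wn (h' t)) +
   c0 R * (B * wn (fun x => h' (s n) x - h' t x)))).
- apply: nearW => n; rewrite wn_ge0/=.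
  have d1 := wienerB (wh _ (sa n)) (wh t ta).
  have d2 := wienerB (wh' _ (sa n)) (wh' t ta).
  have -> : (fun x => h (s n) x * h' (s n) x - h t x * h' t x) =
    (fun x => (h (s n) x - h t x) * h' t x + h (s n) x * (h' (s n) x - h' t x)).
    by apply/funext => x; ring.
  rewrite (le_trans (wnD _ _))//; [exact: wienerM d1 (wh' t ta)|
    exact: wienerM (wh _ (sa n)) d2|].
  apply: lerD; first exact: wnM d1 (wh' t ta).
  rewrite (le_trans (wnM (wh _ (sa n)) d2))// ler_wpM2l ?c0_ge0// ler_wpM2r ?wn_ge0//.
  exact: hB.
- exact: cvg_cst.
- rewrite -[X in _ --> X](_ : c0 R * (0 * wn (h' t)) + c0 R * (B * 0) = 0); last first.
    by rewrite mul0r !mulr0 addr0.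
  apply: cvgD; apply: cvgM; [exact: cvg_cst| |exact: cvg_cst|].
    by apply: cvgM; [exact: hc|exact: cvg_cst].
  by apply: cvgM; [exact: cvg_cst|exact: hc'].
Qed.

Definition cseqcont (a : R) (f : R -> R[i]) :=
  seqcont a (fun t => Re (f t)) /\ seqcont a (fun t => Im (f t)).

Lemma cseqcont_dist a (f : R -> R[i]) (g : R -> (nat -> R) -> nat -> R) :
  (forall (t : R) (s : nat -> R), 0 <= t <= a -> (forall n, 0 <= s n <= a) -> s @ \oo --> t ->
    (forall n, nc (f (s n) - f t) <= g t s n) /\ g t s @ \oo --> (0 : R)) ->
  cseqcont a f.
Proof.
move=> fg; split=> t s ta sa st; have [le_g g0] := fg t s ta sa st;
  apply: cvg_dist0 g0 => n; apply: le_trans (le_g n).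
- have -> : Re (f (s n)) - Re (f t) = Re (f (s n) - f t).
    by case: (f (s n)) => ? ?; case: (f t).
  exact: Re_le_nc.
- have -> : Im (f (s n)) - Im (f t) = Im (f (s n) - f t).
    by case: (f (s n)) => ? ?; case: (f t).
  exact: Im_le_nc.
Qed.

Lemma cseqcont_integrable a f (D : set (measurableTypeR R)) : 0 <= a ->
  cseqcont a f -> measurable D -> D `<=` `[0, a] -> cintegrable (leb R) D f.
Proof. by move=> a0 [f1 f2] mD Da; split; apply: (seqcont_integrable a0). Qed.

Lemma wcont_pair a h m M : wcont a h -> bounded_symbol m M ->
  cseqcont a (fun t => pair m (h t)).
Proof.
move=> [wh hc] bm; apply: (@cseqcont_dist _ _
  (fun t s n => M * wn (fun x => h (s n) x - h t x))) => t s ta sa st; split.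
  move=> n; rewrite -(pairB bm (wh _ (sa n)) (wh t ta)).
  by apply: nc_pair => //; apply: wienerB; exact: wh.
by rewrite -(mulr0 M); apply: cvgM; [exact: cvg_cst|exact: hc].
Qed.

Lemma wcont_eval a h x : wcont a h -> cseqcont a (fun t => h t x).
Proof.
move=> [wh hc]; apply: (@cseqcont_dist _ _
  (fun t s n => c0 R * wn (fun x => h (s n) x - h t x))) => t s ta sa st; split.
  move=> n; apply: (@nc_le_wn R (fun x => h (s n) x - h t x)).
  by apply: wienerB; exact: wh.
by rewrite -(mulr0 (c0 R)); apply: cvgM; [exact: cvg_cst|exact: hc].
Qed.


Section TimeIntegral.
Variables (a : R) (h : R -> plane -> R[i]) (D : set (measurableTypeR R)).
Hypotheses (a0 : 0 <= a) (hc : wcont a h) (mD : measurable D) (Da : D `<=` `[0, a]).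

Local Notation ind A := (fun xi : plane => (\1_A xi : R)%:C).

Lemma bounded_ind (A : set plane) : measurable A -> bounded_symbol (ind A) 1.
Proof. by move=> mA; split; [exact: cmeasurable_indic|exact: nc_indic]. Qed.

Let Lpair (m : plane -> R[i]) : R[i] := integralC (leb R) D (fun s => pair m (h s)).

Let B := sval (cid (wcont_bounded a0 hc)).
Let hB t : D t -> wn (h t) <= B.
Proof.
move=> Dt; rewrite /B; case: cid => /= b; apply; exact: (sub_itv0 Da Dt).
Qed.

Let lD : R := fine (leb R D).

Let wh t : D t -> wiener (h t).
Proof. by move=> Dt; apply: hc.1; exact: (sub_itv0 Da Dt). Qed.

Let ipair m M : bounded_symbol m M -> cintegrable (leb R) D (fun s => pair m (h s)).
Proof. by move=> bm; apply: (cseqcont_integrable a0 (wcont_pair hc bm)). Qed.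

Let icst (r : R) : (leb R).-integrable D (EFin \o (fun=> r)).
Proof.
apply: measurable_bounded_integrable => //; first exact: leb_sub_finite Da.
exists `|r|; split; first exact: num_real.
by move=> x rx t _; exact: ltW.
Qed.

Lemma nc_integral_le (f : R -> R[i]) (b : R) : cintegrable (leb R) D f ->
  (forall t, D t -> nc (f t) <= b) -> nc (integralC (leb R) D f) <= b * lD.
Proof.
move=> fi fb; rewrite (le_trans (nc_cintegral mD fi))//.
rewrite /lD -Rintegral_cst//; apply: le_Rintegral => //.
exact: cintegrable_nc.
Qed.

Let Lpair_bound m M : bounded_symbol m M -> nc (Lpair m) <= (M * B) * lD.
Proof.
move=> bm; apply: nc_integral_le; first exact: ipair bm.
move=> t Dt; have [mm mM] := bm.
have M0 : 0 <= M by apply: le_trans (mM (0, 0)); exact: nc_ge0.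
by rewrite (le_trans (nc_pair bm (wh Dt)))// ler_wpM2l// hB.
Qed.

Let pairDs m M m' M' s : D s -> bounded_symbol m M -> bounded_symbol m' M' ->
  pair (fun xi => m xi + m' xi) (h s) = pair m (h s) + pair m' (h s).
Proof.
move=> Ds bm bm'; have [iF _] := wiener_fourier (wh Ds).
rewrite /pair; under eq_fun do rewrite mulrDl.
by apply: cintegralD => //; [exact: cintegrable_bs bm iF|exact: cintegrable_bs bm' iF].
Qed.

Let pairZs m M z s : D s -> bounded_symbol m M ->
  pair (fun xi => z * m xi) (h s) = z * pair m (h s).
Proof.
move=> Ds bm; have [iF _] := wiener_fourier (wh Ds).
rewrite /pair; under eq_fun do rewrite -mulrA.
by apply: cintegralZ => //; exact: cintegrable_bs bm iF.
Qed.

Let LpairD m M m' M' : bounded_symbol m M -> bounded_symbol m' M' ->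
  Lpair (fun xi => m xi + m' xi) = Lpair m + Lpair m'.
Proof.
move=> bm bm'; rewrite /Lpair -cintegralD//; [|exact: ipair bm|exact: ipair bm'].
by apply: eq_cintegral => s /set_mem Ds; exact: (pairDs Ds bm bm').
Qed.

Let LpairZ m M z : bounded_symbol m M -> Lpair (fun xi => z * m xi) = z * Lpair m.
Proof.
move=> bm; rewrite /Lpair -cintegralZ//; last exact: ipair bm.
by apply: eq_cintegral => s /set_mem Ds; exact: (pairZs _ Ds bm).
Qed.

Let Lpair_cvg (u : nat -> plane -> R[i]) m :
  (forall n, bounded_symbol (u n) 1) -> bounded_symbol m 1 ->
  (forall xi, nc (u n xi - m xi) @[n --> \oo] --> (0 : R)) ->
  nc (Lpair (u n) - Lpair m) @[n --> \oo] --> (0 : R).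
Proof.
move=> bu bm um.
have [] // := @cdominated_cvg _ _ _ (leb R) D (fun n s => pair (u n) (h s))
  (fun s => pair m (h s)) (fun=> B) mD.
- by move=> n; exact: cintegrable_meas (ipair (bu n)).
- exact: cintegrable_meas (ipair bm).
- move=> n s Ds; rewrite (le_trans (nc_pair (bu n) (wh Ds)))// mul1r; exact: hB.
move=> s Ds; have [iF _] := wiener_fourier (wh Ds).
have [] // := @cdominated_cvg _ _ _ mu setT (fun n xi => u n xi * fourier (h s) xi)
  (fun xi => m xi * fourier (h s) xi) (fun xi => nc (fourier (h s) xi)) measurableT.
- by move=> n; exact: cintegrable_meas (cintegrable_bs (bu n) iF).
- exact: cintegrable_meas (cintegrable_bs bm iF).
- exact: cintegrable_nc.
- by move=> n xi _; rewrite ncM ler_piMl ?nc_ge0//; have [_] := bu n; apply.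
move=> xi _; under eq_fun do rewrite -mulrBl ncM.
by rewrite -(mul0r (nc (fourier (h s) xi))); apply: cvgM => //; exact: cvg_cst.
Qed.

Let Lpair0 : Lpair (ind set0) = 0.
Proof.
have := LpairZ 0 (bounded_ind (@measurable0 _ plane)); rewrite mul0r => <-.
by congr Lpair; apply/funext => xi; rewrite indicE in_set0 mul0r.
Qed.

Let Lpair_sum (A : nat -> set plane) n : (forall k, measurable (A k)) -> trivIset setT A ->
  Lpair (ind (\bigcup_(k < n) A k)) = \sum_(k < n) Lpair (ind (A k)).
Proof.
move=> mA tA; elim: n => [|n ih]; first by rewrite big_ord0 bigcup_mkord big_ord0 Lpair0.
have mU k : measurable (\bigcup_(j < k) A j) by apply: bigcup_measurable => j _; exact: mA.
rewrite big_ord_recr /= -ih -(LpairD (bounded_ind (mU n)) (bounded_ind (mA n))).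
congr Lpair; apply/funext => xi; rewrite -rmorphD; congr (_%:C).
rewrite !bigcup_mkord big_ord_recr /= !indicE in_setU.
have [x1|x1] /= := boolP (xi \in \big[setU/set0]_(i < n) A i);
  have [x2|x2] /= := boolP (xi \in A n); rewrite ?addr0 ?add0r//.
exfalso; move: x1 x2 => /set_mem; rewrite -bigcup_mkord => -[k /= kn Ak] /set_mem An.
have e : k = n by apply: tA => //; exists xi.
by rewrite e ltnn in kn.
Qed.

Let Lpair_sigma (A : nat -> set plane) :
  (forall k, measurable (A k)) -> trivIset setT A ->
  nc (\sum_(k < n) Lpair (ind (A k)) - Lpair (ind (\bigcup_k A k))) @[n --> \oo]
    --> (0 : R).
Proof.
move=> mA tA.
have mU k : measurable (\bigcup_(j < k) A j) by apply: bigcup_measurable => j _; exact: mA.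
have mV : measurable (\bigcup_k A k) by exact: bigcupT_measurable.
apply: eq_cvgn (Lpair_cvg (u := fun n => ind (\bigcup_(k < n) A k))
   (fun n => bounded_ind (mU n)) (bounded_ind mV) _).
  by move=> n; rewrite Lpair_sum.
move=> xi; apply: (@cvg_trans _ ((cst (0 : R)) @ \oo)); last exact: cvg_cst.
apply: near_eq_cvg; rewrite indicE.
have [x1|x1] := boolP (xi \in _).
  have [i _ Ai] := set_mem x1; exists i.+1 => // n ni.
  have e : xi \in \bigcup_(k < n) A k by apply/mem_set; exists i.
  by rewrite indicE e subrr nc0.
apply: nearW => n; rewrite indicE.
suff /negbTE -> : xi \notin \bigcup_(i < n) A i by rewrite subrr nc0.
by apply: contra x1 => /set_mem[i _ Ai]; apply/mem_set; exists i.
Qed.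

Let Lpair_null (A : set plane) : measurable A -> mu A = 0%E -> Lpair (ind A) = 0.
Proof.
move=> mA A0; rewrite /Lpair -[RHS](@cintegral0 _ _ _ (leb R) D).
apply: eq_cintegral => s /set_mem Ds; have [iF _] := wiener_fourier (wh Ds).
rewrite -[RHS](@cintegral0 _ _ _ mu setT).
apply: ae_eq_cintegral; [|exact: cmeasurable_cst|].
  apply: cmeasurableM; first exact: cmeasurable_indic.
  exact: cintegrable_meas iF.
exists A; split => // xi /= nxi; apply: contra_notP nxi => nA.
by rewrite indicE memNset// mul0r.
Qed.

(** The set function that maps A to the integral over s in D of the integral of
    [fourier (h s)] over A is countably additive and absolutely continuous. The
    theorem of Radon and Nikodym gives it a density, one real component at a
    time, although [fourier (h s)] need not be jointly measurable in s and xi: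
    it is chosen separately for every s. *)
Let density (p : R[i] -> R) : (forall z w, p (z + w) = p z + p w) ->
  (forall z, `|p z| <= nc z) ->
  exists2 f : plane -> R, mu.-integrable setT (EFin \o f) &
    forall A, measurable A -> \int[mu]_xi (\1_A xi * f xi) = p (Lpair (ind A)).
Proof.
move=> pD pb.
have p0 : p 0 = 0 by have /eqP := pD 0 0; rewrite addr0 -subr_eq subrr => /eqP <-.
have pN z : p (- z) = - p z.
  by apply/eqP; rewrite -addr_eq0 -pD addNr p0.
pose nu (A : set plane) : \bar R := (p (Lpair (ind A)))%:E.
have nu0 : nu set0 = 0%E by rewrite /nu Lpair0 p0.
have nuf A : measurable A -> nu A \is a fin_num by [].
have nus : semi_sigma_additive nu.
  move=> A mA tA mU.
  have -> : (fun n => \sum_(0 <= k < n) nu (A k))%E =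
      EFin \o (fun n => \sum_(k < n) p (Lpair (ind (A k)))).
    by apply/funext => n; rewrite /= big_mkord sumEFin.
  apply: cvg_EFin; first exact: nearW.
  apply: (@cvg_dist0 _ (fun n => \sum_(k < n) p (Lpair (ind (A k)))) _ _ _
    (Lpair_sigma mA tA)) => n.
  rewrite -pN; have -> : \sum_(k < n) p (Lpair (ind (A k))) =
      p (\sum_(k < n) Lpair (ind (A k))).
    by elim/big_rec2 : _ => // k y z _ ->; rewrite pD.
  by rewrite -pD.
pose nuC : {charge set plane -> \bar R} :=
  HB.pack nu (isCharge.Build _ _ R nu nu0 nuf nus).
have nudom : nuC `<< @sleb2 R.
  apply/null_content_dominatesP => A mA A0.
  by change (nu A = 0%E); rewrite /nu Lpair_null// p0.
have fi := Radon_Nikodym_integrable nudom.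
have [iff _] := integrable_fine fi.
exists (fun xi => fine (Radon_Nikodym nuC (@sleb2 R) xi)); first exact: iff.
move=> A mA; have := Radon_Nikodym_integral nudom mA.
rewrite /= /nu => /(congr1 fine) /= ->.
rewrite /Rintegral; congr fine; rewrite [RHS]integral_mkcond.
apply: eq_integral => xi _.
rewrite /patch /= indicE; case: ifPn => xA; last by rewrite mul0r.
by rewrite mul1r fineK//; exact: Radon_Nikodym_fin_num.
Qed.

(** The density of the time integral of the transforms is the transform of the
    time integral. It agrees with the iterated integral on indicators; a weight
    m with values in [0, 1] is half of an indicator plus half of another such
    weight, so that the discrepancy d satisfies d m = d r / 2, and iteration
    gives d m = 0. *)
Lemma time_integral_transform : exists F, cintegrable mu setT F /\
  forall m M, bounded_symbol m M ->
    integralC mu setT (fun xi => m xi * F xi) =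
    integralC (leb R) D (fun s => pair m (h s)).
Proof.
have [f1 if1 e1] := density (@ReD R) (@Re_le_nc R).
have [f2 if2 e2] := density (@ImD R) (@Im_le_nc R).
pose F xi := f1 xi +i* f2 xi; exists F.
have iF : cintegrable mu setT F by split.
split => //.
have eind A : measurable A -> integralC mu setT (fun xi => ind A xi * F xi) = Lpair (ind A).
  move=> mA; apply: complexP.
    by rewrite -e1//; apply: eq_Rintegral => xi _; rewrite ReM /= mul0r subr0.
  by rewrite -e2//; apply: eq_Rintegral => xi _; rewrite ImM /= mul0r addr0.
pose d m := integralC mu setT (fun xi => m xi * F xi) - Lpair m.
have dD m M m' M' : bounded_symbol m M -> bounded_symbol m' M' ->
    d (fun xi => m xi + m' xi) = d m + d m'.
  move=> bm bm'; rewrite /d (LpairD bm bm').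
  under eq_fun do rewrite mulrDl.
  rewrite cintegralD//; [|exact: cintegrable_bs bm iF|exact: cintegrable_bs bm' iF].
  by rewrite opprD addrACA.
have dZ m M z : bounded_symbol m M -> d (fun xi => z * m xi) = z * d m.
  move=> bm; rewrite /d (LpairZ _ bm) mulrBr.
  under eq_fun do rewrite -mulrA.
  by rewrite cintegralZ//; exact: cintegrable_bs bm iF.
pose C := L1norm F + (1 * B) * lD.
have dC m : bounded_symbol m 1 -> nc (d m) <= C.
  move=> bm; rewrite (le_trans (ncB _ _))// lerD//; last exact: Lpair_bound.
  rewrite (le_trans (nc_cintegral _ (cintegrable_bs bm iF)))//.
  apply: le_Rintegral => //.
  - by apply: cintegrable_nc => //; exact: cintegrable_bs bm iF.
  - exact: cintegrable_nc.
  - by move=> xi _; rewrite ncM ler_piMl ?nc_ge0//; exact: bm.2.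
have real01 (m : plane -> R) : measurable_fun setT m -> (forall xi, 0 <= m xi <= 1) ->
    bounded_symbol (fun xi => (m xi)%:C) 1.
  move=> mm m01; split; first exact: cmeasurable_real.
  by move=> xi; have /andP[u v] := m01 xi; rewrite nc_real ger0_norm.
have digits n : forall m : plane -> R, measurable_fun setT m ->
    (forall xi, 0 <= m xi <= 1) -> nc (d (fun xi => (m xi)%:C)) <= 2^-1 ^+ n * C.
  elim: n => [|n ih] m mm m01; first by rewrite mul1r dC//; exact: real01.
  pose A := [set xi | 2^-1 <= m xi].
  have mA : measurable A.
    rewrite (_ : A = m @^-1` `[2^-1, +oo[); last first.
      by apply/seteqP; split => xi /=; rewrite /A /= in_itv/= andbT.
    by rewrite -[X in measurable X]setTI; exact: mm.
  pose r xi : R := 2 * m xi - \1_A xi.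
  have mr : measurable_fun setT r.
    by apply: measurable_funB; [exact: measurable_funM|exact: measurable_indic].
  have r01 xi : 0 <= r xi <= 1.
    rewrite /r indicE; have /andP[u v] := m01 xi.
    have [xA|xA] /= := boolP (xi \in A).
      by have := set_mem xA; rewrite /A /= => hA; apply/andP; split; lra.
    have : ~~ (2^-1 <= m xi) by apply: contra xA => hA; apply/mem_set.
    by rewrite -ltNge => hA; apply/andP; split; lra.
  have -> : (fun xi => (m xi)%:C) =
      (fun xi => (2^-1)%:C * ((r xi)%:C + ind A xi)).
    apply/funext => xi; rewrite -rmorphD -rmorphM; congr (_%:C).
    by rewrite /r subrK mulrA mulVf ?mul1r// pnatr_eq0.
  rewrite (dZ _ (1 + 1)); last first.
    by apply: bounded_symbolD; [exact: real01|exact: bounded_ind].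
  rewrite (dD _ _ _ _ (real01 _ mr r01) (bounded_ind mA)).
  have -> : d (ind A) = 0 by rewrite /d eind// subrr.
  rewrite addr0 ncM ncR ?invr_ge0// exprS -mulrA ler_wpM2l ?invr_ge0//.
  exact: ih.
have d01 (m : plane -> R) : measurable_fun setT m -> (forall xi, 0 <= m xi <= 1) ->
    d (fun xi => (m xi)%:C) = 0.
  move=> mm m01; apply: Normc.eq0_normc; apply/eqP; rewrite eq_le nc_ge0 andbT.
  have C0 : 2^-1 ^+ n * C @[n --> \oo] --> 0 * C.
    apply: cvgM; last exact: cvg_cst.
    by apply: cvg_expr; rewrite ger0_norm ?invr_ge0// invf_lt1// ltr1n.
  rewrite mul0r in C0.
  rewrite -(cvg_lim _ C0)//; apply: limr_ge; first exact: cvgP C0.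
  by apply: nearW => n; exact: digits.
have dreal (m : plane -> R) M : measurable_fun setT m -> (forall xi, `|m xi| <= M) ->
    d (fun xi => (m xi)%:C) = 0.
  move=> mm mM.
  have M0 : 0 <= M by apply: le_trans (mM (0, 0)).
  pose M' := M + 1; have M'0 : 0 < M' by rewrite ltr_wpDl.
  pose m' xi : R := (m xi + M') / (2 * M').
  have mm' : measurable_fun setT m'.
    by apply: measurable_funM => //; exact: measurable_funD.
  have m'01 xi : 0 <= m' xi <= 1.
    have := mM xi; rewrite ler_norml => /andP[u v].
    rewrite /m' divr_ge0 ?ler_pdivrMr ?mulr_gt0//=; last 2 first.
    - by rewrite /M'; lra.
    - by rewrite mulr_ge0// ltW.
    by rewrite /M'; lra.
  have -> : (fun xi => (m xi)%:C) =
      (fun xi => (2 * M')%:C * (m' xi)%:C + (- M')%:C * (1 : R)%:C).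
    apply/funext => xi; rewrite -!rmorphM -rmorphD; congr (_%:C).
    by rewrite /m' mulrC divfK ?mulf_neq0 ?gt_eqF//; ring.
  have b1 : bounded_symbol (fun xi : plane => (1 : R)%:C) 1.
    by apply: (real01 (fun=> 1)) => // xi; rewrite ler01 lexx.
  have b2 := real01 _ mm' m'01.
  rewrite (dD _ _ _ _ (bounded_symbolZ _ b2) (bounded_symbolZ _ b1)).
  rewrite (dZ _ _ _ b2) (dZ _ _ _ b1) d01// (d01 (fun=> 1)) ?mulr0 ?addr0//.
  by move=> xi; rewrite ler01 lexx.
move=> m M bm; apply/eqP; rewrite -subr_eq0; apply/eqP; rewrite -/(d m).
have [[m1 m2] mM] := bm.
have br (g : plane -> R) : measurable_fun setT g -> (forall xi, `|g xi| <= M) ->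
    bounded_symbol (fun xi => (g xi)%:C) M.
  move=> mg gM; split; first exact: cmeasurable_real.
  by move=> xi; rewrite nc_real.
have g1 xi : `|Re (m xi)| <= M by rewrite (le_trans (Re_le_nc _))// mM.
have g2 xi : `|Im (m xi)| <= M by rewrite (le_trans (Im_le_nc _))// mM.
have -> : m = (fun xi => (Re (m xi))%:C + imC R * (Im (m xi))%:C).
  apply/funext => xi; apply: complexP; rewrite ?ReD ?ImD ?ReM ?ImM /=; ring.
rewrite (dD _ _ _ _ (br _ m1 g1) (bounded_symbolZ _ (br _ m2 g2))).
by rewrite (dZ _ _ _ (br _ m2 g2)) (dreal _ M)// (dreal _ M)// mulr0 addr0.
Qed.

Lemma rep_time_integral : exists2 F,
  rep (fun x => integralC (leb R) D (fun s => h s x)) F &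
  forall m M, bounded_symbol m M ->
    integralC mu setT (fun xi => m xi * F xi) =
    integralC (leb R) D (fun s => pair m (h s)).
Proof.
have [F [iF eF]] := time_integral_transform; exists F => //; split => //.
apply/funext => x; rewrite /inv_fourier -/(c0 R).
have bx : bounded_symbol (fun xi => expi (dotp x xi)) 1.
  by split; [exact: cmeasurable_char|move=> xi; rewrite nc_expi].
rewrite (eF _ _ bx) -cintegralZ//; last exact: ipair bx.
apply: eq_cintegral => s /set_mem Ds.
by have [_ {1}->] := wiener_fourier (wh Ds).
Qed.

Lemma wiener_time_integral : wiener (fun x => integralC (leb R) D (fun s => h s x)).
Proof. by have [F rF _] := rep_time_integral; exists F. Qed.

Lemma pair_time_integral m M : bounded_symbol m M ->
  pair m (fun x => integralC (leb R) D (fun s => h s x)) =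
  integralC (leb R) D (fun s => pair m (h s)).
Proof.
move=> bm; have [F rF eF] := rep_time_integral.
by rewrite (pair_rep bm.1 rF) (eF _ _ bm).
Qed.

(** By duality: testing the transform F of the integral with the weight
    [conj F / |F|] gives the norm of the integral, and the functional commutes
    with the time integral. *)
Lemma wn_time_integral b : (forall s, D s -> wn (h s) <= b) ->
  wn (fun x => integralC (leb R) D (fun s => h s x)) <= b * fine (leb R D).
Proof.
move=> hb; have [F rF eF] := rep_time_integral; have [iF _] := rF.
have mF := cintegrable_meas iF.
pose m xi : R[i] := (nc (F xi) `^ (-1))%:C * conjc (F xi).
have bm : bounded_symbol m 1.
  split.
    apply: cmeasurableM; last exact: cmeasurable_conj.
    apply: cmeasurable_real; apply: (measurableT_comp (measurable_powR _)).
    exact: measurable_nc.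
  move=> xi; rewrite ncM nc_conj nc_real ger0_norm ?powR_ge0//.
  rewrite powR_inv1 ?nc_ge0//.
  by have [->|F0] := eqVneq (nc (F xi)) 0; [rewrite mulr0|rewrite mulVf].
have mE xi : m xi * F xi = (nc (F xi))%:C.
  rewrite /m powR_inv1 ?nc_ge0//.
  have sq : nc (F xi) ^+ 2 = Re (F xi) ^+ 2 + Im (F xi) ^+ 2.
    by case: (F xi) => u v /=; rewrite sqr_sqrtr// addr_ge0 ?sqr_ge0.
  have -> : ((nc (F xi))^-1)%:C * conjc (F xi) * F xi =
      ((nc (F xi))^-1 * (Re (F xi) ^+ 2 + Im (F xi) ^+ 2))%:C.
    by case: (F xi) => u v; apply: complexP; rewrite !(ReM, ImM) /=; ring.
  rewrite -sq; have [->|F0] := eqVneq (nc (F xi)) 0; first by rewrite expr2 !mulr0.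
  by rewrite expr2 mulrA mulVf// mul1r.
rewrite (wn_rep rF).
have -> : L1norm F = nc (integralC mu setT (fun xi => m xi * F xi)).
  have -> : integralC mu setT (fun xi => m xi * F xi) = (L1norm F)%:C.
    under eq_fun do rewrite mE.
    by apply: complexP => //=; rewrite /Rintegral integral0.
  by rewrite ncR// L1norm_ge0.
rewrite (eF _ _ bm); apply: nc_integral_le; first exact: ipair bm.
by move=> t Dt; rewrite (le_trans (nc_pair bm (wh Dt)))// mul1r hb.
Qed.

Lemma multiplier_time_integral m M : bounded_symbol m M ->
  multiplier m (fun x => integralC (leb R) D (fun s => h s x)) =
  (fun x => integralC (leb R) D (fun s => multiplier m (h s) x)).
Proof.
move=> bm; have [F rF eF] := rep_time_integral.
have [_ ->] := rep_multiplier rF bm.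
apply/funext => x; rewrite /inv_fourier -/(c0 R).
have bx : bounded_symbol (fun xi => expi (dotp x xi)) 1.
  by split; [exact: cmeasurable_char|move=> xi; rewrite nc_expi].
under eq_fun do rewrite mulrA.
have bxm := bounded_symbolM bx bm.
rewrite (eF _ _ bxm); apply: etrans (esym (cintegralZ _ mD (ipair bxm))) _.
apply: eq_cintegral => s /set_mem Ds.
have [_ ->] := rep_multiplier (wiener_fourier (wh Ds)) bm.
rewrite /inv_fourier -/(c0 R) /pair; congr (_ * integralC _ _ _).
by apply/funext => xi; rewrite mulrA.
Qed.

End TimeIntegral.

Local Notation int0 := Defs.integral0.

Section Integral0.
Variables (a : R) (h : R -> plane -> R[i]).
Hypotheses (hc : wcont a h).

Lemma integral0E (t : R) (f : R -> R[i]) : 0 <= t -> int0 t f = integralC (leb R) `[0, t] f.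
Proof. by rewrite /Defs.integral0 => ->. Qed.

Lemma leb0 (t : R) : 0 <= t -> fine (leb R `[0, t]%classic) = t.
Proof.
move=> t0; have -> : leb R `[0, t]%classic = _ := lebesgue_measure_itv `[0, t].
move: t0; rewrite le_eqVlt => /predU1P[<-|t0]; first by rewrite /= ltxx.
by rewrite /= lte_fin t0 /= subr0.
Qed.

Lemma leb_oc (u v : R) : u <= v -> fine (leb R `]u, v]%classic) = v - u.
Proof.
move=> uv; have -> : leb R `]u, v]%classic = _ := lebesgue_measure_itv `]u, v].
move: uv; rewrite le_eqVlt => /predU1P[<-|uv]; first by rewrite /= ltxx subrr.
by rewrite /= lte_fin uv.
Qed.

Let sub t : 0 <= t <= a -> 0 <= a.
Proof. by move=> /andP[t0 /(le_trans t0)]. Qed.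

Let subD (t : R) : 0 <= t <= a -> `[0, t] `<=` `[0, a].
Proof.
move=> /andP[t0 ta] s /=; rewrite !in_itv/= => /andP[-> st]; exact: le_trans ta.
Qed.

Lemma wiener_integral0 t : 0 <= t <= a -> wiener (fun x => int0 t (fun s => h s x)).
Proof.
move=> ta; have /andP[t0 _] := ta.
have := wiener_time_integral (sub ta) hc (measurable_itv _) (subD ta).
by under eq_fun do rewrite -integral0E//.
Qed.

Lemma pair_integral0 t m M : 0 <= t <= a -> bounded_symbol m M ->
  pair m (fun x => int0 t (fun s => h s x)) = int0 t (fun s => pair m (h s)).
Proof.
move=> ta bm; have /andP[t0 _] := ta.
have := pair_time_integral (sub ta) hc (measurable_itv _) (subD ta) bm.
rewrite integral0E// => <-; congr pair.
by under eq_fun do rewrite integral0E//.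
Qed.

Lemma wn_integral0 t b : 0 <= t <= a -> (forall s, 0 <= s <= t -> wn (h s) <= b) ->
  wn (fun x => int0 t (fun s => h s x)) <= b * t.
Proof.
move=> ta hb; have /andP[t0 _] := ta.
have := @wn_time_integral _ _ _ (sub ta) hc (measurable_itv _) (subD ta) b.
rewrite leb0// => h1; under eq_fun do rewrite integral0E//; apply: h1 => s /=.
by rewrite in_itv/=; exact: hb.
Qed.

Lemma multiplier_integral0 t m M : 0 <= t <= a -> bounded_symbol m M ->
  multiplier m (fun x => int0 t (fun s => h s x)) =
  (fun x => int0 t (fun s => multiplier m (h s) x)).
Proof.
move=> ta bm; have /andP[t0 _] := ta.
have := multiplier_time_integral (sub ta) hc (measurable_itv _) (subD ta) bm.
by under eq_fun do rewrite -integral0E//;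
  under [in RHS]eq_fun do rewrite -integral0E//.
Qed.

Lemma cintegrable_integral0 (f : R -> R[i]) t : 0 <= t <= a -> cseqcont a f ->
  cintegrable (leb R) `[0, t] f.
Proof.
by move=> ta cf; apply: (cseqcont_integrable (sub ta) cf) => //; exact: subD.
Qed.

Lemma nc_integral0 (f : R -> R[i]) t b : 0 <= t <= a -> cseqcont a f ->
  (forall s, 0 <= s <= t -> nc (f s) <= b) -> nc (int0 t f) <= b * t.
Proof.
move=> ta cf fb; have /andP[t0 _] := ta; rewrite integral0E//.
have := @nc_integral_le a `[0, t]%classic (sub ta) (measurable_itv _) (subD ta) f b.
rewrite leb0//; apply; first exact: cintegrable_integral0.
by move=> s /=; rewrite in_itv/=; exact: fb.
Qed.

Lemma integral0_sub (f : R -> R[i]) (u v : R) : cseqcont a f -> 0 <= u -> u <= v -> v <= a ->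
  int0 v f - int0 u f = integralC (leb R) `]u, v] f.
Proof.
move=> cf u0 uv va; have v0 := le_trans u0 uv.
have va' : 0 <= v <= a by rewrite v0.
rewrite !integral0E//; have [i1 i2] := cintegrable_integral0 va' cf.
have b1 : (BLeft (0 : R) <= BRight u)%O by rewrite bnd_simp.
have b2 : (BRight u <= BRight v)%O by rewrite bnd_simp.
apply: complexP.
  by rewrite /= -(Rintegral_itvB i1 b1 b2).
by rewrite /= -(Rintegral_itvB i2 b1 b2).
Qed.

Lemma wcont_integral0 : wcont a (fun t x => int0 t (fun s => h s x)).
Proof.
split => [t ta|t s ta sa st]; first exact: wiener_integral0.
have [B hB] := wcont_bounded (sub ta) hc.
have key (u v : R) : 0 <= u -> u <= v -> v <= a ->
    wn (fun x => int0 v (fun s => h s x) - int0 u (fun s => h s x)) <= B * (v - u).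
  move=> u0 uv va.
  have Duv : `]u, v] `<=` `[0, a].
    move=> r /=; rewrite !in_itv/= => /andP[ur rv].
    by rewrite (le_trans u0 (ltW ur)) (le_trans rv va).
  have -> : (fun x => int0 v (fun s => h s x) - int0 u (fun s => h s x)) =
      (fun x => integralC (leb R) `]u, v] (fun s => h s x)).
    by apply/funext => x; rewrite integral0_sub//; exact: wcont_eval.
  have := @wn_time_integral _ _ _ (sub ta) hc (measurable_itv _) Duv B.
  rewrite (leb_oc uv).
  apply => r /Duv /=; rewrite in_itv/=; exact: hB.
apply: (@squeeze_cvgr _ _ _ _ (cst 0) (fun n => B * `|s n - t|)).
- apply: nearW => n; rewrite wn_ge0/=; have /andP[t0 tle] := ta.
  have /andP[s0 sle] := sa n; have [st'|ts] := leP (s n) t.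
    rewrite -wnN; last by apply: wienerB; apply: wiener_integral0.
    rewrite (_ : (fun x => - _) = (fun x => int0 t (fun s => h s x) -
      int0 (s n) (fun s => h s x))); last by apply/funext => x; rewrite opprB.
    by rewrite ler0_norm ?subr_le0// opprB key.
  by rewrite gtr0_norm ?subr_gt0// key// ltW.
- exact: cvg_cst.
- by rewrite -(mulr0 B); apply: cvgM; [exact: cvg_cst|exact: cvgn_dist].
Qed.

Lemma integral0D (f g : R -> R[i]) t : 0 <= t <= a -> cseqcont a f -> cseqcont a g ->
  int0 t (fun s => f s + g s) = int0 t f + int0 t g.
Proof.
move=> ta cf cg; have /andP[t0 _] := ta; rewrite !integral0E//.
by rewrite cintegralD//; exact: cintegrable_integral0.
Qed.

Lemma integral0Z (f : R -> R[i]) t z : 0 <= t <= a -> cseqcont a f ->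
  int0 t (fun s => z * f s) = z * int0 t f.
Proof.
move=> ta cf; have /andP[t0 _] := ta; rewrite !integral0E//.
by rewrite cintegralZ//; exact: cintegrable_integral0.
Qed.

Lemma eq_integral0 (f g : R -> R[i]) t : 0 <= t ->
  (forall s, 0 <= s <= t -> f s = g s) -> int0 t f = int0 t g.
Proof.
move=> t0 fg; rewrite !integral0E//; apply: eq_cintegral => s /set_mem /=.
by rewrite in_itv/=; exact: fg.
Qed.

End Integral0.

Lemma integral0_id (t : R) (z : R[i]) : 0 < t ->
  int0 t (fun s => s%:C * z) = (t ^+ 2 / 2)%:C * z.
Proof.
move=> t0; have t0' := ltW t0; have tt : 0 <= t <= t by rewrite t0' lexx.
have cid : cseqcont t (fun s : R => s%:C).
  by split => s u _ _ us //=; exact: cvg_cst.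
under [X in int0 t X]eq_fun do rewrite mulrC.
rewrite (integral0Z z tt cid) mulrC integral0E//; congr (_ * _).
apply: complexP => /=; last by rewrite /Rintegral integral0.
pose F (x : R) : R := x ^+ 2 * 2^-1.
have dF x : is_derive x (1 : R) F x.
  apply: is_derive_eq.
  by rewrite /GRing.scale /=; field.
have cF x : F y @[y --> x] --> F x.
  by apply/differentiable_continuous/derivable1_diffP; have [] := dF x.
have := @continuous_FTC2 R id F 0 t t0.
rewrite /Rintegral => -> //=.
- by rewrite /F expr0n /= mul0r subr0.
- exact: continuous_subspaceT (fun=> cvg_id).
- split => //.
  + exact: cvg_at_right_filter (cF 0).
  + exact: cvg_at_left_filter (cF t).
- by move=> x _; rewrite derive1E; exact: derive_val.
Qed.

End Curves.

(** * Integrability of Sobolev weights *)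

Section Decay.
Variable R : realType.
Local Notation plane := (plane R).
Local Notation mu := (leb2 R).

Lemma plane_norm_ge0 (xi : plane) : 0 <= plane_norm xi.
Proof. exact: sqrtr_ge0. Qed.

Lemma plane_norm_ge1 (xi : plane) : `|xi.1| <= plane_norm xi.
Proof. by rewrite /plane_norm -sqrtr_sqr ler_sqrt ?addr_ge0 ?sqr_ge0// lerDl sqr_ge0. Qed.

Lemma plane_norm_ge2 (xi : plane) : `|xi.2| <= plane_norm xi.
Proof. by rewrite /plane_norm -sqrtr_sqr ler_sqrt ?addr_ge0 ?sqr_ge0// lerDr sqr_ge0. Qed.

Lemma plane_norm_le (xi : plane) : plane_norm xi <= `|xi.1| + `|xi.2|.
Proof.
rewrite -(ler_pXn2r (ltn0Sn 1)) ?nnegrE ?sqrtr_ge0 ?addr_ge0//.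
rewrite sqr_sqrtr ?addr_ge0 ?sqr_ge0// sqrrD !real_normK ?num_real//.
by rewrite addrAC lerDl mulrn_wge0// mulr_ge0.
Qed.

Lemma powR_decay (b : R) : 0 < b -> (1 + x) `^ (- b) @[x --> +oo] --> (0 : R).
Proof.
move=> b0; apply/cvgrPdist_lt => e e0; near=> x.
rewrite sub0r normrN ger0_norm ?powR_ge0//.
have x0 : 0 < 1 + x by rewrite ltr_pwDl.
have h : (e^-1) `^ (b^-1) < 1 + x by rewrite -ltrBlDl; near: x; exact: nbhs_pinfty_gt.
rewrite powRN invf_plt ?posrE ?powR_gt0//.
have := gt0_ltr_powR b0 _ _ h; rewrite -powRrM mulVf ?gt_eqF// powRr1 ?invr_ge0 ?ltW//.
by apply; rewrite nnegrE ?powR_ge0// ltW.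
Unshelve. all: by end_near. Qed.

Lemma integrable_decay_half (s : R) : 1 < s ->
  (leb R).-integrable `[0, +oo[ (EFin \o (fun x => (1 + x) `^ (- s))).
Proof.
move=> s1.
pose f (x : R) := (1 + x) `^ (- s).
pose F (x : R) := (1 - s)^-1 * (1 + x) `^ (1 - s).
have ms : measurable_fun setT f.
  by apply: (measurableT_comp (measurable_powR _)); exact: measurable_funD.
apply/integrableP; split; first by apply/measurable_EFinP; exact: measurable_funTS.
have dF (x : R) : 0 <= x -> is_derive x (1 : R) F (f x).
  move=> x0; have x1 : 0 < 1 + x by rewrite ltr_pwDl.
  have d1 : is_derive x (1 : R) (fun y : R => 1 + y) 1.
    have := @is_deriveD R R^o R^o (cst 1) id x 1 0 1 (is_derive_cst _ _ _) (is_derive_id _ _).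
    by rewrite add0r.
  have d2 := @is_derive1_powR R (1 - s) (1 + x) x1.
  have d3 := @is_derive1_comp R ((@powR R) ^~ (1 - s)) (fun y : R => 1 + y) x _ _ d2 d1.
  have d4 := @is_deriveZ R R^o R^o _ (1 - s)^-1 x 1 _ d3.
  apply: (@is_derive_eq _ _ _ _ _ _ _ _ d4).
  rewrite /GRing.scale /= mulr1 mulrA mulVf ?mul1r; last by rewrite lt_eqF// subr_lt0.
  by rewrite /f; congr (_ `^ _); ring.
have cF (x : R) : 0 <= x -> F y @[y --> x] --> F x.
  move=> x0; have [d _] := dF x x0.
  by apply/differentiable_continuous/derivable1_diffP.
have cf (x : R) : 0 <= x -> f y @[y --> x] --> f x.
  move=> x0; have x1 : 0 < 1 + x by rewrite ltr_pwDl.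
  have d1 : is_derive x (1 : R) (fun y : R => 1 + y) 1.
    have := @is_deriveD R R^o R^o (cst 1) id x 1 0 1 (is_derive_cst _ _ _) (is_derive_id _ _).
    by rewrite add0r.
  have d2 := @is_derive1_powR R (- s) (1 + x) x1.
  have [d _] := @is_derive1_comp R ((@powR R) ^~ (- s)) (fun y : R => 1 + y) x _ _ d2 d1.
  by apply/differentiable_continuous/derivable1_diffP.
rewrite (@eq_integral _ _ _ (leb R) _ (EFin \o f)); last first.
  by move=> x _; rewrite /= ger0_norm ?powR_ge0.
rewrite (_ : (\int[leb R]_(x in `[0%R, +oo[) (EFin \o f) x)%E = (0%:E - (F 0)%:E)%E) ?ltry//.
apply: (@ge0_continuous_FTC2y R f F 0 0).
- by move=> x _; exact: powR_ge0.
- apply/continuous_within_itvcyP; split.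
    by move=> x; rewrite in_itv/= andbT => /ltW; exact: cf.
  by apply: cvg_at_right_filter; exact: cf.
- rewrite -(mulr0 (1 - s)^-1); apply: cvgM; first exact: cvg_cst.
  by rewrite -opprB; apply: powR_decay; rewrite subr_gt0.
- by move=> x /ltW x0; have [] := dF x x0.
- by apply: cvg_at_right_filter; exact: cF.
- by move=> x; rewrite in_itv/= andbT => /ltW x0; rewrite derive1E; have [_] := dF x x0.
Qed.

Lemma integrable_decay (s : R) : 1 < s ->
  (leb R).-integrable setT (EFin \o (fun x => (1 + `|x|) `^ (- s))).
Proof.
move=> s1; have ih := integrable_decay_half s1.
pose k (x : R) : R := ((fun x => (1 + x) `^ (- s)) \_ (`[0, +oo[ : set R)) x.
have ik : (leb R).-integrable setT (EFin \o k).
  have := (integrable_mkcond (mu := leb R) (EFin \o (fun x => (1 + x) `^ (- s)))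
    (measurable_itv `[0, +oo[)).1 ih.
  by rewrite restrict_EFin.
have s1' : (-1 : R) ^+ 2 = 1 by rewrite sqrrN expr1n.
have [ik' _] := @integrable_preserving _ (measurableTypeR R) R (leb R) (affine (-1) 0)
  (measurable_affine (-1) 0) (fun A mA => leb_affine 0 s1' mA) _ ik.
have isum : (leb R).-integrable setT (EFin \o (fun x => k x + k (affine (-1) 0 x))).
  rewrite (_ : EFin \o _ = (EFin \o k) \+ (EFin \o (fun x => k (affine (-1) 0 x))))%E//.
  exact: integrableD.
apply: (integrable_le _ _ isum) => //.
  by apply: (measurableT_comp (measurable_powR _)); apply: measurable_funD => //.
move=> x _; rewrite ger0_norm ?powR_ge0// /k /patch /affine add0r mulN1r.
have p0 : (point : R) = 0 by [].
have [x0|x0] := leP 0 x.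
  have e : x \in `[0, +oo[%classic = true by apply/mem_set; rewrite /= in_itv/= x0.
  by rewrite e ger0_norm// lerDl; case: ifP => // _; rewrite ?powR_ge0 ?p0.
have e : - x \in `[0, +oo[%classic = true.
  by apply/mem_set; rewrite /= in_itv/= oppr_ge0 (ltW x0).
by rewrite e ltr0_norm// lerDr; case: ifP => // _; rewrite ?powR_ge0 ?p0.
Qed.

Lemma integrable_decay2 (s : R) : 1 < s ->
  mu.-integrable setT (EFin \o (fun xi => ((1 + plane_norm xi) `^ (- s)) ^+ 2)).
Proof.
move=> s1; pose g (x : R) := (1 + `|x|) `^ (- s).
have ig : (leb R).-integrable setT (EFin \o g) by exact: integrable_decay.
have mg : measurable_fun setT (g : measurableTypeR R -> R).
  by apply/measurable_EFinP; exact: measurable_int ig.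
have m1 : measurable_fun setT (fst : measurableTypeR R * measurableTypeR R -> measurableTypeR R).
  exact: measurable_fst.
have m2 : measurable_fun setT (snd : measurableTypeR R * measurableTypeR R -> measurableTypeR R).
  exact: measurable_snd.
have gg0 x : 0 <= g x by exact: powR_ge0.
have iprod : (@sleb R \x @sleb R)%E.-integrable setT (EFin \o (fun z => g z.1 * g z.2)).
  apply: (@integrable_prod _ _ _ _ R (@sleb R) (@sleb R) _
    (fun x => g x * \int[leb R]_y g y)).
  - apply: measurable_funM; first exact: (measurableT_comp mg m1).
    exact: (measurableT_comp mg m2).
  - by move=> z; rewrite mulr_ge0.
  - by move=> x; exact: (rintegrableZ (g x) measurableT ig).
  - by move=> x; exact: (RintegralZl (g x) measurableT ig).
  - have := rintegrableZ (\int[leb R]_y g y) measurableT ig.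
    congr (_.-integrable); apply/funext => x /=; by rewrite mulrC.
apply: (integrable_le _ _ iprod) => //.
  apply: measurable_funX; apply: (measurableT_comp (measurable_powR _)).
  by apply: measurable_funD => //; exact: measurable_plane_norm.
move=> xi _; rewrite ger0_norm ?sqr_ge0// expr2 /g !powRN.
have h0 := plane_norm_ge0 xi; have h1 := plane_norm_ge1 xi; have h2 := plane_norm_ge2 xi.
have s0 : 0 <= s by apply: ltW; apply: lt_trans s1.
have pos (r : R) : 0 <= r -> 0 < 1 + r by move=> r0; rewrite ltr_pwDl.
apply: ler_pM; rewrite ?invr_ge0 ?powR_ge0// lef_pV2 ?posrE ?powR_gt0 ?pos//;
  by apply: ge0_ler_powR; rewrite // ?nnegrE ?addr_ge0// lerD2l.
Qed.

End Decay.

(** * Sobolev functions as elements of the Wiener algebra *)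

Section SobolevPairing.
Variable R : realType.
Local Notation plane := (plane R).
Local Notation mu := (leb2 R).

Lemma nc_le_spinor_norm (v : spinor R) i : nc (v i 0) <= spinor_norm v.
Proof.
rewrite -(ler_pXn2r (ltn0Sn 1)) ?nnegrE ?sqrtr_ge0 ?nc_ge0//.
rewrite sqr_sqrtr ?addr_ge0 ?sqr_ge0//.
case: i => -[|[|//]] hi.
  by rewrite (_ : Ordinal hi = 0) ?lerDl ?sqr_ge0//; apply/val_inj.
by rewrite (_ : Ordinal hi = 1) ?lerDr ?sqr_ge0//; apply/val_inj.
Qed.

Lemma cmeasurable_hat s (f : Hs s) i : cmeasurable setT (fun xi : plane => hat f xi i 0).
Proof. exact: (hatP f).1. Qed.

(** Cauchy-Schwarz between the weighted transform of f and the inverse weight.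
    With g = 1 and s > 1 it embeds the Sobolev space in the Wiener algebra, with
    g the indicator of a bounded set it bounds a functional on it. *)
Lemma sobolev_pairing s (f : Hs s) (g : plane -> R) (G : R) i :
  measurable_fun setT g -> (forall xi, 0 <= g xi) -> 0 <= G ->
  (\int[mu]_xi (((g xi * (1 + plane_norm xi) `^ (- s)) ^+ 2)%:E) <= (G ^+ 2)%:E)%E ->
  cintegrable mu setT (fun xi => (g xi)%:C * hat f xi i 0) /\
  \int[mu]_xi nc ((g xi)%:C * hat f xi i 0) <= G * `|f|.
Proof.
move=> mg g0 G0 hG; pose p xi := g xi * (1 + plane_norm xi) `^ (- s).
have mp : measurable_fun setT p.
  apply: measurable_funM => //; apply: (measurableT_comp (measurable_powR _)).
  by apply: measurable_funD => //; exact: measurable_plane_norm.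
have mw : measurable_fun setT (weighted s (hat f)) by exact: measurable_weighted (hatP f).1.
have mF := cmeasurable_hat f i.
have mgF : cmeasurable setT (fun xi => (g xi)%:C * hat f xi i 0).
  by apply: cmeasurableM => //; exact: cmeasurable_real.
have p0 xi : 0 <= p xi by rewrite mulr_ge0// powR_ge0.
have pw xi : p xi * weighted s (hat f) xi = g xi * spinor_norm (hat f xi).
  have x0 : 1 + plane_norm xi != 0 by rewrite gt_eqF// ltr_pwDl// plane_norm_ge0.
  have e : (1 + plane_norm xi) `^ (- s) * (1 + plane_norm xi) `^ s = 1.
    by rewrite -powRD ?x0 ?implybT// addNr powRr0.
  by rewrite /p /weighted mulrA -(mulrA (g xi)) e mulr1.
have H : (\int[mu]_xi (nc ((g xi)%:C * hat f xi i 0))%:E <= (G * `|f|)%:E)%E.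
  have := hoelder (p := 2) (q := 2) mu mp mw (ltr0Sn _ _) (ltr0Sn _ _).
  have -> : (2^-1 + 2^-1 = 1 :> R) by lra.
  move=> /(_ erefl); rewrite Lnorm1 => hh.
  apply: (@le_trans _ _ (\int[mu]_xi `|(EFin \o (p \* weighted s (hat f))%R) xi|)%E).
    apply: ge0_le_integral => //=.
    - by move=> xi _; rewrite lee_fin nc_ge0.
    - by apply/measurable_EFinP; exact: measurable_nc.
    - by apply/measurable_EFinP/measurableT_comp => //; exact: measurable_funM.
    - move=> xi _; rewrite lee_fin pw ncM ncR// ger0_norm ?mulr_ge0 ?spinor_norm_ge0//.
      by rewrite ler_wpM2l// nc_le_spinor_norm.
  apply: (le_trans hh); rewrite EFinM.
  apply: lee_pmul; rewrite ?Lnorm_ge0//; last by rewrite [X in (_ <= X)%E]Hs_normE.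
  rewrite unlock.
  have -> : G%:E = ((G ^+ 2)%:E `^ 2^-1)%E.
    by rewrite poweR_EFin -powR_mulrn// -powRrM mulfV ?powRr1.
  apply: gt0_ler_poweR; rewrite ?invr_ge0 ?in_itv/= ?leey ?andbT//.
  - by apply: integral_ge0 => x _; rewrite lee_fin powR_ge0.
  - by rewrite lee_fin sqr_ge0.
  apply: le_trans hG; apply: ge0_le_integral => //=.
  - apply/measurable_EFinP/(measurableT_comp (measurable_powR _)).
    exact: measurableT_comp.
  - apply/measurable_EFinP; exact: measurable_funX.
  - by move=> x _; rewrite lee_fin powR_mulrn// ger0_norm.
have ci : mu.-integrable setT (EFin \o (fun xi => nc ((g xi)%:C * hat f xi i 0))).
  apply/integrableP; split; first by apply/measurable_EFinP; exact: measurable_nc.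
  apply: le_lt_trans (ltry (G * `|f|)).
  by under eq_integral do rewrite /= ger0_norm ?nc_ge0//.
split; first by apply: cintegrable_le ci _ => //.
by rewrite -lee_fin /Rintegral fineK//; exact: integrable_fin_num.
Qed.

Definition decay_norm (s : R) := Num.sqrt (\int[mu]_xi ((1 + plane_norm xi) `^ (- s)) ^+ 2).

Lemma hat_integrable s (f : Hs s) i : 1 < s ->
  cintegrable mu setT (fun xi => hat f xi i 0) /\
  \int[mu]_xi nc (hat f xi i 0) <= decay_norm s * `|f|.
Proof.
move=> s1; have [] := @sobolev_pairing s f (fun=> 1) (decay_norm s) i (measurable_cst _)
  (fun=> ler01) (sqrtr_ge0 _) _.
  have i0 : 0 <= \int[mu]_xi ((1 + plane_norm xi) `^ (- s)) ^+ 2.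
    by apply: Rintegral_ge0 => xi _; exact: sqr_ge0.
  rewrite sqr_sqrtr// /Rintegral fineK; last by apply: integrable_fin_num => //; exact: integrable_decay2.
  by apply: ge0_le_integral => //=;
    [move=> x _; rewrite lee_fin sqr_ge0
    |apply/measurable_EFinP/measurable_funX/measurable_funM => //; apply: (measurableT_comp (measurable_powR _));
     apply: measurable_funD => //; exact: measurable_plane_norm
    |apply/measurable_EFinP/measurable_funX; apply: (measurableT_comp (measurable_powR _));
     apply: measurable_funD => //; exact: measurable_plane_norm
    |move=> x _; rewrite mul1r].
have -> : (fun xi : plane => (1 : R)%:C * hat f xi i 0) = (fun xi => hat f xi i 0).
  by apply/funext => xi; rewrite mul1r.
by rewrite (_ : (fun xi : plane => _) = (fun xi => nc (hat f xi i 0)))//;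
  apply/funext => xi; rewrite mul1r.
Qed.

Definition component s (f : Hs s) i : plane -> R[i] := fun x => pointwise f x i 0.

Lemma rep_component s (f : Hs s) i : 1 < s -> rep (component f i) (fun xi => hat f xi i 0).
Proof.
move=> s1; split; first exact: (hat_integrable f i s1).1.
by apply/funext => x; rewrite /component /pointwise mxE.
Qed.

Lemma wn_componentB s (f g : Hs s) i : 1 < s ->
  wn (fun x => component f i x - component g i x) <= decay_norm s * `|f - g|.
Proof.
move=> s1.
have r1 : rep (fun x => component f i x - component g i x) (fun xi => hat (f - g) xi i 0).
  apply: rep_ae (repB (rep_component f i s1) (rep_component g i s1)) (cmeasurable_hat _ _) _.
  have a1 := hatD f (- g); have a2 := hatZ (-1) g.
  near=> xi.
  rewrite (near a1 xi)// !mxE (near a2 xi)// !mxE.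
  by rewrite rmorphN rmorph1 mulN1r.
by rewrite (wn_rep r1); exact: (hat_integrable _ _ s1).2.
Unshelve. all: by end_near. Qed.

Lemma curve_seq (V : normedModType R) (T : R) (f : curve T V) (t : R) (u : nat -> R) :
  t \in `[- T, T] -> (forall n, u n \in `[- T, T]) -> u @ \oo --> t ->
  `|f (u n) - f t| @[n --> \oo] --> (0 : R).
Proof.
move=> tT uT ut; have [/subspace_continuousP cf _] := set_mem (curveP f).
have : f (u n) @[n --> \oo] --> f t.
  move=> A /(cf t tT) /ut [n _ hn]; exists n => // k /hn; apply; exact: uT.
move=> h; have : f (u n) - f t @[n --> \oo] --> f t - f t by apply: cvgB => //; exact: cvg_cst.
by rewrite subrr => /cvg_norm; rewrite normr0.
Qed.

Lemma wcont_component s (T a : R) (f : curve T (Hs s)) i : 1 < s -> a <= T ->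
  wcont a (fun t => component (f t) i).
Proof.
move=> s1 aT; split; first by move=> t _; exact: rep_wiener (rep_component _ _ s1).
have sub (t : R) : 0 <= t <= a -> t \in `[- T, T].
  by move=> /andP[t0 ta]; rewrite in_itv/=; lra.
move=> t u ta ua ut.
have h := @curve_seq _ T f t u (sub t ta) (fun n => sub _ (ua n)) ut.
apply: (@cvg_dist0 R _ (fun n => decay_norm s * `|f (u n) - f t|)).
  by move=> n; rewrite subr0 ger0_norm ?wn_ge0//; exact: wn_componentB.
by rewrite -(mulr0 (decay_norm s)); apply: cvgM => //; exact: cvg_cst.
Qed.

End SobolevPairing.

(** * Symbols of the spinor propagators *)

Section Symbols.
Variable R : realType.
Local Notation plane := (plane R).
Local Notation mu := (leb2 R).

Lemma measurable_inv_plane_norm :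
  measurable_fun setT (fun xi : plane => (plane_norm xi)^-1).
Proof.
rewrite (_ : (fun xi : plane => _) = (fun xi => plane_norm xi `^ (-1))).
  by apply: (measurableT_comp (measurable_powR _)); exact: measurable_plane_norm.
by apply/funext => xi; rewrite powR_inv1// plane_norm_ge0.
Qed.

Lemma freq_ratio (xi : plane) j : `|freq xi j / plane_norm xi| <= 1.
Proof.
have h0 := plane_norm_ge0 xi.
rewrite normrM normfV (ger0_norm h0).
have hf : `|freq xi j| <= plane_norm xi.
  by rewrite /freq; case: ifP => _; [exact: plane_norm_ge1|exact: plane_norm_ge2].
have [->|x0] := eqVneq (plane_norm xi) 0; first by rewrite invr0 mulr0.
by rewrite ler_pdivrMr ?mul1r// lt_neqAle eq_sym x0.
Qed.

Lemma measurable_freq_ratio j :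
  measurable_fun setT (fun xi : plane => freq xi j / plane_norm xi).
Proof.
apply: measurable_funM; last exact: measurable_inv_plane_norm.
rewrite /freq; case: (j == 1); first exact: measurable_fst.
exact: measurable_snd.
Qed.

Lemma nc_alpha (l : 'I_3) (i k : 'I_2) : nc (@alpha R l i k) <= 1.
Proof.
have n1 : nc (1 : R[i]) = 1 by have := @nc_real R 1; rewrite normr1.
have n0 : nc (0 : R[i]) <= 1 by rewrite nc0.
rewrite /alpha; case: ifP => _.
  by rewrite mxE; case: (i == k); rewrite ?mulr1n ?mulr0n ?n1.
case: ifP => _; first by rewrite mxE; case: (i != k); rewrite ?n1.
rewrite mxE; case: ifP => _ //; case: ifP => _; rewrite ?ncN;
by have -> : nc (imC R) = 1 by exact: nc_i.
Qed.

Definition Pi_symbol (b : bool) (i k : 'I_2) (xi : plane) : R[i] :=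
  (2^-1%:C *: (1%:M + (sg R b)%:C *:
    \sum_(j < 3 | j != 0) (freq xi j / plane_norm xi)%:C *: alpha R j)) i k.

Lemma Pi_symbolE b i k xi : Pi_symbol b i k xi =
  2^-1%:C * ((i == k)%:R + (sg R b)%:C *
    \sum_(j < 3 | j != 0) (freq xi j / plane_norm xi)%:C * alpha R j i k).
Proof.
rewrite /Pi_symbol !mxE summxE; congr (_ * (_ + _ * _)).
by apply: eq_bigr => j _; rewrite mxE.
Qed.

Lemma sum_Pi_symbol i k xi : \sum_(b : bool) Pi_symbol b i k xi = (i == k)%:R.
Proof.
rewrite big_bool /= !Pi_symbolE -mulrDr addrACA -mulrDl /sg.
have -> : 1%:C + (-1)%:C = 0 :> R[i] by rewrite -rmorphD subrr.
rewrite mul0r addr0; move: ((i == k)%:R : R[i]) => z.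
rewrite -mulr2n -[z *+ 2]mulr_natl mulrA -(rmorph_nat (real_complex R)) -rmorphM /=.
by rewrite mulVf ?mul1r.
Qed.

Lemma bounded_Pi_symbol b i k : bounded_symbol (Pi_symbol b i k) 2.
Proof.
split.
  rewrite (_ : Pi_symbol b i k = (fun xi => 2^-1%:C * ((i == k)%:R + (sg R b)%:C *
    \sum_(j < 3 | j != 0) (freq xi j / plane_norm xi)%:C * alpha R j i k))); last first.
    by apply/funext => xi; rewrite Pi_symbolE.
  apply: cmeasurableM; first exact: cmeasurable_cst.
  apply: cmeasurableD; first exact: cmeasurable_cst.
  apply: cmeasurableM; first exact: cmeasurable_cst.
  apply: cmeasurable_sum => j; apply: cmeasurableM; last exact: cmeasurable_cst.
  by apply: cmeasurable_real; exact: measurable_freq_ratio.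
move=> xi; rewrite Pi_symbolE ncM ncR ?invr_ge0// ler_pdivrMl//.
apply: le_trans (ncD _ _) _.
have h1 : nc ((i == k)%:R : R[i]) <= 1.
  case: (i == k); last by rewrite nc0.
  by have := @nc_real R 1; rewrite normr1 => ->.
have h2 : nc (\sum_(j < 3 | j != 0) (freq xi j / plane_norm xi)%:C * alpha R j i k) <= 3.
  apply: le_trans (nc_sum _ _ _) _.
  apply: (@le_trans _ _ (\sum_(j < 3 | j != 0) 1)).
    apply: ler_sum => j _; rewrite ncM nc_real -[leRHS](mulr1 1).
    by apply: ler_pM; rewrite ?nc_ge0 ?freq_ratio ?nc_alpha.
  rewrite sumr_const; apply: (@le_trans _ _ (1 *+ #|'I_3|)); last by rewrite card_ord.
  by rewrite ler_nat max_card.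
have h3 : nc ((sg R b)%:C * \sum_(j < 3 | j != 0) (freq xi j / plane_norm xi)%:C * alpha R j i k) <= 3.
  rewrite ncM nc_real (_ : `|sg R b| = 1) ?mul1r//.
  by case: b; rewrite /sg ?normrN normr1.
lra.
Qed.

Lemma nc_U_symbol b t (xi : plane) : nc (U_symbol b t xi) = 1.
Proof. exact: nc_expi. Qed.

Lemma bounded_U_symbol b t : bounded_symbol (@U_symbol R b t) 1.
Proof.
split; last by move=> xi; rewrite nc_U_symbol.
apply: cmeasurable_expi; apply: measurable_funM => //; exact: measurable_plane_norm.
Qed.

Lemma U_symbolD b s t (xi : plane) : U_symbol b (s + t) xi = U_symbol b s xi * U_symbol b t xi.
Proof. by rewrite /U_symbol -expiD; congr expi; ring. Qed.

Lemma U_symbol_sub1 b t (xi : plane) : 0 <= t -> nc (U_symbol b t xi - 1) <= 2 * t * plane_norm xi.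
Proof.
move=> t0; apply: le_trans (expi_sub1 _) _.
rewrite !normrM (ger0_norm (plane_norm_ge0 _)) (ger0_norm t0) -!mulrA.
by rewrite (_ : `|- sg R b| = 1) ?mul1r// normrN; case: b; rewrite /sg ?normrN normr1.
Qed.

Lemma U_symbol_cvg b (u : nat -> R) t (xi : plane) : u @ \oo --> t ->
  nc (U_symbol b (u n) xi - U_symbol b t xi) @[n --> \oo] --> (0 : R).
Proof.
move=> ut; apply: (@cvg_dist0 R _ (fun n => 2 * plane_norm xi * `|u n - t|)).
  move=> n; rewrite subr0 ger0_norm ?nc_ge0//.
  have -> : U_symbol b (u n) xi - U_symbol b t xi =
    U_symbol b t xi * (U_symbol b (u n - t) xi - 1).
    by rewrite mulrBr mulr1 -U_symbolD (addrC t) subrK.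
  rewrite ncM nc_U_symbol mul1r; apply: le_trans (expi_sub1 _) _.
  rewrite !normrM (ger0_norm (plane_norm_ge0 _)) -!mulrA (mulrC (plane_norm xi)).
  by rewrite (_ : `|- sg R b| = 1) ?mul1r// normrN; case: b; rewrite /sg ?normrN normr1.
rewrite -(mulr0 (2 * plane_norm xi)); apply: cvgM; first exact: cvg_cst.
exact: cvgn_dist.
Qed.

Definition propagator (b : bool) (t : R) (i k : 'I_2) (xi : plane) : R[i] :=
  U_symbol b t xi * Pi_symbol b i k xi.

Lemma bounded_propagator b t i k : bounded_symbol (propagator b t i k) 2.
Proof.
have := bounded_symbolM (bounded_U_symbol b t) (bounded_Pi_symbol b i k).
by rewrite mul1r.
Qed.

(** The two propagators add up to the identity at time 0, as the projections do,
    and frequencies that are small compared with 1/t barely move in time t. *)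
Lemma sum_propagator_sub t i k (xi : plane) : 0 <= t ->
  nc (\sum_(b : bool) propagator b t i k xi - (i == k)%:R) <= 8 * t * plane_norm xi.
Proof.
move=> t0; rewrite -(sum_Pi_symbol i k xi) !big_bool.
have e (p q p' q' : R[i]) : p * p' + q * q' - (p' + q') = (p - 1) * p' + (q - 1) * q'.
  by ring.
rewrite /propagator e; apply: le_trans (ncD _ _) _.
have h b : nc ((U_symbol b t xi - 1) * Pi_symbol b i k xi) <= 2 * t * plane_norm xi * 2.
  rewrite ncM; apply: ler_pM; rewrite ?nc_ge0 ?U_symbol_sub1//.
  exact: (bounded_Pi_symbol b i k).2.
apply: (le_trans (lerD (h true) (h false))); rewrite le_eqVlt; apply/orP; left; apply/eqP; ring.
Qed.

Lemma Us_Pi b t (v : plane -> spinor R) x i :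
  (forall k, wiener (fun y => v y k 0)) ->
  Us b t (Pi b v) x i 0 = \sum_k multiplier (propagator b t i k) (fun y => v y k 0) x.
Proof.
move=> wv; rewrite /Us /multiplier_mx mxE.
have eP j : (fun y => Pi b v y j 0) =
    (fun y => \sum_k multiplier (Pi_symbol b j k) (fun z => v z k 0) y).
  by apply/funext => y; rewrite /Pi /multiplier_mx mxE.
have wP j : wiener (fun y => Pi b v y j 0).
  by rewrite eP; apply: wiener_sum => k; exact: wiener_multiplier (wv k) (bounded_Pi_symbol b j k).
rewrite (bigD1 i)//= [X in _ + X]big1 ?addr0 => [|j ji].
  have -> : (fun xi => (U_symbol b t xi)%:M i i) = U_symbol b t.
    by apply/funext => xi; rewrite mxE eqxx mulr1n.
  rewrite eP (multiplier_sum _ _ (bounded_U_symbol b t)); last first.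
    by move=> k; exact: wiener_multiplier (wv k) (bounded_Pi_symbol b i k).
  apply: eq_bigr => k _.
  by rewrite (multiplier_comp (bounded_U_symbol b t) (bounded_Pi_symbol b i k)).
have -> : (fun xi => (U_symbol b t xi)%:M i j) = (fun=> 0).
  by apply/funext => xi; rewrite mxE eq_sym (negbTE ji) mulr0n.
by rewrite multiplier_cst// mul0r.
Qed.

End Symbols.

(** * Duhamel integrals and the terms of the nonlinearity *)

Section Duhamel.
Variable R : realType.
Local Notation plane := (plane R).
Local Notation mu := (leb2 R).
Local Notation int0 := Defs.integral0.
Implicit Types (h : R -> plane -> R[i]).

Definition duhamel (b : bool) h (t : R) (x : plane) : R[i] :=
  int0 t (fun s => multiplier (U_symbol b (t - s)) (h s) x).

Variables (a : R) (b : bool).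

Lemma wcont_U_symbol (c : R) h : wcont a h ->
  wcont a (fun s => multiplier (U_symbol b (c * s)) (h s)).
Proof.
move=> hc; apply: (@wcont_symbol R a h (fun s => U_symbol b (c * s)) 1) => //.
  by move=> t _; exact: bounded_U_symbol.
move=> t s xi _ _ st; apply: (@U_symbol_cvg R b (fun n => c * s n) (c * t)).
by apply: cvgM => //; exact: cvg_cst.
Qed.

Lemma wcont_U_symbolN h : wcont a h -> wcont a (fun s => multiplier (U_symbol b (- s)) (h s)).
Proof. by move=> /(wcont_U_symbol (-1)); apply: eq_wcont => t _; rewrite mulN1r. Qed.

(** The group property takes the final time out of the integral, which is then
    the time integral of one continuous curve; this yields the continuity of
    the Duhamel integral in t. *)
Lemma duhamelE h t : wcont a h -> 0 <= t <= a -> duhamel b h t =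
  multiplier (U_symbol b t) (fun x => int0 t (fun s => multiplier (U_symbol b (- s)) (h s) x)).
Proof.
move=> hc ta; have hN := wcont_U_symbolN hc.
rewrite (multiplier_integral0 hN ta (bounded_U_symbol b t)).
have t0 : 0 <= t by case/andP: ta.
apply/funext => x; apply: eq_integral0 => // s /andP[s0 st].
have wh : wiener (h s) by apply: hc.1; rewrite s0 (le_trans st)//; case/andP: ta.
rewrite (multiplier_comp (bounded_U_symbol b t) (bounded_U_symbol b (- s)))//.
have -> // : U_symbol b (t - s) = (fun xi => U_symbol b t xi * U_symbol b (- s) xi) :> (plane -> R[i]).
by apply/funext => xi; rewrite -U_symbolD.
Qed.

Lemma wcont_duhamel h : wcont a h -> wcont a (duhamel b h).
Proof.
move=> hc.
have h1 := wcont_integral0 (wcont_U_symbolN hc).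
have := wcont_U_symbol 1 h1; apply: eq_wcont => t ta.
by rewrite mul1r duhamelE.
Qed.

Lemma wcont_integrand h t : wcont a h -> 0 <= t <= a ->
  wcont t (fun s => multiplier (U_symbol b (t - s)) (h s)).
Proof.
move=> hc /andP[t0 ta]; have hct := wcont_sub ta hc.
apply: (@wcont_symbol R t h (fun s => U_symbol b (t - s)) 1) => //.
  by move=> s _; exact: bounded_U_symbol.
move=> r s xi _ _ sr; apply: (@U_symbol_cvg R b (fun n => t - s n) (t - r)).
by apply: cvgB => //; exact: cvg_cst.
Qed.

Let tself t : 0 <= t <= a -> 0 <= t <= t.
Proof. by case/andP=> -> _; rewrite lexx. Qed.

Lemma wn_duhamel h t B : wcont a h -> 0 <= t <= a ->
  (forall s, 0 <= s <= t -> wn (h s) <= B) -> wn (duhamel b h t) <= B * t.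
Proof.
move=> hc ta hB; apply: (wn_integral0 (wcont_integrand hc ta) (tself ta)) => s st.
have wh : wiener (h s).
  by apply: hc.1; case/andP: st => -> /le_trans; apply; case/andP: ta.
apply: le_trans (wn_multiplier wh (bounded_U_symbol b (t - s))) _.
by rewrite mul1r; exact: hB.
Qed.

Lemma pair_duhamel h t m M : wcont a h -> 0 <= t <= a -> bounded_symbol m M ->
  pair m (duhamel b h t) = int0 t (fun s => pair m (multiplier (U_symbol b (t - s)) (h s))).
Proof. by move=> hc ta mM; exact: (pair_integral0 (wcont_integrand hc ta) (tself ta) mM). Qed.

Lemma duhamel_cseqcont h t x : wcont a h -> 0 <= t <= a ->
  cseqcont t (fun s => multiplier (U_symbol b (t - s)) (h s) x).
Proof. by move=> hc ta; exact: (wcont_eval x (wcont_integrand hc ta)). Qed.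

Lemma duhamelD h h' t : wcont a h -> wcont a h' -> 0 <= t <= a ->
  duhamel b (fun s x => h s x + h' s x) t = (fun x => duhamel b h t x + duhamel b h' t x).
Proof.
move=> hc hc' ta; have t0 : 0 <= t by case/andP: ta.
have tt : 0 <= t <= t by rewrite t0 lexx.
apply/funext => x.
rewrite /duhamel -(integral0D tt (duhamel_cseqcont x hc ta) (duhamel_cseqcont x hc' ta)).
apply: eq_integral0 => // s /andP[s0 st].
have sa : 0 <= s <= a by rewrite s0 (le_trans st)//; case/andP: ta.
by rewrite (multiplierD (bounded_U_symbol b (t - s)) (hc.1 s sa) (hc'.1 s sa)).
Qed.

Lemma duhamelZ h z t : wcont a h -> 0 <= t <= a ->
  duhamel b (fun s x => z * h s x) t = (fun x => z * duhamel b h t x).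
Proof.
move=> hc ta; have t0 : 0 <= t by case/andP: ta.
have tt : 0 <= t <= t by rewrite t0 lexx.
apply/funext => x.
rewrite /duhamel -(integral0Z z tt (duhamel_cseqcont x hc ta)).
apply: eq_integral0 => // s /andP[s0 st].
have sa : 0 <= s <= a by rewrite s0 (le_trans st)//; case/andP: ta.
by rewrite (multiplierZ z (bounded_U_symbol b (t - s)) (hc.1 s sa)).
Qed.

Lemma eq_duhamel h h' t : 0 <= t -> (forall s, 0 <= s <= t -> h s = h' s) ->
  duhamel b h t = duhamel b h' t.
Proof.
move=> t0 hh; apply/funext => x; apply: eq_integral0 => // s st; by rewrite hh.
Qed.

End Duhamel.

Section Potentials.
Variable R : realType.
Local Notation plane := (plane R).
Local Notation mu := (leb2 R).
Implicit Types (v : 'I_2 -> plane -> R[i]).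

Definition cur l v (x : plane) : R[i] :=
  \sum_i \sum_j conjc (v i x) * (alpha R l i j * v j x).

Definition eps_cur (m nu : 'I_3) v (x : plane) : R[i] :=
  \sum_l epsilon R m nu l * cur l v x.

Lemma currentE l (psi : plane -> spinor R) x :
  current l psi x = cur l (fun i y => psi y i 0) x.
Proof.
rewrite /current /cur mxE exchange_big /=; apply: eq_bigr => j _.
by rewrite mxE mulr_suml; apply: eq_bigr => i _; rewrite !mxE mulrA.
Qed.

Lemma epsilonE (m nu l : 'I_3) : epsilon R m nu l =
  ((nu%:R - m%:R) * (l%:R - m%:R) * (l%:R - nu%:R) / 2)%:C.
Proof.
rewrite /epsilon !rmorphM !rmorphB /= fmorphV /=.
by rewrite -!(rmorph_nat (real_complex R)).
Qed.

Lemma nc_epsilon m nu l : nc (epsilon R m nu l) <= 1.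
Proof.
rewrite epsilonE nc_real ler_norml.
case: m => -[|[|[|//]]] ?; case: nu => -[|[|[|//]]] ?; case: l => -[|[|[|//]]] ? /=;
  by apply/andP; split; lra.
Qed.

Section CurrentBounds.
Variables (v : 'I_2 -> plane -> R[i]) (y : R).
Hypotheses (wv : forall i, wiener (v i)) (vy : forall i, wn (v i) <= y).

Lemma wiener_cur l : wiener (cur l v).
Proof.
apply: wiener_sum => i; apply: wiener_sum => j.
by apply: wienerM; [exact: wiener_conj|exact: wienerZ].
Qed.

Lemma wiener_eps_cur m nu : wiener (eps_cur m nu v).
Proof. by apply: wiener_sum => l; apply: wienerZ; exact: wiener_cur. Qed.

Lemma wn_cur l : wn (cur l v) <= 4 * (c0 R * y ^+ 2).
Proof.
have h i j : wn (fun x => conjc (v i x) * (alpha R l i j * v j x)) <= c0 R * y ^+ 2.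
  apply: le_trans (wnM (wiener_conj (wv i)) (wienerZ _ (wv j))) _.
  rewrite ler_wpM2l ?c0_ge0// expr2 wn_conj// wnZ//.
  apply: ler_pM; rewrite ?wn_ge0 ?mulr_ge0 ?nc_ge0 ?wn_ge0//.
  by rewrite -[leRHS]mul1r; apply: ler_pM; rewrite ?nc_ge0 ?wn_ge0 ?nc_alpha.
have w i j : wiener (fun x => conjc (v i x) * (alpha R l i j * v j x)).
  by apply: wienerM; [exact: wiener_conj|exact: wienerZ].
apply: le_trans (wn_sum _ _ (fun i => wiener_sum _ _ (w i))) _.
apply: (@le_trans _ _ (\sum_(i < 2) \sum_(j < 2) c0 R * y ^+ 2)).
  apply: ler_sum => i _; apply: le_trans (wn_sum _ _ (w i)) _.
  by apply: ler_sum => j _.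
rewrite !big_ord_recl !big_ord0; lra.
Qed.

Lemma wn_eps_cur m nu : wn (eps_cur m nu v) <= 12 * (c0 R * y ^+ 2).
Proof.
have w l : wiener (fun x => epsilon R m nu l * cur l v x) by apply: wienerZ; exact: wiener_cur.
apply: le_trans (wn_sum _ _ w) _.
apply: (@le_trans _ _ (\sum_(l < 3) 4 * (c0 R * y ^+ 2))).
  apply: ler_sum => l _; rewrite wnZ; last exact: wiener_cur.
  rewrite -[leRHS]mul1r; apply: ler_pM; rewrite ?nc_ge0 ?wn_ge0 ?nc_epsilon//.
  exact: wn_cur.
rewrite !big_ord_recl !big_ord0; lra.
Qed.

End CurrentBounds.

Lemma wcont_cur a (u : R -> 'I_2 -> plane -> R[i]) l : 0 <= a ->
  (forall i, wcont a (u ^~ i)) -> wcont a (fun t => cur l (u t)).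
Proof.
move=> a0 uc; apply: wcont_sum => i; apply: wcont_sum => j.
by apply: wcontM => //; [exact: wcont_conj|exact: wcontZ].
Qed.

Lemma wcont_eps_cur a (u : R -> 'I_2 -> plane -> R[i]) m nu : 0 <= a ->
  (forall i, wcont a (u ^~ i)) -> wcont a (fun t => eps_cur m nu (u t)).
Proof. by move=> a0 uc; apply: wcont_sum => l; apply: wcontZ; exact: wcont_cur. Qed.

Definition interaction (V : 'I_3 -> plane -> R[i]) v (i : 'I_2) (x : plane) : R[i] :=
  \sum_nu \sum_k alpha R nu i k * (V nu x * v k x).

Lemma potential_mulE V (psi : plane -> spinor R) x i :
  potential_mul V psi x i 0 = interaction V (fun k y => psi y k 0) i x.
Proof.
rewrite /potential_mul summxE; apply: eq_bigr => nu _; rewrite mxE.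
by apply: eq_bigr => k _; rewrite mxE.
Qed.

Lemma wcont_interaction a (V : 'I_3 -> R -> plane -> R[i]) (u : R -> 'I_2 -> plane -> R[i]) i :
  0 <= a -> (forall nu, wcont a (V nu)) -> (forall k, wcont a (u ^~ k)) ->
  wcont a (fun t => interaction (V ^~ t) (u t) i).
Proof.
move=> a0 Vc uc; apply: wcont_sum => nu; apply: wcont_sum => k; apply: wcontZ.
exact: wcontM.
Qed.

Lemma wn_interaction (V : 'I_3 -> plane -> R[i]) v i (B y : R) :
  (forall nu, wiener (V nu)) -> (forall k, wiener (v k)) ->
  (forall nu, wn (V nu) <= B) -> (forall k, wn (v k) <= y) ->
  wn (interaction V v i) <= 6 * (c0 R * (B * y)).
Proof.
move=> wV wv hB hy.
have w nu k : wiener (fun x => alpha R nu i k * (V nu x * v k x)).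
  by apply: wienerZ; exact: wienerM.
apply: le_trans (wn_sum _ _ (fun nu => wiener_sum _ _ (w nu))) _.
apply: (@le_trans _ _ (\sum_(nu < 3) \sum_(k < 2) c0 R * (B * y))).
  apply: ler_sum => nu _; apply: le_trans (wn_sum _ _ (w nu)) _.
  apply: ler_sum => k _; rewrite wnZ; last exact: wienerM.
  rewrite -[leRHS]mul1r; apply: ler_pM; rewrite ?nc_ge0 ?wn_ge0 ?nc_alpha//.
  apply: le_trans (wnM (wV nu) (wv k)) _; rewrite ler_wpM2l ?c0_ge0//.
  by apply: ler_pM; rewrite ?wn_ge0.
rewrite !big_ord_recl !big_ord0; lra.
Qed.

End Potentials.

(** * The integral equation in components *)

Section ComponentEquation.
Variable R : realType.
Local Notation plane := (plane R).
Local Notation mu := (leb2 R).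
Local Notation int0 := Defs.integral0.

(** The symbol of the inverse of D is not bounded near 0. It is only applied to
    functions without frequencies below N, and there this truncation, which is
    bounded, has the same effect. *)
Definition inv_symbol (N : R) (xi : plane) : R[i] :=
  (if N <= plane_norm xi then (plane_norm xi)^-1 else 0)%:C.

Lemma bounded_inv_symbol N : 0 < N -> bounded_symbol (inv_symbol N) N^-1.
Proof.
move=> N0; split.
  apply: cmeasurable_real; apply: measurable_fun_ifT => //.
    apply: (measurable_fun_ler (f := fun=> N)) => //; exact: measurable_plane_norm.
  exact: measurable_inv_plane_norm.
move=> xi; rewrite /inv_symbol nc_real; case: ifP => h; last by rewrite normr0 invr_ge0 ltW.
have x0 : 0 < plane_norm xi by exact: lt_le_trans h.
by rewrite ger0_norm ?invr_ge0 ?(ltW x0)// lef_pV2.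
Qed.

Lemma Dinv_away N h : 0 < N -> wiener h ->
  {ae mu, forall xi, plane_norm xi < N -> fourier h xi = 0} ->
  Dinv h = multiplier (inv_symbol N) h.
Proof.
move=> N0 wh supp; apply/funext => x; rewrite /Dinv /multiplier /inv_fourier.
have mF := cintegrable_meas (wiener_fourier wh).1.
congr (_ * _); apply: ae_eq_cintegral.
- apply: cmeasurableM; first exact: cmeasurable_char.
  apply: cmeasurableM => //; apply: cmeasurable_real; exact: measurable_inv_plane_norm.
- apply: cmeasurableM; first exact: cmeasurable_char.
  by apply: cmeasurableM => //; exact: (bounded_inv_symbol N0).1.
- apply: filterS supp => xi; rewrite /inv_symbol.
  by case: leP => // _ /(_ isT) ->; rewrite !mulr0.
Qed.

Definition riesz_symbol (b : bool) (m : 'I_3) (xi : plane) : R[i] :=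
  if m == 0 then -1 else (- sg R b * freq xi m / plane_norm xi)%:C.

Lemma bounded_riesz_symbol b m : bounded_symbol (riesz_symbol b m) 1.
Proof.
rewrite /riesz_symbol; case: (m == 0).
  split; first exact: cmeasurable_cst.
  by move=> _; rewrite ncN (@nc_real R 1) normr1.
split.
  apply: cmeasurable_real; rewrite (_ : (fun x : plane => _) =
    (fun x => - sg R b * (freq x m / plane_norm x))); last by apply/funext => x; rewrite mulrA.
  by apply: measurable_funM => //; exact: measurable_freq_ratio.
move=> xi; rewrite nc_real -mulrA normrM.
have -> : `|- sg R b| = 1 by rewrite normrN; case: b; rewrite /sg ?normrN normr1.
by rewrite mul1r freq_ratio.
Qed.

(** The bracket whose Duhamel integral is the potential [A_nonlin]. *)
Definition source (b : bool) (nu : 'I_3) (v : 'I_2 -> plane -> R[i]) (y : plane) : R[i] :=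
  \sum_m multiplier (riesz_symbol b m) (eps_cur m nu v) y.

Lemma A_nonlinE b (psi : R -> plane -> spinor R) nu t :
  A_nonlin b psi nu t = duhamel b (fun t' => source b nu (fun i y => psi t' y i 0)) t.
Proof.
have e t' : (fun y => \sum_(m < 3) Riesz b m
    (fun z => \sum_(l < 3) epsilon R m nu l * current l (psi t') z) y) =
    source b nu (fun i y => psi t' y i 0).
  apply/funext => y; apply: eq_bigr => m _.
  have -> // : (fun z => \sum_(l < 3) epsilon R m nu l * current l (psi t') z) =
    eps_cur m nu (fun i y => psi t' y i 0).
  by apply/funext => z; apply: eq_bigr => l _; rewrite currentE.
apply/funext => x.
exact: (congr1 (int0 t) (funext (fun t' => congr1 (fun g => U b (t - t') g x) (e t')))).
Qed.

Lemma A_dataE b (psi0 : plane -> spinor R) nu t : A_data b psi0 nu t =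
  multiplier (U_symbol b t) (fun y => (sg R b)%:C * Dinv (eps_cur 0 nu (fun i y => psi0 y i 0)) y).
Proof.
have e : (fun z => \sum_(l < 3) epsilon R 0 nu l * current l psi0 z) =
    eps_cur 0 nu (fun i y => psi0 y i 0).
  by apply/funext => z; apply: eq_bigr => l _; rewrite currentE.
exact: (congr1 (fun g => U b t (fun y => (sg R b)%:C * Dinv g y)) e).
Qed.

Lemma spinor_entry (v : spinor R) (F : bool -> spinor R) (G H : bool -> bool -> spinor R) i
    (l p : bool -> R[i]) (g h : bool -> bool -> R[i]) :
  v = \sum_(b : bool) F b - 2^-1%:C *: \sum_(b1 : bool) \sum_(b2 : bool) G b1 b2 +
      imC R *: \sum_(b1 : bool) \sum_(b2 : bool) H b1 b2 ->
  (forall b, F b i 0 = l b) -> (forall b b2, G b b2 i 0 = g b b2) ->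
  (forall b b2, H b b2 i 0 = h b b2) ->
  (forall b, p b = (- 2^-1)%:C * (g b true + g b false) + imC R * (h b true + h b false)) ->
  v i 0 = \sum_(b : bool) l b + \sum_(b : bool) p b.
Proof.
move=> -> Fl Gg Hh hp; rewrite !big_bool !hp !mxE !Fl !Gg !Hh rmorphN /=; ring.
Qed.

Section Solution.
Variables (T s N : R) (f0 : Hs s) (f : curve T (Hs s)).
Local Notation phi := (component f0).
Local Notation u := (fun t => component (f t)).
Hypotheses (s1 : 1 < s) (T0 : 0 <= T) (N0 : 0 < N).
Hypothesis far : forall nu,
  {ae mu, forall xi, plane_norm xi < N -> fourier (eps_cur 0 nu phi) xi = 0}.
Hypothesis eqn : integral_equation T (pointwise f0) (fun t => pointwise (f t)).

Let wphi i : wiener (phi i). Proof. exact: rep_wiener (rep_component _ _ s1). Qed.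

Let uc i : wcont T (fun t => u t i). Proof. exact: wcont_component. Qed.

Definition data_potential b nu t :=
  multiplier (U_symbol b t) (fun y => (sg R b)%:C * multiplier (inv_symbol N) (eps_cur 0 nu phi) y).

Definition nonlin_potential b nu t := duhamel b (fun t' => source b nu (u t')) t.

Lemma wcont_source b nu : wcont T (fun t => source b nu (u t)).
Proof.
apply: wcont_sum => m; apply: (wcont_multiplier _ (bounded_riesz_symbol b m)).
by apply: wcont_eps_cur.
Qed.

Lemma wcont_data_potential b nu : wcont T (data_potential b nu).
Proof.
have := @wcont_U_symbol R T b 1 (fun=> (fun y => (sg R b)%:C * multiplier (inv_symbol N) (eps_cur 0 nu phi) y)).
move=> /(_ (wcont_cst _ (wienerZ _ (wiener_multiplier (wiener_eps_cur wphi 0 nu) (bounded_inv_symbol N0))))).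
by apply: eq_wcont => t _; rewrite mul1r.
Qed.

Lemma wcont_nonlin_potential b nu : wcont T (nonlin_potential b nu).
Proof. by apply: wcont_duhamel; exact: wcont_source. Qed.

(** The two nonlinear terms of the equation have the same form, with potentials
    that carry the factors -1/2 and i. Merging them leaves one Duhamel term that
    is linear in the potential, and the two contributions to the potential can
    be compared with each other before they act on the spinor. *)
Definition potential nu t (x : plane) : R[i] :=
  (- 2^-1)%:C * (data_potential true nu t x + data_potential false nu t x) +
  imC R * (nonlin_potential true nu t x + nonlin_potential false nu t x).

Lemma wcont_potential nu : wcont T (potential nu).
Proof.
apply: wcontD; apply: wcontZ; apply: wcontD;
  [exact: wcont_data_potential|exact: wcont_data_potential
  |exact: wcont_nonlin_potential|exact: wcont_nonlin_potential].
Qed.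

Definition forcing (V : 'I_3 -> R -> plane -> R[i]) b i t (x : plane) : R[i] :=
  \sum_k multiplier (Pi_symbol b i k) (interaction (V ^~ t) (u t) k) x.

Lemma wcont_forcing V b i : (forall nu, wcont T (V nu)) -> wcont T (forcing V b i).
Proof.
move=> Vc; apply: wcont_sum => k.
apply: (wcont_multiplier _ (bounded_Pi_symbol R b i k)); exact: wcont_interaction.
Qed.

Lemma wiener_interaction V t i : (forall nu, wcont T (V nu)) -> 0 <= t <= T ->
  wiener (interaction (V ^~ t) (u t) i).
Proof. by move=> Vc; apply: (wcont_interaction i T0 Vc uc).1. Qed.

Lemma forcingD V V' b i t : (forall nu, wcont T (V nu)) -> (forall nu, wcont T (V' nu)) ->
  0 <= t <= T ->
  forcing (fun nu t x => V nu t x + V' nu t x) b i t =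
  (fun x => forcing V b i t x + forcing V' b i t x).
Proof.
move=> Vc Vc' tT; apply/funext => x; rewrite /forcing -big_split /=; apply: eq_bigr => k _.
have -> : interaction (fun nu x => V nu t x + V' nu t x) (u t) k =
    (fun x => interaction (V ^~ t) (u t) k x + interaction (V' ^~ t) (u t) k x).
  apply/funext => y; rewrite /interaction -big_split /=; apply: eq_bigr => nu _.
  by rewrite -big_split /=; apply: eq_bigr => j _; rewrite mulrDl mulrDr.
by rewrite (multiplierD (bounded_Pi_symbol R b i k)) //; exact: wiener_interaction.
Qed.

Lemma forcingZ V z b i t : (forall nu, wcont T (V nu)) -> 0 <= t <= T ->
  forcing (fun nu t x => z * V nu t x) b i t = (fun x => z * forcing V b i t x).
Proof.
move=> Vc tT; apply/funext => x; rewrite /forcing mulr_sumr; apply: eq_bigr => k _.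
have -> : interaction (fun nu x => z * V nu t x) (u t) k =
    (fun x => z * interaction (V ^~ t) (u t) k x).
  apply/funext => y; rewrite /interaction mulr_sumr; apply: eq_bigr => nu _.
  by rewrite mulr_sumr; apply: eq_bigr => j _; rewrite -mulrA !(mulrCA z).
by rewrite (multiplierZ z (bounded_Pi_symbol R b i k)) //; exact: wiener_interaction.
Qed.

Let sub (t t' : R) : 0 <= t <= T -> 0 <= t' <= t -> 0 <= t' <= T.
Proof. by move=> /andP[_ tT] /andP[-> /le_trans]; apply. Qed.

Lemma duhamel_forcingD V V' b i t : (forall nu, wcont T (V nu)) ->
  (forall nu, wcont T (V' nu)) -> 0 <= t <= T ->
  duhamel b (forcing (fun nu t x => V nu t x + V' nu t x) b i) t =
  (fun x => duhamel b (forcing V b i) t x + duhamel b (forcing V' b i) t x).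
Proof.
move=> Vc Vc' tT; have t0 : 0 <= t by case/andP: tT.
apply: etrans (duhamelD b (wcont_forcing b i Vc) (wcont_forcing b i Vc') tT).
exact: (eq_duhamel b t0 (fun t' tt' => forcingD b i Vc Vc' (sub tT tt'))).
Qed.

Lemma duhamel_forcingZ V z b i t : (forall nu, wcont T (V nu)) -> 0 <= t <= T ->
  duhamel b (forcing (fun nu t x => z * V nu t x) b i) t =
  (fun x => z * duhamel b (forcing V b i) t x).
Proof.
move=> Vc tT; have t0 : 0 <= t by case/andP: tT.
apply: etrans (duhamelZ b z (wcont_forcing b i Vc) tT).
exact: (eq_duhamel b t0 (fun t' tt' => forcingZ z b i Vc (sub tT tt'))).
Qed.

Lemma duhamel_combination V1 V2 W1 W2 c z b i t x :
  (forall nu, wcont T (V1 nu)) -> (forall nu, wcont T (V2 nu)) ->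
  (forall nu, wcont T (W1 nu)) -> (forall nu, wcont T (W2 nu)) -> 0 <= t <= T ->
  duhamel b (forcing (fun nu t x =>
    c * (V1 nu t x + V2 nu t x) + z * (W1 nu t x + W2 nu t x)) b i) t x =
  c * (duhamel b (forcing V1 b i) t x + duhamel b (forcing V2 b i) t x) +
  z * (duhamel b (forcing W1 b i) t x + duhamel b (forcing W2 b i) t x).
Proof.
move=> c1 c2 c3 c4 tT.
have d1 nu := wcontD (c1 nu) (c2 nu); have d2 nu := wcontD (c3 nu) (c4 nu).
have ev (g g' : plane -> R[i]) : g = g' -> g x = g' x by move=> ->.
apply: (etrans (ev _ _ (duhamel_forcingD b i (fun nu => wcontZ c (d1 nu)) (fun nu => wcontZ z (d2 nu)) tT))).
apply: (congr2 (fun p q => p + q)).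
- apply: (etrans (ev _ _ (duhamel_forcingZ c b i d1 tT))); apply: (congr1 (fun p => c * p)).
  exact: (ev _ _ (duhamel_forcingD b i c1 c2 tT)).
- apply: (etrans (ev _ _ (duhamel_forcingZ z b i d2 tT))); apply: (congr1 (fun p => z * p)).
  exact: (ev _ _ (duhamel_forcingD b i c3 c4 tT)).
Qed.

Lemma duhamel_forcing V b i t x : (forall nu, wcont T (V nu)) -> 0 <= t <= T ->
  integral0s t (fun t' => Us b (t - t') (Pi b
    (potential_mul (fun nu => V nu t') (pointwise (f t')))) x) i 0 =
  duhamel b (forcing V b i) t x.
Proof.
move=> Vc /andP[t0 tT]; rewrite /integral0s mxE /duhamel; apply: eq_integral0 => // t' /andP[t0' tt'].
have tT' : 0 <= t' <= T by rewrite t0' (le_trans tt').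
have e k : (fun y => potential_mul (fun nu => V nu t') (pointwise (f t')) y k 0) =
    interaction (V ^~ t') (u t') k.
  by apply/funext => y; rewrite potential_mulE.
rewrite Us_Pi; last by move=> k; rewrite e; exact: wiener_interaction.
rewrite /forcing (multiplier_sum _ _ (bounded_U_symbol b (t - t'))); last first.
  by move=> k; apply: (wiener_multiplier _ (bounded_Pi_symbol R b i k)); exact: wiener_interaction.
apply: eq_bigr => k _; rewrite e.
by rewrite (multiplier_comp (bounded_U_symbol b (t - t')) (bounded_Pi_symbol R b i k))//;
  exact: wiener_interaction.
Qed.

(** In the Wiener algebra every product, multiplier and time integral of the
    integral equation is defined and linear, which justifies rearranging it
    into scalar equations. *)
Lemma component_equation t i : 0 <= t <= T -> u t i =
  (fun x => \sum_(b : bool) \sum_k multiplier (propagator b t i k) (phi k) x +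
            \sum_(b : bool) duhamel b (forcing potential b i) t x).
Proof.
move=> tT; have t0 : 0 <= t by case/andP: tT.
have tI : t \in `[- T, T] by case/andP: tT => ? ?; rewrite in_itv/=; lra.
apply/funext => x.
have eD b nu t' : A_data b (pointwise f0) nu t' = data_potential b nu t'.
  rewrite A_dataE /data_potential (@Dinv_away N) //; exact: wiener_eps_cur.
have eA b nu t' : A_nonlin b (fun t => pointwise (f t)) nu t' = nonlin_potential b nu t'.
  by rewrite A_nonlinE.
have e1 b b2 : integral0s t (fun t' => Us b (t - t') (Pi b (potential_mul
    (fun nu => A_data b2 (pointwise f0) nu t') (pointwise (f t')))) x) i 0 =
    duhamel b (forcing (data_potential b2) b i) t x.
  have e : (fun t' nu => A_data b2 (pointwise f0) nu t') = (fun t' nu => data_potential b2 nu t').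
    by apply/funext => t'; apply/funext => nu; exact: eD.
  apply: etrans (duhamel_forcing b i x (fun nu => wcont_data_potential b2 nu) tT).
  exact: (congr1 (fun V => integral0s t (fun t' =>
    Us b (t - t') (Pi b (potential_mul (V t') (pointwise (f t')))) x) i 0) e).
have e2 b b2 : integral0s t (fun t' => Us b (t - t') (Pi b (potential_mul
    (fun nu => A_nonlin b2 (fun t => pointwise (f t)) nu t') (pointwise (f t')))) x) i 0 =
    duhamel b (forcing (nonlin_potential b2) b i) t x.
  have e : (fun t' nu => A_nonlin b2 (fun t => pointwise (f t)) nu t') = (fun t' nu => nonlin_potential b2 nu t').
    by apply/funext => t'; apply/funext => nu; exact: eA.
  apply: etrans (duhamel_forcing b i x (fun nu => wcont_nonlin_potential b2 nu) tT).
  exact: (congr1 (fun V => integral0s t (fun t' =>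
    Us b (t - t') (Pi b (potential_mul (V t') (pointwise (f t')))) x) i 0) e).
have Dc b2 nu := wcont_data_potential b2 nu.
have Ac b2 nu := wcont_nonlin_potential b2 nu.
have eP b : duhamel b (forcing potential b i) t x =
    (- 2^-1)%:C * (duhamel b (forcing (data_potential true) b i) t x +
                   duhamel b (forcing (data_potential false) b i) t x) +
    imC R * (duhamel b (forcing (nonlin_potential true) b i) t x +
             duhamel b (forcing (nonlin_potential false) b i) t x).
  exact: duhamel_combination.
have eL b : Us b t (Pi b (pointwise f0)) x i 0 = \sum_k multiplier (propagator b t i k) (phi k) x.
  by rewrite Us_Pi.
exact: (spinor_entry (eqn tI x) eL e1 e2 eP).
Qed.

End Solution.
End ComponentEquation.

(** * Bootstrap, supports and difference estimates *)

Section Bootstrap.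
Variable R : realType.

(** Consider the largest interval [0, tau] on which y stays below M: there it
    even stays below [M'], and by continuity it cannot reach M right after. *)
Lemma bootstrap (a M' M : R) (y : R -> R) : 0 <= a -> M' < M -> seqcont a y -> y 0 <= M' ->
  (forall t, 0 <= t <= a -> (forall s, 0 <= s <= t -> y s <= M) -> y t <= M') ->
  forall t, 0 <= t <= a -> y t <= M'.
Proof.
move=> a0 MM yc y0 H.
have cont (t e : R) : 0 <= t <= a -> 0 < e ->
    exists2 r : R, 0 < r & forall x, 0 <= x <= a -> `|t - x| < r -> `|y t - y x| < e.
  move=> ta e0; have hc : {for t, continuous (y \o clamp a)} by exact: seqcont_clamp.
  move/cvgrPdist_lt: hc => /(_ e e0) /nbhs_ballP[r r0 hr]; exists r => // x xa tx.
  by have := hr x tx; rewrite /= !clamp_id.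
pose A := [set t : R | 0 <= t <= a /\ forall s, 0 <= s <= t -> y s <= M].
have A0 : A 0.
  split; first by rewrite lexx a0.
  by move=> s s0; have -> : s = 0 by [lra]; rewrite (le_trans y0)// ltW.
have supA : has_sup A by split; [exists 0|exists a => x [/andP[]]].
pose tau := sup A.
have tau0 : 0 <= tau by apply: ub_le_sup => //; case: supA.
have taua : tau <= a by apply: ge_sup; [exists 0|move=> x [/andP[]]].
have below s : 0 <= s < tau -> y s <= M.
  move=> /andP[s0 st]; have e0 : 0 < tau - s by rewrite subr_gt0.
  have [x [_ hx] xt] := sup_adherent e0 supA.
  by apply: hx; rewrite s0/=; apply: ltW; move: xt; rewrite -/tau; lra.
have tauI : 0 <= tau <= a by rewrite tau0.
have yt : y tau <= M.
  rewrite leNgt; apply/negP => h.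
  have [r r0 hr] := cont tau (y tau - M) tauI ltac:(lra).
  have [t0|t0] := eqVneq tau 0; first by move: h; rewrite t0; lra.
  have tp : 0 < tau by rewrite lt_neqAle eq_sym t0.
  pose x := Num.max 0 (tau - r / 2).
  have x0 : 0 <= x by rewrite /x le_max lexx.
  have x1 : x < tau by rewrite /x gt_max tp/=; lra.
  have x2 : tau - r / 2 <= x by rewrite /x le_max lexx orbT.
  have xa : 0 <= x <= a by rewrite x0; lra.
  have d : `|tau - x| < r by rewrite ger0_norm; lra.
  have := hr x xa d; have := below x; rewrite x0 x1 => /(_ isT) yx.
  rewrite ger0_norm; lra.
have Atau s : 0 <= s <= tau -> y s <= M.
  move=> /andP[s0]; rewrite le_eqVlt => /orP[/eqP -> //|st]; apply: below; exact/andP.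
have ytau := H tau tauI Atau.
have ta : tau = a.
  apply/eqP; rewrite eq_le taua leNgt; apply/negP => h.
  have [r r0 hr] := cont tau (M - M') tauI ltac:(lra).
  pose x := Num.min a (tau + r / 2).
  have x1 : tau < x by rewrite /x lt_min h/=; lra.
  have x2 : x <= tau + r / 2 by rewrite /x ge_min lexx orbT.
  have x3 : x <= a by rewrite /x ge_min lexx.
  have : A x.
    split; first by lra.
    move=> s /andP[s0 sx]; have [st|st] := leP s tau; first by apply: Atau; rewrite s0.
    have sa : 0 <= s <= a by rewrite s0; lra.
    have d : `|tau - s| < r by rewrite ltr0_norm; lra.
    have := hr s sa d; rewrite ltr_norml; lra.
  by move=> /(ub_le_sup (proj2 supA)); rewrite -/tau leNgt x1.
move=> t /andP[t0 tle]; apply: H; first by rewrite t0.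
by move=> s /andP[s0 st]; apply: Atau; rewrite s0 ta (le_trans st).
Qed.

End Bootstrap.

Section Support.
Variable R : realType.
Local Notation plane := (plane R).
Local Notation mu := (leb2 R).

(** On a known set of frequencies an unbounded symbol such as the modulus of xi
    can be estimated, and Taylor expansions of the propagators have small
    remainders. *)
Definition supported (A : plane -> Prop) (h : plane -> R[i]) :=
  {ae mu, forall xi, ~ A xi -> fourier h xi = 0}.

Lemma supported_rep A h F : rep h F -> (forall xi, ~ A xi -> F xi = 0) -> supported A h.
Proof. by move=> rF F0; apply: filterS (rep_fourier rF) => xi -> /F0. Qed.

Lemma wn_le_rep A M h F g : rep h F -> wiener g -> supported A g ->
  (forall xi, (~ A xi -> fourier g xi = 0) -> nc (F xi) <= M * nc (fourier g xi)) ->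
  wn h <= M * wn g.
Proof.
move=> rF wg supp hM; rewrite (wn_rep rF) /wn.
have i1 := cintegrable_nc measurableT (wiener_fourier wg).1.
have -> : M * L1norm (fourier g) = \int[mu]_xi (M * nc (fourier g xi)).
  by rewrite /L1norm (RintegralZl M measurableT i1).
apply: ae_le_Rintegral.
- exact: cintegrable_nc measurableT rF.1.
- exact: rintegrableZ.
- by move=> x; exact: nc_ge0.
- by apply: filterS supp => xi; exact: hM.
Qed.

End Support.

Section Differences.
Variable R : realType.
Local Notation plane := (plane R).
Local Notation mu := (leb2 R).
Local Notation c := (c0 R).

Lemma wn_mulB (h g h' g' : plane -> R[i]) A B D D' :
  wiener h -> wiener g -> wiener h' -> wiener g' ->
  wn g <= B -> wn h' <= A ->
  wn (fun x => h x - h' x) <= D -> wn (fun x => g x - g' x) <= D' ->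
  wn (fun x => h x * g x - h' x * g' x) <= c * (D * B + A * D').
Proof.
move=> wh wg wh' wg' gB hA hD gD.
have -> : (fun x => h x * g x - h' x * g' x) =
    (fun x => (h x - h' x) * g x + h' x * (g x - g' x)).
  by apply/funext => x; ring.
apply: le_trans (wnD (wienerM (wienerB wh wh') wg) (wienerM wh' (wienerB wg wg'))) _.
rewrite mulrDr; apply: lerD.
  apply: le_trans (wnM (wienerB wh wh') wg) _; rewrite ler_wpM2l ?c0_ge0//.
  by apply: ler_pM; rewrite ?wn_ge0.
apply: le_trans (wnM wh' (wienerB wg wg')) _; rewrite ler_wpM2l ?c0_ge0//.
by apply: ler_pM; rewrite ?wn_ge0.
Qed.

Lemma wn_scale_le (z : R[i]) (h : plane -> R[i]) B : wiener h -> nc z <= 1 -> wn h <= B ->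
  wn (fun x => z * h x) <= B.
Proof.
move=> wh z1 hB; rewrite wnZ// -[leRHS]mul1r.
by apply: ler_pM; rewrite ?nc_ge0 ?wn_ge0.
Qed.

Variables (v v' : 'I_2 -> plane -> R[i]) (Y D : R).
Hypotheses (wv : forall i, wiener (v i)) (wv' : forall i, wiener (v' i)).
Hypotheses (vY : forall i, wn (v i) <= Y) (vY' : forall i, wn (v' i) <= Y).
Hypothesis vD : forall i, wn (fun x => v i x - v' i x) <= D.

Lemma wn_curB l : wn (fun x => cur l v x - cur l v' x) <= 8 * (c * (Y * D)).
Proof.
have w i j : wiener (fun x => conjc (v i x) * (alpha R l i j * v j x) -
    conjc (v' i x) * (alpha R l i j * v' j x)).
  by apply: wienerB; apply: wienerM; (exact: wiener_conj || exact: wienerZ).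
have h i j : wn (fun x => conjc (v i x) * (alpha R l i j * v j x) -
    conjc (v' i x) * (alpha R l i j * v' j x)) <= c * (D * Y + Y * D).
  apply: wn_mulB; rewrite ?wn_conj//; try exact: wiener_conj; try exact: wienerZ.
  - by apply: wn_scale_le; rewrite ?nc_alpha.
  - have -> : (fun x => conjc (v i x) - conjc (v' i x)) = (fun x => conjc (v i x - v' i x)).
      by apply/funext => x; rewrite rmorphB.
    by rewrite wn_conj//; exact: wienerB.
  - have -> : (fun x => alpha R l i j * v j x - alpha R l i j * v' j x) =
        (fun x => alpha R l i j * (v j x - v' j x)).
      by apply/funext => x; rewrite mulrBr.
    by apply: wn_scale_le; rewrite ?nc_alpha//; exact: wienerB.
have -> : (fun x => cur l v x - cur l v' x) = (fun x => \sum_i \sum_j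
    (conjc (v i x) * (alpha R l i j * v j x) - conjc (v' i x) * (alpha R l i j * v' j x))).
  apply/funext => x; rewrite /cur -sumrB; apply: eq_bigr => i _.
  by rewrite -sumrB.
apply: le_trans (wn_sum _ _ (fun i => wiener_sum _ _ (w i))) _.
apply: (@le_trans _ _ (\sum_(i < 2) \sum_(j < 2) c * (D * Y + Y * D))).
  by apply: ler_sum => i _; apply: le_trans (wn_sum _ _ (w i)) _; apply: ler_sum => j _.
rewrite !big_ord_recl !big_ord0 le_eqVlt; apply/orP; left; apply/eqP; ring.
Qed.

Lemma wn_eps_curB m nu : wn (fun x => eps_cur m nu v x - eps_cur m nu v' x) <=
  24 * (c * (Y * D)).
Proof.
have wB l : wiener (fun x => cur l v x - cur l v' x) by apply: wienerB; exact: wiener_cur.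
have -> : (fun x => eps_cur m nu v x - eps_cur m nu v' x) =
    (fun x => \sum_l epsilon R m nu l * (cur l v x - cur l v' x)).
  by apply/funext => x; rewrite /eps_cur -sumrB; apply: eq_bigr => l _; rewrite mulrBr.
apply: le_trans (wn_sum _ _ (fun l => wienerZ _ (wB l))) _.
apply: (@le_trans _ _ (\sum_(l < 3) 8 * (c * (Y * D)))).
  by apply: ler_sum => l _; apply: wn_scale_le; rewrite ?nc_epsilon ?wn_curB.
rewrite !big_ord_recl !big_ord0 le_eqVlt; apply/orP; left; apply/eqP; ring.
Qed.

Lemma wiener_source b nu : wiener (source b nu v).
Proof.
apply: wiener_sum => m.
exact: (wiener_multiplier (wiener_eps_cur wv m nu) (bounded_riesz_symbol R b m)).
Qed.

Lemma wn_source b nu : wn (source b nu v) <= 36 * (c * Y ^+ 2).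
Proof.
have w m : wiener (multiplier (riesz_symbol b m) (eps_cur m nu v)).
  exact: (wiener_multiplier (wiener_eps_cur wv m nu) (bounded_riesz_symbol R b m)).
apply: le_trans (wn_sum _ _ w) _.
apply: (@le_trans _ _ (\sum_(m < 3) 12 * (c * Y ^+ 2))).
  apply: ler_sum => m _.
  apply: le_trans (wn_multiplier (wiener_eps_cur wv m nu) (bounded_riesz_symbol R b m)) _.
  by rewrite mul1r; exact: wn_eps_cur.
rewrite !big_ord_recl !big_ord0 le_eqVlt; apply/orP; left; apply/eqP; ring.
Qed.

Lemma wn_sourceB b nu : wn (fun x => source b nu v x - source b nu v' x) <= 72 * (c * (Y * D)).
Proof.
have wB m : wiener (fun x => eps_cur m nu v x - eps_cur m nu v' x).
  by apply: wienerB; exact: wiener_eps_cur.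
have -> : (fun x => source b nu v x - source b nu v' x) = (fun x => \sum_m
    multiplier (riesz_symbol b m) (fun x => eps_cur m nu v x - eps_cur m nu v' x) x).
  apply/funext => x; rewrite /source -sumrB; apply: eq_bigr => m _.
  have wN : wiener (fun x => - eps_cur m nu v' x) by apply: wienerN; exact: wiener_eps_cur.
  rewrite (multiplierD (bounded_riesz_symbol R b m) (wiener_eps_cur wv m nu) wN).
  have e : (fun x => - eps_cur m nu v' x) = (fun x => -1 * eps_cur m nu v' x).
    by apply/funext => y; rewrite mulN1r.
  by rewrite e (multiplierZ (-1) (bounded_riesz_symbol R b m) (wiener_eps_cur wv' m nu)) mulN1r.
apply: le_trans (wn_sum _ _ (fun m => wiener_multiplier (wB m) (bounded_riesz_symbol R b m))) _.
apply: (@le_trans _ _ (\sum_(m < 3) 24 * (c * (Y * D)))).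
  apply: ler_sum => m _.
  apply: le_trans (wn_multiplier (wB m) (bounded_riesz_symbol R b m)) _.
  by rewrite mul1r; exact: wn_eps_curB.
rewrite !big_ord_recl !big_ord0 le_eqVlt; apply/orP; left; apply/eqP; ring.
Qed.

Lemma wn_interactionB (V V' : 'I_3 -> plane -> R[i]) i (B E : R) :
  (forall nu, wiener (V nu)) -> (forall nu, wiener (V' nu)) ->
  (forall nu, wn (V' nu) <= B) -> (forall nu, wn (fun x => V nu x - V' nu x) <= E) ->
  wn (fun x => interaction V v i x - interaction V' v' i x) <= 6 * (c * (E * Y + B * D)).
Proof.
move=> wV wV' hB hE.
have w nu k : wiener (fun x => alpha R nu i k * (V nu x * v k x - V' nu x * v' k x)).
  by apply: wienerZ; apply: wienerB; exact: wienerM.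
have -> : (fun x => interaction V v i x - interaction V' v' i x) = (fun x => \sum_nu \sum_k
    alpha R nu i k * (V nu x * v k x - V' nu x * v' k x)).
  apply/funext => x; rewrite /interaction -sumrB; apply: eq_bigr => nu _.
  by rewrite -sumrB; apply: eq_bigr => k _; rewrite mulrBr.
apply: le_trans (wn_sum _ _ (fun nu => wiener_sum _ _ (w nu))) _.
apply: (@le_trans _ _ (\sum_(nu < 3) \sum_(k < 2) c * (E * Y + B * D))).
  apply: ler_sum => nu _; apply: le_trans (wn_sum _ _ (w nu)) _.
  apply: ler_sum => k _; apply: wn_scale_le; rewrite ?nc_alpha//.
    by apply: wienerB; exact: wienerM.
  exact: wn_mulB.
rewrite !big_ord_recl !big_ord0 le_eqVlt; apply/orP; left; apply/eqP; ring.
Qed.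

End Differences.

(** * The cubic term of the solution *)

Section ShortTime.
Variable R : realType.
Local Notation plane := (plane R).
Local Notation mu := (leb2 R).
Local Notation int0 := Defs.integral0.
Local Notation c := (c0 R).

Lemma integral0_cst (t : R) (z : R[i]) : 0 <= t -> int0 t (fun=> z) = t%:C * z.
Proof.
move=> t0; rewrite integral0E//; apply: complexP => /=.
  by rewrite Rintegral_cst//= leb0// mulrC; case: z => ? ? /=; rewrite mul0r subr0.
by rewrite Rintegral_cst//= leb0// mulrC; case: z => ? ? /=; rewrite mul0r addr0.
Qed.

Lemma U_symbol_diff t (xi : plane) :
  (- 2^-1)%:C * (U_symbol true t xi - U_symbol false t xi) =
  imC R * (sin (t * plane_norm xi))%:C.
Proof.
rewrite /U_symbol /sg opprK !mul1r !mulN1r !mulNr /expi cosN sinN.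
by apply: complexP => /=; field.
Qed.

Lemma nc_ratio (p q : R) : nc (imC R * p%:C - imC R * q%:C) = `|p - q|.
Proof. by rewrite -mulrBr ncM nc_i mul1r -rmorphB nc_real. Qed.

(** Two waves travelling in opposite directions cancel to leading order in the
    symbols of the Riesz operators with index 1 and 2, and add up to -2 for
    index 0. *)
Lemma riesz_sum m t (xi : plane) : 0 <= t ->
  nc (U_symbol true t xi * riesz_symbol true m xi + U_symbol false t xi * riesz_symbol false m xi +
      (if m == 0 then 2 else 0)%:C) <= 4 * t * plane_norm xi.
Proof.
move=> t0; have h b := U_symbol_sub1 b xi t0.
have ht := h true; have hf := h false.
rewrite /riesz_symbol; case: (m == 0).
  have -> : U_symbol true t xi * -1 + U_symbol false t xi * -1 + 2%:C =
      - ((U_symbol true t xi - 1) + (U_symbol false t xi - 1)).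
    by rewrite (rmorph_nat (real_complex R)); ring.
  rewrite ncN; apply: le_trans (ncD _ _) _; lra.
set q : R := freq xi m / plane_norm xi.
have -> : U_symbol true t xi * (- sg R true * freq xi m / plane_norm xi)%:C +
    U_symbol false t xi * (- sg R false * freq xi m / plane_norm xi)%:C + (0 : R)%:C =
    - q%:C * ((U_symbol true t xi - 1) - (U_symbol false t xi - 1)).
  rewrite -!mulrA -/q /sg opprK mulN1r mul1r rmorphN /=; ring.
rewrite ncM ncN nc_real.
have hq : `|q| <= 1 by exact: freq_ratio.
have hd := ncB (U_symbol true t xi - 1) (U_symbol false t xi - 1).
apply: (@le_trans _ _ (1 * nc (U_symbol true t xi - 1 - (U_symbol false t xi - 1)))).
  by rewrite ler_wpM2r ?nc_ge0.
lra.
Qed.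

Lemma pair_symbolB (m : plane -> R[i]) M m' M' h (z : R[i]) : bounded_symbol m M -> bounded_symbol m' M' ->
  wiener h -> pair (fun xi => m xi - z * m' xi) h = pair m h - z * pair m' h.
Proof.
move=> mM mM' /wiener_fourier[iF _]; rewrite /pair.
have i1 := cintegrable_bs mM iF; have i2 := cintegrable_bs mM' iF.
rewrite -(cintegralZ z measurableT i2).
rewrite -(cintegralB measurableT i1 (cintegrableZ z measurableT i2)).
by congr (integralC _ _ _); apply/funext => xi; rewrite mulrBl mulrA.
Qed.

Lemma pair_symbolD (m : plane -> R[i]) M m' M' h : bounded_symbol m M -> bounded_symbol m' M' ->
  wiener h -> pair (fun xi => m xi + m' xi) h = pair m h + pair m' h.
Proof.
move=> mM mM' /wiener_fourier[iF _]; rewrite /pair.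
have i1 := cintegrable_bs mM iF; have i2 := cintegrable_bs mM' iF.
rewrite -(cintegralD measurableT i1 i2).
by congr (integralC _ _ _); apply/funext => xi; rewrite mulrDl.
Qed.

Let o1 : 'I_3 := @Ordinal 3 1 isT.
Let o2 : 'I_3 := @Ordinal 3 2 isT.

Let sum3 (F : 'I_3 -> R[i]) : \sum_l F l = F 0 + F o1 + F o2.
Proof.
rewrite !big_ord_recl big_ord0 addr0 addrA.
by congr (F _ + F _ + F _); apply/val_inj.
Qed.

Let sum2 (F : 'I_2 -> R[i]) : \sum_l F l = F 0 + F 1.
Proof.
rewrite !big_ord_recl big_ord0 addr0.
by congr (F _ + F _); apply/val_inj.
Qed.

Lemma wn_duhamel0 b (h : R -> plane -> R[i]) r : 0 <= r -> wcont r h -> wn (duhamel b h 0) <= 0.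
Proof.
move=> r0 hc; have z : 0 <= (0 : R) <= r by rewrite lexx.
apply: (@le_trans _ _ (wn (h 0) * 0)); last by rewrite mulr0.
apply: (wn_duhamel b hc z) => v /andP[v0 v1].
by have -> : v = 0 by apply/eqP; rewrite eq_le v0 v1.
Qed.

Lemma cseqcontD r (f g : R -> R[i]) : cseqcont r f -> cseqcont r g ->
  cseqcont r (fun t => f t + g t).
Proof.
move=> [f1 f2] [g1 g2]; split => t v tr vr vt.
  rewrite [X in _ --> X]ReD (_ : (fun n => _) = (fun n => complex.Re (f (v n)) + complex.Re (g (v n)))).
    by apply: cvgD; [exact: f1|exact: g1].
  by apply/funext => n; rewrite ReD.
rewrite [X in _ --> X]ImD (_ : (fun n => _) = (fun n => complex.Im (f (v n)) + complex.Im (g (v n)))).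
  by apply: cvgD; [exact: f2|exact: g2].
by apply/funext => n; rewrite ImD.
Qed.

Lemma cseqcont_linear r (z : R[i]) : cseqcont r (fun t : R => t%:C * z).
Proof.
split => t v _ _ vt.
  rewrite [X in _ --> X]ReM (_ : (fun n => _) = (fun n => v n * complex.Re z)).
    by rewrite /= mul0r subr0; apply: cvgM => //; exact: cvg_cst.
  by apply/funext => n; rewrite ReM /= mul0r subr0.
rewrite [X in _ --> X]ImM (_ : (fun n => _) = (fun n => v n * complex.Im z)).
  by rewrite /= mul0r addr0; apply: cvgM => //; exact: cvg_cst.
by apply/funext => n; rewrite ImM /= mul0r addr0.
Qed.

Lemma pair_U_Pi m b t i (g : 'I_2 -> plane -> R[i]) : bounded_symbol m 1 ->
  (forall k, wiener (g k)) ->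
  pair m (multiplier (U_symbol b t) (fun x => \sum_k multiplier (Pi_symbol b i k) (g k) x)) =
  \sum_k pair m (multiplier (propagator b t i k) (g k)).
Proof.
move=> m1 wg.
have wP k := wiener_multiplier (wg k) (bounded_Pi_symbol R b i k).
rewrite (multiplier_sum _ _ (bounded_U_symbol b t) wP).
rewrite (pair_sum _ _ m1 (fun k => wiener_multiplier (wP k) (bounded_U_symbol b t))).
apply: eq_bigr => k _.
by rewrite (multiplier_comp (bounded_U_symbol b t) (bounded_Pi_symbol R b i k) (wg k)).
Qed.

(** Over times t with t N at most e, frequencies of size at most 3 N move by
    O(e) only. The functional restricts the frequencies, whatever the
    support of g. *)
Lemma pair_propagators m N e k t (g : plane -> R[i]) : bounded_symbol m 1 ->
  (forall xi, m xi != 0 -> plane_norm xi <= 3 * N) -> wiener g -> 0 <= e ->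
  0 <= t -> t * N <= e ->
  nc (\sum_(b : bool) pair m (multiplier (propagator b t 0 k) g) - (0 == k)%:R * pair m g) <=
  24 * e * wn g.
Proof.
move=> m1 m3 wg e0 t0 tN.
have bE b := bounded_symbolM m1 (bounded_propagator b t 0 k).
have eE b : pair m (multiplier (propagator b t 0 k) g) = pair (fun xi => m xi * propagator b t 0 k xi) g.
  exact: (pair_multiplier m1 (bounded_propagator b t 0 k) wg).
set z : R[i] := (0 == k)%:R.
have eq : \sum_(b : bool) pair m (multiplier (propagator b t 0 k) g) - z * pair m g =
    pair (fun xi => m xi * propagator true t 0 k xi + m xi * propagator false t 0 k xi - z * m xi) g.
  apply: etrans (esym (pair_symbolB z (bounded_symbolD (bE true) (bE false)) m1 wg)).
  congr (_ - _); apply: etrans (esym (pair_symbolD (bE true) (bE false) wg)).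
  by rewrite big_bool; exact: (congr2 (fun p q => p + q) (eE true) (eE false)).
rewrite eq.
apply: (nc_pair (M := 24 * e) _ wg); split.
  have := bounded_symbolD (bounded_symbolD (bE true) (bE false)) (bounded_symbolZ (- z) m1).
  by case=> + _; congr (cmeasurable _ _); apply/funext => xi; rewrite mulNr.
have alg (p q r w : R[i]) : p * q + p * r - w * p = p * (q + r - w) by ring.
move=> xi; rewrite (alg (m xi) (propagator true t 0 k xi) (propagator false t 0 k xi) z).
have [->|mx] := eqVneq (m xi) 0; first by rewrite mul0r nc0 mulr_ge0.
have sE := sum_propagator_sub 0 k xi t0; rewrite big_bool in sE.
rewrite ncM; apply: (@le_trans _ _ (1 * (8 * t * plane_norm xi))).
  by apply: ler_pM; rewrite ?nc_ge0 ?m1.2//; exact: sE.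
have h : t * plane_norm xi <= t * (3 * N) by rewrite ler_wpM2l// m3.
lra.
Qed.

Variables (T sigma N : R) (f0 : Hs sigma) (f : curve T (Hs sigma)) (L e a : R).
Local Notation phi := (component f0).
Local Notation u := (fun t => component (f t)).
Local Notation V := (potential N f0 f).
Local Notation K := (fun nu => eps_cur 0 nu phi).
Hypotheses (s1 : 1 < sigma) (T0 : 0 <= T) (N0 : 0 < N).
Hypothesis far : forall nu,
  {ae mu, forall xi, plane_norm xi < N -> fourier (eps_cur 0 nu phi) xi = 0}.
Hypothesis eqn : integral_equation T (pointwise f0) (fun t => pointwise (f t)).
Hypotheses (L0 : 0 < L) (phiL : forall i, wn (phi i) <= L).
Hypothesis supp3 : forall i, supported (fun xi => plane_norm xi <= 3 * N) (phi i).
Hypothesis supp6 : forall m nu,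
  supported (fun xi => plane_norm xi <= 6 * N) (eps_cur m nu phi).
Hypotheses (a0 : 0 <= a) (aT : a <= T) (e0 : 0 <= e) (e1 : e <= 1) (aN : a * N <= e).
(* Up to a constant [(c L a)^2] bounds the time integral of the potential over
   [0, a], so the nonlinear evolution is a perturbation of relative size e. *)
Hypothesis small : 100 * 100 * 600 * (c * L * a) ^+ 2 <= e.

Let wphi i : wiener (phi i). Proof. exact: rep_wiener (rep_component _ _ s1). Qed.
Let uc i : wcont T (fun t => u t i). Proof. exact: wcont_component. Qed.
Let cc : 0 <= c. Proof. exact: c0_ge0. Qed.
Let L0' : 0 <= L. Proof. exact: ltW. Qed.
Let cLL : 0 <= c * L ^+ 2. Proof. by rewrite mulr_ge0// sqr_ge0. Qed.
Let wK m nu : wiener (eps_cur m nu phi). Proof. exact: wiener_eps_cur. Qed.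
Let KL m nu : wn (eps_cur m nu phi) <= 12 * (c * L ^+ 2). Proof. exact: wn_eps_cur. Qed.
Let inT t : 0 <= t <= a -> 0 <= t <= T.
Proof. by move=> /andP[-> /le_trans]; apply. Qed.
Let ina t s : 0 <= t <= a -> 0 <= s <= t -> 0 <= s <= a.
Proof. by move=> /andP[_ ta] /andP[-> /le_trans]; apply. Qed.
Let wu t i : 0 <= t <= a -> wiener (u t i).
Proof. by move=> ta; apply: rep_wiener (rep_component _ _ s1). Qed.

Let data_sum nu t x :=
  (- 2^-1)%:C * (data_potential N f0 true nu t x + data_potential N f0 false nu t x).

Let rep_data nu t : rep (data_sum nu t) (fun xi =>
  imC R * (sin (t * plane_norm xi))%:C * inv_symbol N xi * fourier (K nu) xi).
Proof.
have rK := wiener_fourier (wK 0 nu).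
have r b := rep_multiplier (repZ (sg R b)%:C (rep_multiplier rK (bounded_inv_symbol N0)))
  (bounded_U_symbol b t).
have := repZ (- 2^-1)%:C (repD (r true) (r false)).
congr (rep _ _); apply/funext => xi; rewrite -U_symbol_diff /sg rmorphN rmorph1; ring.
Qed.

Let wn_data nu t : 0 <= t -> wn (data_sum nu t) <= t * (12 * (c * L ^+ 2)).
Proof.
move=> t0; apply: (@le_trans _ _ (t * wn (K nu))); last by rewrite ler_wpM2l.
apply: (@wn_le_rep R (fun _ => True) _ _ _ _ (rep_data nu t) (wK 0 nu)).
  by apply: nearW => xi [].
move=> xi _; rewrite ncM; apply: ler_wpM2r; first exact: nc_ge0.
rewrite !ncM nc_i mul1r nc_real /inv_symbol nc_real.
case: (leP N (plane_norm xi)) => /= h; last by rewrite normr0 mulr0.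
have x0 : 0 < plane_norm xi by exact: lt_le_trans h.
have i0 : 0 <= (plane_norm xi)^-1 by rewrite invr_ge0 ltW.
rewrite (ger0_norm i0) ler_pdivrMr//.
by apply: le_trans (sin_bound _) _; rewrite ger0_norm// mulr_ge0// ltW.
Qed.

(** The two waves of opposite sign combine to the symbol i sin(t|xi|) / |xi|,
    which is i t up to O(e t) when t |xi| is O(e). *)
Let wn_data_lead nu t : 0 <= t <= a ->
  wn (fun x => data_sum nu t x - imC R * t%:C * eps_cur 0 nu phi x) <=
  72 * (e * (c * L ^+ 2)) * t.
Proof.
move=> /andP[t0 ta].
apply: (@le_trans _ _ (6 * t ^+ 2 * N * wn (K nu))).
  apply: (@wn_le_rep R (fun xi => N <= plane_norm xi /\ plane_norm xi <= 6 * N) _ _ _ _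
    (repB (rep_data nu t) (repZ (imC R * t%:C) (wiener_fourier (wK 0 nu)))) (wK 0 nu)).
    apply: filterS2 (far nu) (supp6 0 nu) => xi h1 h2 /not_andP[/negP|//].
      by rewrite -ltNge => /h1.
  move=> xi hF; have [[h1 h2]|/hF ->] := pselect (N <= plane_norm xi /\ plane_norm xi <= 6 * N);
    last by rewrite !mulr0 subrr nc0 mulr0.
  have x0 : 0 < plane_norm xi by exact: lt_le_trans h1.
  rewrite -mulrBl ncM; apply: ler_wpM2r; first exact: nc_ge0.
  rewrite /inv_symbol h1 -mulrA -rmorphM nc_ratio.
  have -> : sin (t * plane_norm xi) / plane_norm xi - t =
      (sin (t * plane_norm xi) - t * plane_norm xi) / plane_norm xi.
    by field; rewrite gt_eqF.
  have i0 : 0 <= (plane_norm xi)^-1 by rewrite invr_ge0 ltW.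
  rewrite normrM (ger0_norm i0) ler_pdivrMr//.
  have tx : 0 <= t * plane_norm xi by rewrite mulr_ge0// ltW.
  apply: le_trans (sin_sub_bound tx) _.
  rewrite exprMn expr2 -(mulrA 6) -(mulrA 6) [leRHS]mulrC.
  have h3 : t ^+ 2 * plane_norm xi <= t ^+ 2 * (6 * N) by rewrite ler_wpM2l// sqr_ge0.
  have := ler_wpM2r (ltW x0) h3; rewrite expr2 => h4; lra.
have tN : t * N <= e by apply: le_trans aN; rewrite ler_wpM2r// ltW.
have k1 : 6 * t ^+ 2 * N * wn (K nu) = 6 * t * (t * N) * wn (K nu) by ring.
rewrite k1 (_ : 72 * (e * (c * L ^+ 2)) * t = 6 * t * e * (12 * (c * L ^+ 2))); last by ring.
apply: ler_pM; rewrite ?wn_ge0// ?mulr_ge0// ?(ltW N0)//.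
by rewrite ler_wpM2l// mulr_ge0.
Qed.

(** By [riesz_sum] only the index 0 of the Riesz operators survives, with -2. *)
Let source_lead nu (t : R) : 0 <= t <= a ->
  wn (fun x => multiplier (U_symbol true t) (source true nu phi) x +
    multiplier (U_symbol false t) (source false nu phi) x + 2%:C * eps_cur 0 nu phi x) <=
  864 * (e * (c * L ^+ 2)).
Proof.
move=> /andP[t0 ta].
pose z (m : 'I_3) : R := if m == 0 then 2 else 0.
pose h m x := multiplier (U_symbol true t) (multiplier (riesz_symbol true m) (eps_cur m nu phi)) x
  + multiplier (U_symbol false t) (multiplier (riesz_symbol false m) (eps_cur m nu phi)) x
  + (z m)%:C * eps_cur m nu phi x.
have r b m := rep_multiplier (rep_multiplier (wiener_fourier (wK m nu)) (bounded_riesz_symbol R b m))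
  (bounded_U_symbol b t).
have rh m := repD (repD (r true m) (r false m)) (repZ (z m)%:C (wiener_fourier (wK m nu))).
have wm b m : wiener (multiplier (riesz_symbol b m) (eps_cur m nu phi)).
  exact: (wiener_multiplier (wK m nu) (bounded_riesz_symbol R b m)).
have eh : (fun x => multiplier (U_symbol true t) (source true nu phi) x +
    multiplier (U_symbol false t) (source false nu phi) x + 2%:C * eps_cur 0 nu phi x) =
    (fun x => \sum_m h m x).
  apply/funext => x; rewrite /h 2!big_split /=; congr (_ + _ + _).
  - by rewrite /source (multiplier_sum _ _ (bounded_U_symbol true t) (wm true)).
  - by rewrite /source (multiplier_sum _ _ (bounded_U_symbol false t) (wm false)).
  - rewrite (bigD1 ord0)//= big1 ?addr0 => [|m m0]; first by rewrite /z eqxx.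
    by rewrite /z (negbTE m0) mul0r.
rewrite eh; apply: le_trans (wn_sum _ _ (fun m => rep_wiener (rh m))) _.
apply: (@le_trans _ _ (\sum_(m < 3) 288 * (e * (c * L ^+ 2)))); last first.
  by rewrite !big_ord_recl !big_ord0 le_eqVlt; apply/orP; left; apply/eqP; ring.
apply: ler_sum => m _.
apply: (@le_trans _ _ (24 * (t * N) * wn (eps_cur m nu phi))).
  apply: (@wn_le_rep R _ _ _ _ _ (rh m) (wK m nu) (supp6 m nu)) => xi hF.
  have [h6|/hF ->] := pselect (plane_norm xi <= 6 * N); last by rewrite !mulr0 !addr0 nc0 mulr0.
  rewrite !mulrA -!mulrDl ncM; apply: ler_wpM2r; first exact: nc_ge0.
  apply: le_trans (riesz_sum m xi t0) _.
  have := ler_wpM2l t0 h6; lra.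
have tN : t * N <= e by apply: le_trans aN; rewrite ler_wpM2r// ltW.
rewrite (_ : 288 * (e * (c * L ^+ 2)) = 24 * e * (12 * (c * L ^+ 2))); last by ring.
apply: ler_pM; rewrite ?wn_ge0// ?mulr_ge0// ?(ltW N0)//.
by rewrite ler_wpM2l.
Qed.

Definition linear_part t i (x : plane) : R[i] :=
  \sum_(b : bool) \sum_k multiplier (propagator b t i k) (phi k) x.

Let wE b t i k : wiener (multiplier (propagator b t i k) (phi k)).
Proof. exact: (wiener_multiplier (wphi k) (bounded_propagator b t i k)). Qed.

Let wlin t i : wiener (linear_part t i).
Proof. by apply: wiener_sum => b; apply: wiener_sum => k. Qed.

Lemma wn_linear_part t i : wn (linear_part t i) <= 8 * L.
Proof.
apply: le_trans (wn_sum _ _ (fun b => wiener_sum _ _ (wE b t i))) _.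
apply: (@le_trans _ _ (\sum_(b : bool) \sum_(k < 2) 2 * L)).
  apply: ler_sum => b _; apply: le_trans (wn_sum _ _ (wE b t i)) _.
  apply: ler_sum => k _.
  apply: le_trans (wn_multiplier (wphi k) (bounded_propagator b t i k)) _.
  by rewrite ler_wpM2l.
by rewrite big_bool /= !big_ord_recl !big_ord0 le_eqVlt; apply/orP; left; apply/eqP; ring.
Qed.

Lemma wn_linear_part_close t i : 0 <= t <= a ->
  wn (fun x => linear_part t i x - phi i x) <= 48 * (e * L).
Proof.
move=> /andP[t0 ta].
pose q k x := multiplier (propagator true t i k) (phi k) x + multiplier (propagator false t i k) (phi k) x
  - (i == k)%:R * phi k x.
have r b k := rep_multiplier (wiener_fourier (wphi k)) (bounded_propagator b t i k).
have rq k := repB (repD (r true k) (r false k)) (repZ (i == k)%:R (wiener_fourier (wphi k))).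
have eq : (fun x => linear_part t i x - phi i x) = (fun x => \sum_k q k x).
  apply/funext => x; rewrite /q sumrB big_split /=; congr (_ - _).
    by rewrite /linear_part big_bool.
  rewrite (bigD1 i)//= eqxx mul1r big1 ?addr0// => k ki.
  by rewrite eq_sym (negbTE ki) mul0r.
rewrite eq; apply: le_trans (wn_sum _ _ (fun k => rep_wiener (rq k))) _.
apply: (@le_trans _ _ (\sum_(k < 2) 24 * (e * L))); last first.
  by rewrite !big_ord_recl !big_ord0 le_eqVlt; apply/orP; left; apply/eqP; ring.
apply: ler_sum => k _; apply: (@le_trans _ _ (24 * (t * N) * wn (phi k))).
  apply: (@wn_le_rep R _ _ _ _ _ (rq k) (wphi k) (supp3 k)) => xi hF.
  rewrite -mulrDl -mulrBl ncM.
  have [h3|/hF ->] := pselect (plane_norm xi <= 3 * N); last by rewrite nc0 !mulr0.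
  apply: ler_wpM2r; first exact: nc_ge0.
  have := sum_propagator_sub i k xi t0; rewrite big_bool => /le_trans; apply.
  have := ler_wpM2l t0 h3; lra.
have tN : t * N <= e by apply: le_trans aN; rewrite ler_wpM2r// ltW.
rewrite -mulrA ler_wpM2l//; apply: ler_pM; rewrite ?wn_ge0 ?mulr_ge0//; exact: ltW.
Qed.

Section Bounded.
Variable t : R.
Hypothesis ta : 0 <= t <= a.
Hypothesis u9 : forall s, 0 <= s <= t -> forall i, wn (u s i) <= 9 * L.

Let t0 : 0 <= t. Proof. by case/andP: ta. Qed.

Lemma wn_potential nu s : 0 <= s <= t -> wn (V nu s) <= 60 * 100 * (c * L ^+ 2) * s.
Proof.
have num (r : R) : 0 <= r -> 12 * r + (36 * 81 * r + 36 * 81 * r) <= 60 * 100 * r by lra.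
move=> st; have sa := ina ta st; have sT := inT sa; have s0 : 0 <= s by case/andP: st.
have hn b : wn (nonlin_potential f b nu s) <= 36 * (c * (9 * L) ^+ 2) * s.
  apply: wn_duhamel sT _; first exact: wcont_source.
  move=> r rs; apply: wn_source => i; first exact: wu (ina sa rs).
  by apply: u9; case/andP: rs => -> /le_trans; apply; case/andP: st.
have wn1 b := (wcont_nonlin_potential f s1 T0 b nu).1 s sT.
have w1 := rep_wiener (rep_data nu s).
have := wnD w1 (wienerZ (imC R) (wienerD (wn1 true) (wn1 false))).
move=> /le_trans; apply.
rewrite wnZ; last exact: wienerD.
rewrite nc_i mul1r; have := wnD (wn1 true) (wn1 false).
have := wn_data nu s0; have := hn true; have := hn false.
have cs : 0 <= c * L ^+ 2 * s by rewrite mulr_ge0.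
rewrite !exprMn; move: cs; set q := c * L ^+ 2 => cs.
have -> : c * (9 ^+ 2 * L ^+ 2) = 81 * q by rewrite /q; ring.
move=> h1 h2 h3 h4.
have e1' : 36 * (81 * q) * s = 36 * 81 * (q * s) by ring.
have e2' : s * (12 * q) = 12 * (q * s) by ring.
have e3' : 60 * 100 * q * s = 60 * 100 * (q * s) by ring.
rewrite e1' in h1 h2; rewrite e2' in h3; rewrite e3'.
exact: le_trans (lerD h3 (le_trans h4 (lerD h2 h1))) (num _ cs).
Qed.

Lemma wn_interaction_solution k s : 0 <= s <= t ->
  wn (interaction (V ^~ s) (u s) k) <= 100 * 100 * 33 * (c ^+ 2 * L ^+ 3) * s.
Proof.
move=> st; have sa := ina ta st; have sT := inT sa.
have wV nu := (wcont_potential f0 f s1 T0 N0 nu).1 s sT.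
have := @wn_interaction R (V ^~ s) (u s) k _ _ wV (fun i => wu i sa)
  (fun nu => wn_potential nu st) (u9 st).
move=> /le_trans; apply.
have cL : 0 <= c ^+ 2 * L ^+ 3 * s by rewrite !mulr_ge0 ?exprn_ge0//; case/andP: st.
have -> : 6 * (c * (60 * 100 * (c * L ^+ 2) * s * (9 * L))) = 54 * 60 * 100 * (c ^+ 2 * L ^+ 3 * s).
  by ring.
rewrite -(mulrA _ _ s); lra.
Qed.

(** The potential is at most linear in time, so the Duhamel term is quadratic:
    it is bounded by [(c L t)^2 L] up to a constant, which the smallness of the
    data absorbs. The bound 9 L that is assumed here will follow from the bound
    8 L for the linear part. *)
Lemma wn_duhamel_sum i :
  wn (fun x => \sum_(b : bool) duhamel b (forcing f V b i) t x) <= e / 2 * L.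
Proof.
have tT := inT ta.
have Vc nu := wcont_potential f0 f s1 T0 N0 nu.
have Fc b := wcont_forcing f s1 T0 b i Vc.
have h b : wn (duhamel b (forcing f V b i) t) <= 100 * 100 * 132 * (c ^+ 2 * L ^+ 3) * t * t.
  apply: wn_duhamel (Fc b) tT _ => s st.
  have sT := inT (ina ta st).
  have wG k := wiener_interaction f s1 T0 k Vc sT.
  apply: le_trans (wn_sum _ _ (fun k => wiener_multiplier (wG k) (bounded_Pi_symbol R b i k))) _.
  apply: (@le_trans _ _ (\sum_(k < 2) 2 * (100 * 100 * 33 * (c ^+ 2 * L ^+ 3) * s))).
    apply: ler_sum => k _.
    apply: le_trans (wn_multiplier (wG k) (bounded_Pi_symbol R b i k)) _.
    by rewrite ler_wpM2l// wn_interaction_solution.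
  rewrite !big_ord_recl !big_ord0.
  have h1 : c ^+ 2 * L ^+ 3 * s <= c ^+ 2 * L ^+ 3 * t.
    by rewrite ler_wpM2l ?mulr_ge0 ?exprn_ge0//; case/andP: st.
  rewrite addr0 -!(mulrA _ _ s) -!(mulrA _ _ t); lra.
have wd b := (wcont_duhamel b (Fc b)).1 t tT.
apply: le_trans (wn_sum _ _ wd) _; rewrite big_bool /=.
apply: le_trans (lerD (h true) (h false)) _.
have k1 : (c * L * t) ^+ 2 <= (c * L * a) ^+ 2.
  rewrite lerXn2r ?nnegrE ?mulr_ge0//.
  by rewrite ler_wpM2l ?mulr_ge0//; case/andP: ta.
have k3 : 100 * 100 * 600 * (c * L * t) ^+ 2 <= e by apply: le_trans small; lra.
have k4 := ler_wpM2r L0' k3.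
have -> : 100 * 100 * 132 * (c ^+ 2 * L ^+ 3) * t * t = 100 * 100 * 132 * ((c * L * t) ^+ 2 * L) by ring.
move: k4; rewrite -(mulrA (100 * 100 * 600) _ L).
have : 0 <= (c * L * t) ^+ 2 * L by rewrite mulr_ge0// sqr_ge0.
lra.
Qed.

Hypothesis uD : forall s, 0 <= s <= t -> forall i,
  wn (fun x => u s i x - phi i x) <= 50 * (e * L).

Let phi9 i : wn (phi i) <= 9 * L.
Proof. apply: (le_trans (phiL i)); move: L0'; lra. Qed.

Lemma wn_nonlin_lead nu s : 0 <= s <= t ->
  wn (fun x => nonlin_potential f true nu s x + nonlin_potential f false nu s x +
               (2 * s)%:C * eps_cur 0 nu phi x) <= 100 * 660 * (e * (c * L ^+ 2)) * s.
Proof.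
have reorder (p p' q q' z : R[i]) : p + p' + (q + q') + z = p + q + (p' + q' + z) by ring.
have num (q : R) : 0 <= q -> 72 * (450 * q) + 72 * (450 * q) + 864 * q <= 100 * 660 * q by lra.
move=> st; have sa := ina ta st; have sT := inT sa; have s0 : 0 <= s by case/andP: st.
have ss : 0 <= s <= s by rewrite s0 lexx.
have Sc b := wcont_source f s1 T0 b nu.
pose I r x := multiplier (U_symbol true (s - r)) (source true nu (u r)) x +
  multiplier (U_symbol false (s - r)) (source false nu (u r)) x + 2%:C * eps_cur 0 nu phi x.
have Ic : wcont s I.
  apply: wcontD; last by apply: wcontZ; exact: wcont_cst.
  by apply: wcontD; exact: wcont_integrand sT.
have -> : (fun x => nonlin_potential f true nu s x + nonlin_potential f false nu s x +
    (2 * s)%:C * eps_cur 0 nu phi x) = (fun x => int0 s (fun r => I r x)).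
  apply/funext => x.
  have c1 b := duhamel_cseqcont b x (Sc b) sT.
  have c3 : cseqcont s (fun _ => 2%:C * eps_cur 0 nu phi x).
    exact: (wcont_eval x (wcont_cst s (wienerZ 2%:C (wK 0 nu)))).
  have c2 : cseqcont s (fun r => multiplier (U_symbol true (s - r)) (source true nu (u r)) x +
      multiplier (U_symbol false (s - r)) (source false nu (u r)) x).
    exact: (wcont_eval x (wcontD (wcont_integrand true (Sc true) sT) (wcont_integrand false (Sc false) sT))).
  apply: esym; apply: (etrans (integral0D ss c2 c3)); apply: (congr2 (fun p q => p + q)).
    exact: (integral0D ss (c1 true) (c1 false)).
  by rewrite integral0_cst// mulrA -rmorphM (mulrC s).
apply: (wn_integral0 Ic ss) => r rs.
have ra := ina sa rs; have rt : 0 <= r <= t by case/andP: rs => -> /le_trans; apply; case/andP: st.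
have sr : 0 <= s - r <= a by case/andP: rs => r0 rles; case/andP: sa => _ sle; apply/andP; split; lra.
have ws b : wiener (source b nu (u r)) by apply: wiener_source => i; exact: wu ra.
have ws0 b : wiener (source b nu phi) by exact: wiener_source.
have wd b := wienerB (ws b) (ws0 b).
have dB b : wn (fun x => source b nu (u r) x - source b nu phi x) <= 72 * (450 * (e * (c * L ^+ 2))).
  have := @wn_sourceB R (u r) phi (9 * L) (50 * (e * L)) (fun i => wu i ra) wphi (u9 rt) phi9 (uD rt) b nu.
  by congr (_ <= _); ring.
have wmd b := wiener_multiplier (wd b) (bounded_U_symbol b (s - r)).
have wm0 b := wiener_multiplier (ws0 b) (bounded_U_symbol b (s - r)).
have eI : I r = (fun x =>
    (multiplier (U_symbol true (s - r)) (fun x => source true nu (u r) x - source true nu phi x) x +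
     multiplier (U_symbol false (s - r)) (fun x => source false nu (u r) x - source false nu phi x) x) +
    (multiplier (U_symbol true (s - r)) (source true nu phi) x +
     multiplier (U_symbol false (s - r)) (source false nu phi) x + 2%:C * eps_cur 0 nu phi x)).
  have es b : multiplier (U_symbol b (s - r)) (source b nu (u r)) = (fun x =>
      multiplier (U_symbol b (s - r)) (fun x => source b nu (u r) x - source b nu phi x) x +
      multiplier (U_symbol b (s - r)) (source b nu phi) x).
    apply: etrans (multiplierD (bounded_U_symbol b (s - r)) (wd b) (ws0 b)).
    by apply: (congr1 (multiplier (U_symbol b (s - r)))); apply/funext => x; rewrite subrK.
  apply/funext => x; apply: etrans (reorder _ _ _ _ _).
  exact: (congr2 (fun p q : plane -> R[i] => p x + q x + 2%:C * eps_cur 0 nu phi x) (es true) (es false)).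
rewrite eI; have w2 := wienerD (wienerD (wm0 true) (wm0 false)) (wienerZ 2%:C (wK 0 nu)).
apply: le_trans (wnD (wienerD (wmd true) (wmd false)) w2) _.
have mb b : wn (multiplier (U_symbol b (s - r)) (fun x => source b nu (u r) x - source b nu phi x))
    <= 72 * (450 * (e * (c * L ^+ 2))).
  apply: le_trans (wn_multiplier (wd b) (bounded_U_symbol b (s - r))) _.
  by rewrite mul1r.
apply: le_trans (lerD (le_trans (wnD (wmd true) (wmd false)) (lerD (mb true) (mb false)))
  (source_lead nu sr)) _.
by apply: num; rewrite mulr_ge0.
Qed.

(** To leading order the initial data contribute i t K and the nonlinearity
    -2 i t K, where K is the current contracted with epsilon at time 0. *)
Lemma wn_potential_lead nu s : 0 <= s <= t ->
  wn (fun x => V nu s x - - (imC R * s%:C) * eps_cur 0 nu phi x) <=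
  100 * 670 * (e * (c * L ^+ 2)) * s.
Proof.
have regroup (d n k i : R[i]) (r : R) : d + i * n - - (i * r%:C) * k =
    (d - i * r%:C * k) + i * (n + (2 * r)%:C * k).
  by rewrite rmorphM (rmorph_nat (real_complex R)); ring.
have num (q : R) : 0 <= q -> 72 * q + 100 * 660 * q <= 100 * 670 * q by lra.
move=> st; have sa := ina ta st; have sT := inT sa; have s0 : 0 <= s by case/andP: st.
have wn1 b := (wcont_nonlin_potential f s1 T0 b nu).1 s sT.
have w1 := wienerB (rep_wiener (rep_data nu s)) (wienerZ (imC R * s%:C) (wK 0 nu)).
have w2 := wienerD (wienerD (wn1 true) (wn1 false)) (wienerZ (2 * s)%:C (wK 0 nu)).
have -> : (fun x => V nu s x - - (imC R * s%:C) * eps_cur 0 nu phi x) =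
    (fun x => (data_sum nu s x - imC R * s%:C * eps_cur 0 nu phi x) +
      imC R * (nonlin_potential f true nu s x + nonlin_potential f false nu s x +
               (2 * s)%:C * eps_cur 0 nu phi x)).
  by apply/funext => x; exact: regroup.
apply: le_trans (wnD w1 (wienerZ (imC R) w2)) _.
rewrite (wnZ (imC R) w2) nc_i mul1r.
apply: le_trans (lerD (wn_data_lead nu sa) (wn_nonlin_lead nu st)) _.
rewrite -!(mulrA _ _ s); apply: num; by rewrite !mulr_ge0 ?exprn_ge0.
Qed.

Definition cubic (x : plane) : R[i] := conjc (phi 1 x) * phi 1 x * phi 0 x.

(** With K_1 = J^2 and K_2 = - J^1 the products of the Pauli matrices cancel all
    terms of the first component except 2 i conj(phi_1) phi_1 phi_0. *)
Lemma interaction_lead s :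
  interaction (fun nu x => - (imC R * s%:C) * eps_cur 0 nu phi x) phi 0 =
  (fun x => (2 * s)%:C * cubic x).
Proof.
apply/funext => x; rewrite /interaction /cubic sum3 !sum2.
have K0 : eps_cur 0 0 phi x = 0.
  by rewrite /eps_cur big1// => l _; rewrite epsilonE subrr !mul0r.
have ev (m n l : 'I_3) (z : R) : (n%:R - m%:R) * (l%:R - m%:R) * (l%:R - n%:R) = z * 2 ->
    epsilon R m n l = z%:C.
  by move=> h; rewrite epsilonE h mulfK// pnatr_eq0.
have E10 : epsilon R 0 o1 0 = 0 by apply: (ev 0 o1 0 0) => /=; ring.
have E11 : epsilon R 0 o1 o1 = 0 by apply: (ev 0 o1 o1 0) => /=; ring.
have E12 : epsilon R 0 o1 o2 = 1 by apply: (ev 0 o1 o2 1) => /=; ring.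
have E20 : epsilon R 0 o2 0 = 0 by apply: (ev 0 o2 0 0) => /=; ring.
have E21 : epsilon R 0 o2 o1 = -1.
  by rewrite (ev 0 o2 o1 (-1)) ?rmorphN//=; ring.
have E22 : epsilon R 0 o2 o2 = 0 by apply: (ev 0 o2 o2 0) => /=; ring.
have K1 : eps_cur 0 o1 phi x = cur o2 phi x.
  by rewrite /eps_cur sum3 E10 E11 E12 !mul0r !add0r mul1r.
have K2 : eps_cur 0 o2 phi x = - cur o1 phi x.
  by rewrite /eps_cur sum3 E20 E21 E22 !mul0r add0r addr0 mulN1r.
have a100 : alpha R o1 0 0 = 0 by rewrite /alpha /= mxE.
have a101 : alpha R o1 0 1 = 1 by rewrite /alpha /= mxE.
have a110 : alpha R o1 1 0 = 1 by rewrite /alpha /= mxE.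
have a111 : alpha R o1 1 1 = 0 by rewrite /alpha /= mxE.
have a200 : alpha R o2 0 0 = 0 by rewrite /alpha /= mxE.
have a201 : alpha R o2 0 1 = - imC R by rewrite /alpha /= mxE.
have a210 : alpha R o2 1 0 = imC R by rewrite /alpha /= mxE.
have a211 : alpha R o2 1 1 = 0 by rewrite /alpha /= mxE.
rewrite K0 K1 K2 /cur !sum2 a100 a101 a110 a111 a200 a201 a210 a211.
move: (phi 0 x) (phi 1 x) => p q.
have ii : imC R * imC R = -1 by rewrite /imC; apply: complexP => /=; ring.
have num (i z p' q' : R[i]) : i * i = -1 ->
    0 * 0 * 0 + 1 * (- (i * z) * (p' * (0 * p) + p' * (- i * q) + (q' * (i * p) + q' * (0 * q))) * q) +
    - i * (- (i * z) * - (p' * (0 * p) + p' * (1 * q) + (q' * (1 * p) + q' * (0 * q))) * q) =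
    2 * z * (q' * q * p).
  move=> h.
  have -> : 0 * 0 * 0 + 1 * (- (i * z) * (p' * (0 * p) + p' * (- i * q) + (q' * (i * p) + q' * (0 * q))) * q) +
    - i * (- (i * z) * - (p' * (0 * p) + p' * (1 * q) + (q' * (1 * p) + q' * (0 * q))) * q) =
    - (i * i) * (2 * z * (q' * q * p)) by ring.
  by rewrite h opprK mul1r.
rewrite rmorphM (rmorph_nat (real_complex R)) /=.
apply: etrans (num (imC R) s%:C (conjc p) (conjc q) ii); ring.
Qed.

Lemma wn_interaction_lead s : 0 <= s <= t ->
  wn (fun x => interaction (V ^~ s) (u s) 0 x - (2 * s)%:C * cubic x) <=
  100 * 100 * 370 * (e * (c ^+ 2 * L ^+ 3)) * s.
Proof.
have num (q : R) : 0 <= q -> 6 * (100 * 670 * 9 * q + 600 * q) <= 100 * 100 * 370 * q by lra.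
move=> st; have sa := ina ta st; have sT := inT sa; have s0 : 0 <= s by case/andP: st.
have wV nu := (wcont_potential f0 f s1 T0 N0 nu).1 s sT.
have wV' nu := wienerZ (- (imC R * s%:C)) (wK 0 nu).
have V'b nu : wn (fun x => - (imC R * s%:C) * eps_cur 0 nu phi x) <= s * (12 * (c * L ^+ 2)).
  rewrite wnZ// ncN ncM nc_i mul1r ncR//; exact: ler_wpM2l.
have := @wn_interactionB R (u s) phi (9 * L) (50 * (e * L)) (fun i => wu i sa) wphi (u9 st) (uD st)
  (V ^~ s) _ 0 _ _ wV wV' V'b (fun nu => wn_potential_lead nu st).
have el x : interaction (fun nu x => - (imC R * s%:C) * eps_cur 0 nu phi x) phi 0 x =
  (2 * s)%:C * cubic x by rewrite interaction_lead.
have -> : (fun x => interaction (V ^~ s) (u s) 0 x -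
   interaction (fun nu x => - (imC R * s%:C) * eps_cur 0 nu phi x) phi 0 x) =
  (fun x => interaction (V ^~ s) (u s) 0 x - (2 * s)%:C * cubic x).
  by apply/funext => x; rewrite el.
move=> /le_trans; apply.
have q0 : 0 <= e * (c ^+ 2 * L ^+ 3) * s by rewrite !mulr_ge0 ?exprn_ge0.
have := num _ q0; congr (_ <= _); ring.
Qed.

End Bounded.
Let solutionE t i : 0 <= t <= a ->
  u t i = (fun x => linear_part t i x + \sum_(b : bool) duhamel b (forcing f V b i) t x).
Proof. by move=> ta; exact: (component_equation s1 T0 N0 far eqn i (inT ta)). Qed.

Let Vc nu : wcont T (V nu). Proof. exact: wcont_potential. Qed.
Let Fc b i : wcont T (forcing f V b i). Proof. exact: wcont_forcing. Qed.
Let wdsum t i : 0 <= t <= a ->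
  wiener (fun x => \sum_(b : bool) duhamel b (forcing f V b i) t x).
Proof. by move=> ta; apply: wiener_sum => b; exact: (wcont_duhamel b (Fc b i)).1 (inT ta). Qed.

(** The linear part is at most 8 L and the Duhamel term at most L/2 as long as
    the solution is below 9 L, so the solution never reaches 9 L. *)
Lemma solution_bound t i : 0 <= t <= a -> wn (u t i) <= 9 * L.
Proof.
pose y t := Num.max (wn (u t 0)) (wn (u t 1)).
have yi t' j : wn (u t' j) <= y t'.
  case: j => -[|[|//]] hj; rewrite /y le_max.
    by rewrite (_ : Ordinal hj = 0) ?lexx//; apply/val_inj.
  by rewrite (_ : Ordinal hj = 1) ?lexx ?orbT//; apply/val_inj.
have max_dist (p q p' q' : R) : `|Num.max p q - Num.max p' q'| <= `|p - p'| + `|q - q'|.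
  have := normr_ge0 (p - p'); have := normr_ge0 (q - q').
  have := ler_norm (p - p'); have := ler_norm (q - q').
  have := ler_norm (p' - p); have := ler_norm (q' - q).
  rewrite (distrC p' p) (distrC q' q) ler_norml.
  case: (leP p q) => ?; case: (leP p' q') => ?; move=> *; apply/andP; split; lra.
have yc : seqcont a y.
  move=> r v ra va vr; have h j := wcont_seqcont_wn (wcont_sub aT (uc j)) ra va vr.
  apply: (@cvg_dist0 R _ (fun n => `|wn (u (v n) 0) - wn (u r 0)| + `|wn (u (v n) 1) - wn (u r 1)|)).
    by move=> n; exact: max_dist.
  rewrite -(addr0 (0 : R)); apply: cvgD; exact: cvgn_dist (h _).
have step r : 0 <= r <= a -> (forall i, wn (fun x => \sum_(b : bool)
    duhamel b (forcing f V b i) r x) <= e / 2 * L) -> y r <= 17 / 2 * L.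
  have eL : e * L <= 1 * L by rewrite ler_wpM2r.
  have num (p : R) : p <= e / 2 * L -> 8 * L + p <= 17 / 2 * L by move=> ?; lra.
  move=> ra hd; rewrite /y ge_max.
  have h j : wn (u r j) <= 17 / 2 * L.
    rewrite (solutionE j ra); apply: le_trans (wnD (wlin r j) (wdsum j ra)) _.
    by apply: le_trans (num _ (hd j)); rewrite lerD2r wn_linear_part.
  by rewrite !h.
move=> ta; apply: le_trans (yi t i) _.
have LL : 17 / 2 * L < 9 * L by rewrite ltr_pM2r//; lra.
apply: le_trans (ltW LL).
apply: (bootstrap a0 LL yc) ta.
  apply: step => [|j]; first by rewrite lexx.
  have z : 0 <= (0 : R) <= a by rewrite lexx.
  apply: le_trans (wn_sum _ _ (fun b => (wcont_duhamel b (Fc b j)).1 0 (inT z))) _.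
  rewrite big1 ?mulr_ge0// ?divr_ge0// => b _; apply/eqP; rewrite eq_le wn_ge0 andbT.
  exact: wn_duhamel0 T0 (Fc b j).
move=> r ra hr; apply: step => // j; apply: wn_duhamel_sum => // v vr k.
exact: le_trans (yi v k) (hr v vr).
Qed.

Let bound9 t s : 0 <= t <= a -> 0 <= s <= t -> forall i, wn (u s i) <= 9 * L.
Proof. by move=> ta st i; exact: solution_bound (ina ta st). Qed.

(** The solution is replaced by its initial value in the potential and in the
    interaction at the cost of a relative error O(e). *)
Lemma solution_close t i : 0 <= t <= a -> wn (fun x => u t i x - phi i x) <= 50 * (e * L).
Proof.
have num (q : R) : 0 <= q -> 48 * q + q / 2 <= 50 * q by lra.
move=> ta; have -> : (fun x => u t i x - phi i x) = (fun x => (linear_part t i x - phi i x) +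
    \sum_(b : bool) duhamel b (forcing f V b i) t x).
  by apply/funext => x; rewrite (solutionE i ta) addrAC.
apply: le_trans (wnD (wienerB (wlin t i) (wphi i)) (wdsum i ta)) _.
have h1 := wn_linear_part_close i ta.
have h2 : wn (fun x => \sum_(b : bool) duhamel b (forcing f V b i) t x) <= e * L / 2.
  by rewrite mulrAC; apply: wn_duhamel_sum => // s st k; exact: bound9 ta st k.
by apply: le_trans (lerD h1 h2) (num _ _); rewrite mulr_ge0.
Qed.

Let close50 t s : 0 <= t <= a -> 0 <= s <= t ->
  forall i, wn (fun x => u s i x - phi i x) <= 50 * (e * L).
Proof. by move=> ta st i; exact: solution_close (ina ta st). Qed.

Variable m : plane -> R[i].
Hypotheses (m1 : bounded_symbol m 1) (m3 : forall xi, m xi != 0 -> plane_norm xi <= 3 * N).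

Let G k s := interaction (V ^~ s) (u s) k.
Let wG k s : 0 <= s <= a -> wiener (G k s).
Proof. by move=> sa; exact: (wiener_interaction f s1 T0 k Vc (inT sa)). Qed.

(** By [interaction_lead] the forcing at time s is 2 s times the cubic product
    of the initial data, up to a relative error O(e), and its integral is t^2
    times this product. Testing with frequencies O(N) removes the propagators. *)
Lemma pair_solution t : 0 < t -> t <= a ->
  nc (pair m (u t 0) - pair m (linear_part t 0) - (t ^+ 2)%:C * pair m cubic) <=
  100 * 100 * 2000 * (e * (c ^+ 2 * L ^+ 3)) * t ^+ 2.
Proof.
have num (q s r : R) : 0 <= q -> 0 <= s -> s <= r ->
    2 * (24 * (100 * 100 * 33 * (q * s))) + 100 * 100 * 370 * q * s <= 100 * 100 * 2000 * q * r.
  move=> q0 s0 sr; have := mulr_ge0 q0 s0; have := ler_wpM2l q0 sr.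
  by rewrite -(mulrA _ q s) -(mulrA _ q r); lra.
move=> tp tle; have ta : 0 <= t <= a by rewrite ltW.
have t0 := ltW tp; have tT := inT ta; have tt : 0 <= t <= t by rewrite t0 lexx.
have wcub : wiener cubic by apply: wienerM => //; apply: wienerM => //; exact: wiener_conj.
have wd b := (wcont_duhamel b (Fc b 0)).1 t tT.
have alg2 (p0 p1 q0 q1 g0 g1 z : R[i]) (r : R) :
    p0 + p1 + (q0 + q1) + r%:C * ((- 2)%:C * z) =
    p0 + q0 - (0 == 0 :> 'I_2)%:R * g0 + (p1 + q1 - (0 == 1 :> 'I_2)%:R * g1) + (g0 - (2 * r)%:C * z).
  rewrite eqxx (_ : (0 == 1 :> 'I_2) = false)// mul1r mul0r rmorphM rmorphN /=.
  by rewrite !(rmorph_nat (real_complex R)); ring.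
have alg3 (p : bool -> R[i]) (q : bool -> 'I_2 -> R[i]) (g : 'I_2 -> R[i]) z (r : R) :
    (forall b, p b = \sum_k q b k) -> p true + p false + r%:C * ((- 2)%:C * z) =
    \sum_k (\sum_(b : bool) q b k - (0 == k)%:R * g k) + (g 0 - (2 * r)%:C * z).
  by move=> h; rewrite !h !sum2 !big_bool; exact: alg2.
have alg (A B C' : R[i]) : A + B - A - C' = B - C' by ring.
pose P b s := pair m (multiplier (U_symbol b (t - s)) (forcing f V b 0 s)).
have eP b : pair m (duhamel b (forcing f V b 0) t) = int0 t (P b).
  exact: (pair_duhamel b (Fc b 0) tT m1).
have eu : pair m (u t 0) = pair m (linear_part t 0) + (int0 t (P true) + int0 t (P false)).
  apply: etrans (congr1 (pair m) (solutionE 0 ta)) _.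
  apply: etrans (pairD m1 (wlin t 0) (wdsum 0 ta)) _; congr (_ + _).
  apply: etrans (pair_sum _ _ m1 wd) _; rewrite big_bool.
  exact: (congr2 (fun p q => p + q) (eP true) (eP false)).
rewrite eu alg.
have Pc b : cseqcont t (P b) by exact: (wcont_pair (wcont_integrand b (Fc b 0) tT) m1).
pose Q (s : R) := s%:C * ((- 2)%:C * pair m cubic).
have Qc : cseqcont t Q by exact: cseqcont_linear.
have PPc := cseqcontD (Pc true) (Pc false).
have -> : int0 t (P true) + int0 t (P false) - (t ^+ 2)%:C * pair m cubic =
    int0 t (fun s => P true s + P false s + Q s).
  rewrite (integral0D tt PPc Qc) (integral0D tt (Pc true) (Pc false)) integral0_id//.
  congr (_ + _); rewrite mulrA -rmorphM -mulNr -rmorphN; congr (_%:C * _); by field.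
rewrite (_ : 100 * 100 * 2000 * (e * (c ^+ 2 * L ^+ 3)) * t ^+ 2 =
  100 * 100 * 2000 * (e * (c ^+ 2 * L ^+ 3)) * t * t); last by ring.
apply: (nc_integral0 tt (cseqcontD PPc Qc)) => s st.
have sa := ina ta st; have s0 : 0 <= s by case/andP: st.
have wg k := wG k sa.
have ePs b : P b s = \sum_k pair m (multiplier (propagator b (t - s) 0 k) (G k s)).
  exact: (pair_U_Pi b (t - s) 0 m1 wg).
have wg2 := wienerB (wg 0) (wienerZ (2 * s)%:C wcub).
have eS : P true s + P false s + Q s =
    \sum_k (\sum_(b : bool) pair m (multiplier (propagator b (t - s) 0 k) (G k s)) -
            (0 == k)%:R * pair m (G k s)) +
    pair m (fun x => G 0 s x - (2 * s)%:C * cubic x).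
  rewrite (pairB m1 (wg 0) (wienerZ (2 * s)%:C wcub)) (pairZ _ m1 wcub).
  exact: (alg3 (P ^~ s) _ (fun k => pair m (G k s)) _ _ ePs).
rewrite eS.
have tsN : (t - s) * N <= e.
  apply: le_trans aN; rewrite ler_wpM2r ?(ltW N0)//; lra.
have ts0 : 0 <= t - s by case/andP: st => _; rewrite subr_ge0.
have h1 k := pair_propagators k m1 m3 (wg k) e0 ts0 tsN.
have h2 k := wn_interaction_solution ta (fun r rt => bound9 ta rt) k st.
have h3 := wn_interaction_lead ta (fun r rt => bound9 ta rt) (fun r rt => close50 ta rt) st.
apply: le_trans (ncD _ _) _.
have h4 : nc (pair m (fun x => G 0 s x - (2 * s)%:C * cubic x)) <=
    100 * 100 * 370 * (e * (c ^+ 2 * L ^+ 3)) * s.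
  by apply: le_trans (nc_pair m1 wg2) _; rewrite mul1r.
have q0 : 0 <= e * (c ^+ 2 * L ^+ 3) by rewrite !mulr_ge0 ?exprn_ge0.
have h5 : nc (\sum_k (\sum_(b : bool) pair m (multiplier (propagator b (t - s) 0 k) (G k s)) -
            (0 == k)%:R * pair m (G k s))) <= 2 * (24 * (100 * 100 * 33 * (e * (c ^+ 2 * L ^+ 3) * s))).
  rewrite sum2; apply: le_trans (ncD _ _) _.
  have h6 k : 24 * e * wn (G k s) <= 24 * (100 * 100 * 33 * (e * (c ^+ 2 * L ^+ 3) * s)).
    have e24 : 0 <= 24 * e by rewrite mulr_ge0.
    by have := ler_wpM2l e24 (h2 k); congr (_ <= _); ring.
  apply: le_trans (lerD (le_trans (h1 0) (h6 0)) (le_trans (h1 1) (h6 1))) _.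
  by rewrite [leRHS]mulr_natl mulr2n.
apply: le_trans (lerD h5 h4) _.
apply: num => //; case/andP: st => //.
Qed.

End ShortTime.

(** * Third differences of maps of class C^3 *)

Section ThirdDifference.
Variable R : realType.

Lemma is_derive_near (g : R -> R) (x l : R) :
  (forall e : R, 0 < e -> exists2 r : R, 0 < r &
     forall t : R, `|t| < r -> `|g (x + t) - g x - t * l| <= e * `|t|) ->
  is_derive x (1 : R) g l.
Proof.
move=> H.
have cv : (fun h : R => h^-1 *: (g (h *: (1 : R) + x) - g x)) @ 0^' --> l.
  apply/cvgrPdist_le => e e0; have [r r0 hr] := H e e0.
  near=> t.
  have t0 : t != 0 by near: t; exact: nbhs_dnbhs_neq.
  have tr : `|t| < r.
    by near: t; apply: dnbhs0_lt.
  have := hr t tr.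
  have -> : g (t *: (1 : R) + x) = g (x + t) by rewrite /GRing.scale /= mulr1 addrC.
  have -> : l - t^-1 *: (g (x + t) - g x) = - (t^-1 * (g (x + t) - g x - t * l)).
    by rewrite /GRing.scale /=; field.
  rewrite normrN normrM normfV => h; rewrite ler_pdivrMl ?normr_gt0//.
  by rewrite [leRHS]mulrC.
apply: DeriveDef; first by apply/cvg_ex; exists l.
by apply: cvg_lim cv.
Unshelve. all: by end_near. Qed.

Lemma mean_value_bound (g g' : R -> R) (a b B : R) : a <= b ->
  (forall x, a <= x <= b -> is_derive x (1 : R) g (g' x)) ->
  (forall x, a <= x <= b -> `|g' x| <= B) -> `|g b - g a| <= B * (b - a).
Proof.
move=> ab dg hB.
have cg : {within `[a, b], continuous g}.
  apply: derivable_within_continuous => x; rewrite in_itv/= => /dg[] //.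
have dg' x : x \in `]a, b[ -> is_derive x (1 : R) g (g' x).
  by rewrite in_itv/= => /andP[ax xb]; apply: dg; rewrite !ltW.
have [x xab ->] := MVT_segment ab dg' cg.
have ba : 0 <= b - a by rewrite subr_ge0.
rewrite normrM (ger0_norm ba) ler_wpM2r//; apply: hB.
by move: xab; rewrite in_itv.
Qed.

Lemma linear_scale (U W : lmodType R) (F : U -> W) : linear F ->
  forall (t : R) u, F (t *: u) = t *: F u.
Proof.
move=> lF t u; have F0 : F 0 = 0.
  have := lF 1 0 0; rewrite !scale1r addr0 => /(congr1 (fun z => z - F 0)).
  by rewrite subrr addrK.
by have := lF t u 0; rewrite !addr0 F0 addr0.
Qed.

(** Each of the three differences costs one factor d and one derivative. *)
Lemma third_difference_bound (g0 g1 g2 g3 : R -> R) (d B : R) : 0 < d ->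
  (forall x, 0 <= x <= 4 * d -> is_derive x (1 : R) g0 (g1 x)) ->
  (forall x, 0 <= x <= 4 * d -> is_derive x (1 : R) g1 (g2 x)) ->
  (forall x, 0 <= x <= 4 * d -> is_derive x (1 : R) g2 (g3 x)) ->
  (forall x, 0 <= x <= 4 * d -> `|g3 x| <= B) ->
  `|g0 (4 * d) - 3 * g0 (3 * d) + 3 * g0 (2 * d) - g0 d| <= B * d ^+ 3.
Proof.
move=> d0 D0 D1 D2 D3.
have I1 x : 0 <= x <= 3 * d -> 0 <= x <= 4 * d by lra.
have I1' x : 0 <= x <= 3 * d -> 0 <= x + d <= 4 * d by lra.
have I2 x : 0 <= x <= 2 * d -> 0 <= x <= 3 * d by lra.
have I2' x : 0 <= x <= 2 * d -> 0 <= x + d <= 3 * d by lra.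
have I3 x y : 0 <= x <= 3 * d -> x <= y <= x + d -> 0 <= y <= 4 * d by lra.
have I4 x y : 0 <= x <= 2 * d -> x <= y <= x + d -> 0 <= y <= 3 * d by lra.
have I5 y : d <= y <= d + d -> 0 <= y <= 2 * d by lra.
have xd x : x <= x + d by lra.
have len x : x + d - x = d by ring.
have shift_derive (g g' : R -> R) x : is_derive (x + d) (1 : R) g (g' (x + d)) ->
    is_derive x (1 : R) g (g' x) ->
    is_derive x (1 : R) (fun y => g (y + d) - g y) (g' (x + d) - g' x).
  move=> da db.
  have sh : is_derive x (1 : R) (fun y : R => y + d) 1.
    have := @is_deriveD R R^o R^o id (cst d) x 1 1 0 (is_derive_id _ _) (is_derive_cst _ _ _).
    by rewrite addr0.
  have dc := @is_derive1_comp R g (fun y : R => y + d) x _ _ da sh.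
  by have := @is_deriveB R R^o R^o _ _ x 1 _ _ dc db; rewrite mulr1.
have E0 x : 0 <= x <= 3 * d -> is_derive x (1 : R) (fun y => g0 (y + d) - g0 y) (g1 (x + d) - g1 x).
  by move=> h; apply: shift_derive; apply: D0; [exact: I1'|exact: I1].
have E1 x : 0 <= x <= 3 * d -> is_derive x (1 : R) (fun y => g1 (y + d) - g1 y) (g2 (x + d) - g2 x).
  by move=> h; apply: shift_derive; apply: D1; [exact: I1'|exact: I1].
have q2 x : 0 <= x <= 3 * d -> `|g2 (x + d) - g2 x| <= B * d.
  move=> h; rewrite -{2}(len x); apply: mean_value_bound => // y hy.
    exact: D2 (I3 x y h hy).
  exact: D3 (I3 x y h hy).
have q1 x : 0 <= x <= 2 * d ->
    `|(g1 (x + d + d) - g1 (x + d)) - (g1 (x + d) - g1 x)| <= B * d * d.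
  move=> h; rewrite (_ : B * d * d = B * d * (x + d - x)); last by rewrite len.
  apply: (@mean_value_bound (fun y => g1 (y + d) - g1 y) (fun y => g2 (y + d) - g2 y)) => // y hy.
    exact: E1 (I4 x y h hy).
  exact: q2 (I4 x y h hy).
have q0 : `|(g0 (d + d + d + d) - g0 (d + d + d)) - (g0 (d + d + d) - g0 (d + d)) -
    ((g0 (d + d + d) - g0 (d + d)) - (g0 (d + d) - g0 d))| <= B * d * d * d.
  rewrite -[X in _ <= _ * X](len d).
  apply: (@mean_value_bound (fun y => (g0 (y + d + d) - g0 (y + d)) - (g0 (y + d) - g0 y))
    (fun y => (g1 (y + d + d) - g1 (y + d)) - (g1 (y + d) - g1 y))) => // y /I5 h.
    apply: (@shift_derive (fun y => g0 (y + d) - g0 y) (fun y => g1 (y + d) - g1 y)).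
      exact: E0 (I2' y h).
    exact: E0 (I2 y h).
  exact: q1.
have e4 : 4 * d = d + d + d + d by ring.
have e3 : 3 * d = d + d + d by ring.
have e2 : 2 * d = d + d by ring.
rewrite e4 e3 e2; move: q0; congr (`| _ | <= _); ring.
Qed.

Lemma small_factor (C n e : R) : 0 <= C -> 0 <= n -> 0 < e -> exists2 e' : R, 0 < e' &
  [/\ C * (e' * n) <= e, C * (e' * n * n) <= e & C * (e' * n * n * n) <= e].
Proof.
move=> C0 n0 e0; pose q := 1 + C * (n + n ^+ 2 + n ^+ 3).
have m1 := mulr_ge0 C0 n0; have m2 := mulr_ge0 m1 n0; have m3 := mulr_ge0 m2 n0.
have q0 : 0 < q by rewrite /q; lra.
exists (e / q); first by rewrite divr_gt0.
have hq : e / q * q = e by rewrite divfK// gt_eqF.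
have eq0 : 0 <= e / q by rewrite divr_ge0 ?ltW.
have k1 := mulr_ge0 eq0 m1; have k2 := mulr_ge0 eq0 m2; have k3 := mulr_ge0 eq0 m3.
by move: hq; rewrite /q; move: k1 k2 k3 eq0; set w := e / _ => k1 k2 k3 eq0 hq; split; lra.
Qed.

Variables (E F : normedModType R) (S : E -> F).

(** Along a line, composed with a functional, the map is a real function with
    three derivatives; the third one is bounded near 0 by the continuity of the
    third Frechet derivative, and it is cubic in the direction h. The constants
    M and rho depend neither on h nor on the functional. *)
Lemma third_difference : C3_at S 0 -> exists M rho : R, [/\ 0 <= M, 0 < rho &
  forall (h : E) (d : R), 0 < d -> 4 * d * `|h| < rho ->
  forall (Lam : F -> R) (C : R), (forall a u v, Lam (a *: u + v) = a * Lam u + Lam v) ->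
    0 <= C -> (forall v, `|Lam v| <= C * `|v|) ->
  `|Lam (S ((4 * d) *: h)) - 3 * Lam (S ((3 * d) *: h)) +
    3 * Lam (S ((2 * d) *: h)) - Lam (S (d *: h))| <= C * M * `|h| ^+ 3 * d ^+ 3].
Proof.
move=> [D1 [D2 [D3 [near1 cont3]]]].
have [/= r1 r10 h1] := (nbhs_ballP _ _).1 near1.
have [/= r2 r20 h2] := (nbhs_ballP _ _).1 (cont3 1 ltr01).
have [[_ _ b3] _] := h1 0 (ballxx 0 r10).
have [_ _ _ [M0 hM0]] := b3.
exists (`|M0| + 1), (Num.min r1 r2); split; [by rewrite addr_ge0|by rewrite lt_min r10|].
move=> h d d0 dh Lam C LamL C0 LamB.
have LamD u v : Lam (u + v) = Lam u + Lam v by have := LamL 1 u v; rewrite scale1r mul1r.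
have Lam0 : Lam 0 = 0.
  by have := LamD 0 0; rewrite addr0 => /(congr1 (fun z => z - Lam 0)); rewrite subrr addrK.
have LamZ a u : Lam (a *: u) = a * Lam u by have := LamL a u 0; rewrite addr0 Lam0 addr0.
have LamB' u v : Lam (u - v) = Lam u - Lam v.
  by rewrite LamD -scaleN1r LamZ mulN1r.
pose f0 x := Lam (S (x *: h)); pose f1 x := Lam (D1 (x *: h) h).
pose f2 x := Lam (D2 (x *: h) h h); pose f3 x := Lam (D3 (x *: h) h h h).
have inball x : 0 <= x <= 4 * d -> `|x *: h| < Num.min r1 r2.
  move=> /andP[x0 x4]; apply: le_lt_trans dh; rewrite normrZ (ger0_norm x0).
  by rewrite ler_wpM2r.
have in1 x : 0 <= x <= 4 * d -> ball (0 : E) r1 (x *: h).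
  by move=> /inball; rewrite lt_min => /andP[? _]; rewrite -ball_normE /= sub0r normrN.
have in2 x : 0 <= x <= 4 * d -> ball (0 : E) r2 (x *: h).
  by move=> /inball; rewrite lt_min => /andP[_ ?]; rewrite -ball_normE /= sub0r normrN.
have small (P : E -> Prop) : (\forall k \near (0 : E), P k) ->
    exists2 r : R, 0 < r & forall t : R, `|t| < r -> P (t *: h).
  move=> /nbhs_ballP[r r0 hr]; exists (r / (1 + `|h|)); first by rewrite divr_gt0// ltr_pwDl.
  move=> t; rewrite ltr_pdivlMr ?ltr_pwDl// => th; apply: hr.
  rewrite -ball_normE /= sub0r normrN normrZ; apply: le_lt_trans th.
  by rewrite ler_wpM2l// lerDr.
have scale3 (e : R) : 0 < e -> _ := fun e0 => small_factor C0 (normr_ge0 h) e0.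
have d0' x : 0 <= x <= 4 * d -> is_derive x (1 : R) f0 (f1 x).
  move=> xd; apply: is_derive_near => e e0; have [e' e'0 [he _ _]] := scale3 e e0.
  have [[[lin1 _] _ _] H] := h1 _ (in1 x xd).
  have [r r0 hr] := small _ (H e' e'0); exists r => // t /hr[+ _ _].
  rewrite /f0 /f1 scalerDl (linear_scale lin1) => hh.
  rewrite -LamZ -!LamB'; apply: le_trans (LamB _) _.
  apply: le_trans (ler_wpM2l C0 hh) _; rewrite normrZ.
  have := ler_wpM2r (normr_ge0 t) he; lra.
have d1' x : 0 <= x <= 4 * d -> is_derive x (1 : R) f1 (f2 x).
  move=> xd; apply: is_derive_near => e e0; have [e' e'0 [_ he _]] := scale3 e e0.
  have [[_ [_ lin2 _] _] H] := h1 _ (in1 x xd).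
  have [r r0 hr] := small _ (H e' e'0); exists r => // t /hr[_ /(_ h) + _].
  rewrite /f1 /f2 scalerDl (linear_scale (lin2 h)) => hh.
  rewrite -LamZ -!LamB'; apply: le_trans (LamB _) _.
  apply: le_trans (ler_wpM2l C0 hh) _; rewrite normrZ.
  have := ler_wpM2r (normr_ge0 t) he; lra.
have d2' x : 0 <= x <= 4 * d -> is_derive x (1 : R) f2 (f3 x).
  move=> xd; apply: is_derive_near => e e0; have [e' e'0 [_ _ he]] := scale3 e e0.
  have [[_ _ [_ _ lin3 _]] H] := h1 _ (in1 x xd).
  have [r r0 hr] := small _ (H e' e'0); exists r => // t /hr[_ _ /(_ h h)].
  rewrite /f2 /f3 scalerDl (linear_scale (lin3 h h)) => hh.
  rewrite -LamZ -!LamB'; apply: le_trans (LamB _) _.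
  apply: le_trans (ler_wpM2l C0 hh) _; rewrite normrZ.
  have := ler_wpM2r (normr_ge0 t) he; lra.
pose B := C * (`|M0| + 1) * `|h| ^+ 3.
have b3' x : 0 <= x <= 4 * d -> `|f3 x| <= B.
  move=> xd; rewrite /f3 /B; apply: le_trans (LamB _) _; rewrite -mulrA ler_wpM2l//.
  have k1 := h2 _ (in2 x xd) h h h; have k2 := hM0 h h h.
  have k3 : `|D3 (x *: h) h h h| <= `|D3 (x *: h) h h h - D3 0 h h h| + `|D3 0 h h h|.
    by rewrite -{1}(subrK (D3 0 h h h) (D3 (x *: h) h h h)) ler_normD.
  have n3 : 0 <= `|h| ^+ 3 by rewrite exprn_ge0.
  have e3 (z : R) : z * `|h| * `|h| * `|h| = z * `|h| ^+ 3 by ring.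
  rewrite e3 in k1; rewrite e3 in k2; have := ler_wpM2r n3 (ler_norm M0); lra.
exact: (third_difference_bound d0 d0' d1' d2' b3').
Qed.

End ThirdDifference.

(** * Data on two squares *)

Section Squares.
Variable R : realType.
Local Notation plane := (plane R).
Local Notation mu := (leb2 R).

Definition square (p q w : R) : set plane := `[p, p + w]%classic `*` `[q, q + w]%classic.

Lemma in_square (p q w : R) (xi : plane) :
  square p q w xi <-> (p <= xi.1 <= p + w) /\ (q <= xi.2 <= q + w).
Proof. by rewrite /square /= !in_itv. Qed.

Lemma measurable_square p q w : measurable (square p q w).
Proof. by apply: measurableX; exact: measurable_itv. Qed.

Lemma leb_itv (p w : R) : 0 <= w -> leb R `[p, p + w]%classic = w%:E.
Proof.
move=> w0; have -> : leb R `[p, p + w]%classic = _ := lebesgue_measure_itv `[p, p + w].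
move: w0; rewrite le_eqVlt => /predU1P[<-|w0]; first by rewrite /= addr0 ltxx.
by rewrite /= lte_fin ltrDl w0 -EFinB addrAC subrr add0r.
Qed.

Lemma leb2_square p q w : 0 <= w -> mu (square p q w) = (w ^+ 2)%:E.
Proof.
move=> w0; rewrite /leb2 /square.
rewrite [LHS](@product_measure1E _ _ _ _ R (sleb R) (sleb R)); try exact: measurable_itv.
apply: (etrans (congr2 (fun x y => (x * y)%E) (leb_itv p w0) (leb_itv q w0))).
by rewrite -EFinM expr2.
Qed.

Lemma Rintegral_indic (A : set plane) (r : R) : measurable A -> mu A = r%:E ->
  mu.-integrable setT (EFin \o (\1_A : plane -> R)) /\ \int[mu]_xi (\1_A xi : R) = r.
Proof.
move=> mA Ar; have e : (\int[mu]_xi (\1_A xi : R)%:E = r%:E)%E.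
  by rewrite integral_indic// setIT.
split; last by rewrite /Rintegral e.
apply/integrableP; split; first by apply/measurable_EFinP; exact: measurable_indic.
under eq_integral do rewrite /= ger0_norm//.
by rewrite [ltLHS]e ltry.
Qed.

Lemma integral_ge (f : plane -> R) (A : set plane) (k r : R) :
  mu.-integrable setT (EFin \o f) -> measurable A -> mu A = r%:E -> 0 <= k ->
  (forall xi, 0 <= f xi) -> (forall xi, A xi -> k <= f xi) -> k * r <= \int[mu]_xi f xi.
Proof.
move=> fi mA Ar k0 f0 fA; have [iA <-] := Rintegral_indic mA Ar.
rewrite -(RintegralZl k measurableT iA).
apply: ae_le_Rintegral => //; first exact: rintegrableZ.
  by move=> xi; rewrite mulr_ge0.
apply: nearW => xi; rewrite indicE; case: (boolP (xi \in A)) => h /=.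
  by rewrite mulr1; apply: fA; exact: set_mem.
by rewrite mulr0.
Qed.

(** For real nonnegative transforms, where convolutions are bounded from below
    by restricting the integral. *)
Definition rconv (p q : plane -> R) (xi : plane) : R :=
  \int[mu]_eta (p eta * q (shift eta xi)).

Lemma conv_real (p q : plane -> R) xi :
  conv (fun eta => (p eta)%:C) (fun eta => (q eta)%:C) xi = (rconv p q xi)%:C.
Proof.
rewrite /conv /rconv; apply: complexP => /=.
  by apply: eq_Rintegral => eta _; rewrite mul0r subr0.
rewrite (@eq_Rintegral _ _ R mu setT (fun=> 0)); last by move=> eta _; rewrite mulr0 mul0r addr0.
by rewrite /Rintegral integral0.
Qed.

Lemma conv_eq0 (F G : plane -> R[i]) xi : (forall eta, F eta * G (shift eta xi) = 0) ->
  conv F G xi = 0.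
Proof.
by move=> h; apply: etrans (cintegral0 mu setT); apply: eq_cintegral => eta _; exact: h.
Qed.

Lemma rconv_ge (p q : plane -> R) xi (A : set plane) (k r C : R) :
  mu.-integrable setT (EFin \o p) -> measurable_fun setT q -> (forall eta, 0 <= p eta) ->
  (forall eta, 0 <= q eta <= C) -> measurable A -> mu A = r%:E -> 0 <= k ->
  (forall eta, A eta -> k <= p eta * q (shift eta xi)) -> k * r <= rconv p q xi.
Proof.
move=> ip mq p0 qC mA Ar k0 hk; apply: integral_ge mA Ar k0 _ hk.
  have mp : measurable_fun setT p by apply/measurable_EFinP; exact: measurable_int ip.
  have ms : measurable_fun setT (fun eta : plane => shift eta xi).
    have -> : (fun eta : plane => shift eta xi) = paffine (-1) xi.
      by apply/funext => eta; rewrite /shift /paffine /affine /=; congr (_, _); ring.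
    exact: measurable_paffine.
  apply: (integrable_le _ _ (rintegrableZ C measurableT ip)) => //.
    by apply: measurable_funM => //; exact: measurableT_comp mq ms.
  move=> eta _; have /andP[q0 qle] := qC (shift eta xi).
  rewrite ger0_norm ?mulr_ge0// mulrC.
  by apply: ler_wpM2r.
by move=> eta; have /andP[q0 _] := qC (shift eta xi); rewrite mulr_ge0.
Qed.

End Squares.

Section Data.
Variable R : realType.
Local Notation plane := (plane R).
Local Notation mu := (leb2 R).
Local Notation c := (c0 R).

(** Two squares of side N on opposite sides of the origin. Their differences stay
    away from the origin, while the differences within one square surround it. *)
Definition data_square (N : R) (i : 'I_2) : set plane :=
  if i == 0 then square N 0 N else square (- (2 * N)) 0 N.

Definition hat_data (N : R) (xi : plane) : spinor R := \col_i (\1_(data_square N i) xi : R)%:C.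

Lemma measurable_data_square N i : measurable (data_square N i).
Proof. by rewrite /data_square; case: ifP => _; exact: measurable_square. Qed.

Lemma leb2_data_square N i : 0 <= N -> mu (data_square N i) = (N ^+ 2)%:E.
Proof. by move=> N0; rewrite /data_square; case: ifP => _; rewrite leb2_square. Qed.

Lemma in_data_square N i xi : 0 <= N -> data_square N i xi ->
  [/\ N <= `|xi.1|, `|xi.1| <= 2 * N & 0 <= xi.2 <= N].
Proof.
move=> N0; rewrite /data_square; case: ifP => _ /in_square[/andP[h1 h2] /andP[h3 h4]].
  have x0 : 0 <= xi.1 by lra.
  rewrite (ger0_norm x0); split; try apply/andP; try split; lra.
have x0 : xi.1 <= 0 by lra.
rewrite (ler0_norm x0); split; try apply/andP; try split; lra.
Qed.

Lemma plane_norm_data_square N i xi : 0 <= N -> data_square N i xi -> N <= plane_norm xi <= 3 * N.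
Proof.
move=> N0 /(in_data_square N0)[h1 h2 /andP[h3 h4]]; rewrite (le_trans h1 (plane_norm_ge1 xi))/=.
apply: le_trans (plane_norm_le xi) _; rewrite (ger0_norm h3); lra.
Qed.

Lemma measurable_hat_data N : measurable_spinor (hat_data N).
Proof.
move=> i; split.
  rewrite (_ : (fun x => _) = \1_(data_square N i)); first exact: measurable_indic (measurable_data_square N i).
  by apply/funext => xi; rewrite mxE.
by rewrite (_ : (fun x => _) = cst 0)//; apply/funext => xi; rewrite mxE.
Qed.

Lemma indic01 (A : set plane) xi : (\1_A xi : R) = 0 \/ (\1_A xi : R) = 1 /\ A xi.
Proof.
rewrite indicE; case: (boolP (xi \in A)) => h; [right|left] => //.
by split => //; exact: set_mem.
Qed.

Lemma sobolev_hat_data sigma N W : 0 <= N -> 0 <= W ->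
  (forall i xi, data_square N i xi -> (1 + plane_norm xi) `^ sigma <= W) ->
  sobolev sigma (hat_data N) /\ (sobolev_norm sigma (hat_data N) <= (2 * W * N)%:E)%E.
Proof.
move=> N0 W0 hW.
have H : (sobolev_norm sigma (hat_data N) <= (2 * W * N)%:E)%E.
  rewrite sobolev_normE.
  have WN : 0 <= 2 * W * N by rewrite !mulr_ge0.
  have -> : (2 * W * N)%:E = (((2 * W * N) ^+ 2)%:E `^ 2^-1)%E.
    by rewrite poweR_EFin -powR_mulrn// -powRrM mulfV ?powRr1.
  have mW : measurable_fun setT (fun xi => weighted sigma (hat_data N) xi `^ 2).
    apply: (measurableT_comp (measurable_powR _)).
    exact: measurable_weighted (measurable_hat_data N).
  apply: gt0_ler_poweR; rewrite ?invr_ge0 ?in_itv/= ?leey ?andbT//.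
  - by apply: integral_ge0 => x _; rewrite lee_fin powR_ge0.
  - by rewrite lee_fin sqr_ge0.
  have [i1 e1] := Rintegral_indic (measurable_data_square N 0) (leb2_data_square 0 N0).
  have [i2 e2] := Rintegral_indic (measurable_data_square N 1) (leb2_data_square 1 N0).
  have i0 : mu.-integrable setT (EFin \o (fun xi : plane => (\1_(data_square N 0) xi : R) + \1_(data_square N 1) xi)).
    exact: (integrableD measurableT i1 i2).
  have i12 := rintegrableZ (2 * W ^+ 2) measurableT i0.
  have e12 : \int[mu]_xi (2 * W ^+ 2 * ((\1_(data_square N 0) xi : R) + \1_(data_square N 1) xi)) = (2 * W * N) ^+ 2.
    rewrite (RintegralZl _ measurableT i0) (RintegralD measurableT i1 i2) e1 e2; ring.
  rewrite -e12 /Rintegral fineK; last exact: integrable_fin_num.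
  apply: ge0_le_integral => //=.
  - by move=> x _; rewrite lee_fin powR_ge0.
  - exact/measurable_EFinP.
  - by case/integrableP: i12.
  move=> xi _; rewrite lee_fin powR_mulrn ?weighted_ge0// /weighted exprMn.
  rewrite sqr_sqrtr ?addr_ge0 ?sqr_ge0// !mxE !nc_real.
  have h1 := @indic01 (data_square N 0) xi; have h2 := @indic01 (data_square N 1) xi.
  set w := (1 + plane_norm xi) `^ sigma.
  have w0 : 0 <= w by exact: powR_ge0.
  have wW i : data_square N i xi -> w ^+ 2 <= W ^+ 2.
    by move=> /hW wW; rewrite lerXn2r ?nnegrE.
  have W2 : 0 <= W ^+ 2 by exact: sqr_ge0.
  case: h1 => [->|[-> /wW k1]]; case: h2 => [->|[-> /wW k2]];
    rewrite ?normr0 ?normr1 ?expr0n ?expr1n /=; lra.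
by split => //; split; [exact: measurable_hat_data|exact: le_lt_trans H (ltry _)].
Qed.

Variables (N d sigma : R) (f0 : Hs sigma).
Hypotheses (N0 : 0 < N) (d0 : 0 <= d) (s1 : 1 < sigma).
Hypothesis hf0 : {ae mu, forall xi, hat f0 xi = d%:C *: hat_data N xi}.
Local Notation phi := (component f0).
Let N0' : 0 <= N. Proof. exact: ltW. Qed.

(** The transform of the i-th component of the data of size d. *)
Definition amplitude i (xi : plane) : R := d * \1_(data_square N i) xi.

Lemma measurable_amplitude i : measurable_fun setT (amplitude i).
Proof. by apply: measurable_funM => //; exact: measurable_indic (measurable_data_square N i). Qed.

Lemma amplitude_bound i xi : 0 <= amplitude i xi <= d.
Proof.
by rewrite /amplitude; case: (indic01 (data_square N i) xi) => [->|[-> _]]; rewrite ?mulr0 ?mulr1 ?lexx ?d0.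
Qed.

Lemma amplitude_in i xi : amplitude i xi != 0 -> data_square N i xi.
Proof.
by rewrite /amplitude; case: (indic01 (data_square N i) xi) => [->|[_ //]]; rewrite mulr0 eqxx.
Qed.

Lemma amplitude_on i xi : data_square N i xi -> amplitude i xi = d.
Proof. by move=> h; rewrite /amplitude indicE mem_set// mulr1. Qed.

Lemma rep_data_comp i : rep (phi i) (fun xi => (amplitude i xi)%:C).
Proof.
apply: rep_ae (rep_component f0 i s1) _ _.
  by apply: cmeasurable_real; exact: measurable_amplitude.
by apply: filterS hf0 => xi ->; rewrite !mxE rmorphM.
Qed.

Lemma wn_data_comp i : wn (phi i) = d * N ^+ 2.
Proof.
rewrite (wn_rep (rep_data_comp i)) /L1norm.
have [i1 e1] := Rintegral_indic (measurable_data_square N i) (leb2_data_square i N0').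
rewrite -e1 -(RintegralZl d measurableT i1); apply: eq_Rintegral => xi _.
by rewrite ncR//; case/andP: (amplitude_bound i xi).
Qed.

Lemma supported_data i : supported (fun xi => plane_norm xi <= 3 * N) (phi i).
Proof.
apply: supported_rep (rep_data_comp i) _ => xi h.
have [->//|/amplitude_in/(plane_norm_data_square N0')/andP[_ //]] := eqVneq (amplitude i xi) 0.
Qed.

Definition refl_amplitude i (xi : plane) : R[i] := conjc (amplitude i (paffine (-1) (0, 0) xi))%:C.

Definition cur_symbol l i j (xi : plane) : R[i] :=
  c%:C * conv (refl_amplitude i) (fun eta => alpha R l i j * (amplitude j eta)%:C) xi.

Lemma rep_data_cur l : rep (cur l phi) (fun xi => \sum_i \sum_j cur_symbol l i j xi).
Proof.
apply: rep_sum => i; apply: rep_sum => j.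
exact: (rep_mul (rep_conj (rep_data_comp i)) (repZ _ (rep_data_comp j))).1.
Qed.

Lemma rep_data_eps_cur m nu : rep (eps_cur m nu phi)
  (fun xi => \sum_l epsilon R m nu l * \sum_i \sum_j cur_symbol l i j xi).
Proof. by apply: rep_sum => l; apply: repZ; exact: rep_data_cur. Qed.

Lemma cur_symbol_eq0 l i j xi :
  (forall eta : plane, data_square N i (- eta.1, - eta.2) -> data_square N j (xi.1 - eta.1, xi.2 - eta.2) -> False) ->
  cur_symbol l i j xi = 0.
Proof.
move=> h; rewrite /cur_symbol conv_eq0 ?mulr0// => eta.
have e1 : paffine (-1) (0, 0) eta = (- eta.1, - eta.2).
  by rewrite /paffine /affine /= !add0r !mulN1r.
have e2 : shift eta xi = (xi.1 - eta.1, xi.2 - eta.2).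
  by rewrite /shift /paffine /affine /= !mul1r addrC (addrC (- eta.2)).
rewrite /refl_amplitude e1 e2.
have [->|/amplitude_in n1] := eqVneq (amplitude i (- eta.1, - eta.2)) 0; first by rewrite conjc_real !mul0r.
have [->|/amplitude_in n2] := eqVneq (amplitude j (xi.1 - eta.1, xi.2 - eta.2)) 0; first by rewrite !mulr0.
by case: (h eta n1 n2).
Qed.

(** The frequencies of a current are differences of two points of the squares. *)
Lemma supported_data_eps_cur m nu :
  supported (fun xi => plane_norm xi <= 6 * N) (eps_cur m nu phi).
Proof.
apply: supported_rep (rep_data_eps_cur m nu) _ => xi h.
apply: big1 => l _; rewrite big1 ?mulr0// => i _; rewrite big1// => j _.
apply: cur_symbol_eq0 => eta /(in_data_square N0')[_ /= q1 q2] /(in_data_square N0')[_ /= q3 q4]; apply: h.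
apply: le_trans (plane_norm_le xi) _.
have k1 : `|xi.1| <= 4 * N.
  have -> : xi.1 = (xi.1 - eta.1) - (- eta.1) by ring.
  apply: le_trans (ler_normB _ _) _; lra.
have k2 : `|xi.2| <= 2 * N.
  move: q2 q4 => /andP[? ?] /andP[? ?]; rewrite ler_norml; apply/andP; split; lra.
lra.
Qed.

Lemma alpha_diag (l : 'I_3) (i : 'I_2) : l != 0 -> alpha R l i i = 0.
Proof.
by move=> /negbTE l0; rewrite /alpha l0; case: ifP => _; rewrite mxE eqxx.
Qed.

(** The potential of the data involves only the currents of index 1 and 2. Their
    matrices have zero diagonal, so that only frequencies of one square meet
    those of the other, at distance at least 2 N. The inverse of D is therefore
    applied to high frequencies only. *)
Lemma far_data nu :
  {ae mu, forall xi, plane_norm xi < N -> fourier (eps_cur 0 nu phi) xi = 0}.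
Proof.
apply: filterS (rep_fourier (rep_data_eps_cur 0 nu)) => xi -> hxi.
apply: big1 => l _; have [->|l0] := eqVneq l 0.
  by rewrite epsilonE subrr mulr0 !mul0r.
rewrite big1 ?mulr0// => i _; rewrite big1// => j _.
have [->|ij] := eqVneq i j.
  by rewrite /cur_symbol conv_eq0 ?mulr0// => eta; rewrite alpha_diag// mul0r mulr0.
apply: cur_symbol_eq0 => eta; have := plane_norm_ge1 xi.
case: i j ij => -[|[|//]] hi [[|[|//]] hj] //= _ x1.
  move=> /in_square /= [/andP[? ?] _] /in_square /= [/andP[? ?] _].
  have := ler_norm (- xi.1); rewrite normrN; lra.
move=> /in_square /= [/andP[? ?] _] /in_square /= [/andP[? ?] _].
have := ler_norm xi.1; lra.
Qed.

(** The transform of the complex conjugate of the second component, and the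
    transform of the square of its modulus. *)
Definition reflected (xi : plane) : R := amplitude 1 (- xi.1, - xi.2).
Definition density_hat (xi : plane) : R := c * rconv reflected (amplitude 1) xi.

Lemma refl_amplitude1 : refl_amplitude 1 = (fun xi => (reflected xi)%:C).
Proof.
apply/funext => xi; rewrite /refl_amplitude /reflected /paffine /affine /= !add0r !mulN1r.
by apply: complexP => /=; rewrite ?oppr0.
Qed.

Lemma integrable_reflected : mu.-integrable setT (EFin \o reflected).
Proof.
have := (rep_conj (rep_data_comp 1)).1; rewrite -/(refl_amplitude 1) refl_amplitude1.
by case.
Qed.

Lemma rep_cubic : rep (cubic f0) (fun xi => (c * rconv density_hat (amplitude 0) xi)%:C).
Proof.
have r1 := rep_data_comp 1; have r0 := rep_data_comp 0.
have rM (x y : R) : x%:C * y%:C = (x * y)%:C by rewrite -rmorphM.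
have e2 : (fun eta => c%:C * conv (refl_amplitude 1) (fun xi => (amplitude 1 xi)%:C) eta) =
    (fun eta => (density_hat eta)%:C).
  by apply/funext => eta; rewrite refl_amplitude1 conv_real rM.
have := (rep_mul (rep_mul (rep_conj r1) r1).1 r0).1; rewrite -/(refl_amplitude 1) e2.
have -> // : (fun xi => c%:C * conv (fun eta => (density_hat eta)%:C) (fun eta => (amplitude 0 eta)%:C) xi) =
    (fun xi => (c * rconv density_hat (amplitude 0) xi)%:C).
by apply/funext => xi; rewrite conv_real rM.
Qed.

Lemma integrable_density_hat : mu.-integrable setT (EFin \o density_hat).
Proof.
have r1 := rep_data_comp 1.
have e2 : (fun eta => c%:C * conv (refl_amplitude 1) (fun xi => (amplitude 1 xi)%:C) eta) =
    (fun eta => (density_hat eta)%:C).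
  by apply/funext => eta; rewrite refl_amplitude1 conv_real -rmorphM.
by have := (rep_mul (rep_conj r1) r1).1.1; rewrite -/(refl_amplitude 1) e2 => -[].
Qed.

Lemma reflected_ge0 xi : 0 <= reflected xi. Proof. by case/andP: (amplitude_bound 1 (- xi.1, - xi.2)). Qed.

Lemma rconv_ge0 (p q : plane -> R) xi : (forall x, 0 <= p x) -> (forall x, 0 <= q x) ->
  0 <= rconv p q xi.
Proof. by move=> p0 q0; apply: Rintegral_ge0 => eta _; rewrite mulr_ge0. Qed.

Lemma amplitude_ge0 i xi : 0 <= amplitude i xi. Proof. by case/andP: (amplitude_bound i xi). Qed.

Lemma density_hat_ge0 xi : 0 <= density_hat xi.
Proof. by rewrite mulr_ge0 ?c0_ge0// rconv_ge0//; [exact: reflected_ge0|exact: amplitude_ge0]. Qed.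

Lemma shiftE eta (xi : plane) : shift eta xi = (xi.1 - eta.1, xi.2 - eta.2).
Proof. by rewrite /shift /paffine /affine /= !mul1r addrC (addrC (- eta.2)). Qed.

Lemma data_square0E xi : data_square N 0 xi <-> (N <= xi.1 <= 2 * N) /\ (0 <= xi.2 <= N).
Proof.
rewrite /data_square eqxx in_square add0r (_ : N + N = 2 * N)//; ring.
Qed.

Lemma data_square1E xi : data_square N 1 xi <-> (- (2 * N) <= xi.1 <= - N) /\ (0 <= xi.2 <= N).
Proof.
rewrite /data_square (_ : (1 == 0 :> 'I_2) = false)// in_square add0r (_ : - (2 * N) + N = - N)//; ring.
Qed.

(** A square translated by at most N/8 in each direction still meets itself in a
    square of side N/2. *)
Lemma density_hat_ge (eta : plane) : - (N / 8) <= eta.1 <= N / 8 -> - (N / 8) <= eta.2 <= N / 8 ->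
  c * (d ^+ 2 * (N / 2) ^+ 2) <= density_hat eta.
Proof.
move=> /andP[e1 e2] /andP[e3 e4]; rewrite /density_hat ler_wpM2l ?c0_ge0//.
have n2 : 0 <= N / 2 by lra.
apply: (rconv_ge (A := square (5 / 4 * N) (- (3 / 4 * N)) (N / 2)) integrable_reflected
  (measurable_amplitude 1) reflected_ge0 (amplitude_bound 1) (measurable_square _ _ _) (leb2_square _ _ n2)).
  exact: sqr_ge0.
move=> zeta /in_square[/andP[z1 z2] /andP[z3 z4]]; rewrite /reflected shiftE.
rewrite !amplitude_on ?expr2//; apply/data_square1E => /=; split; apply/andP; split; lra.
Qed.

Lemma rconv_density_hat_ge (xi : plane) : square (5 / 4 * N) (N / 4) (N / 2) xi ->
  c * (d ^+ 2 * (N / 2) ^+ 2) * d * (N / 4) ^+ 2 <= rconv density_hat (amplitude 0) xi.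
Proof.
move=> /in_square[/andP[x1 x2] /andP[x3 x4]].
have n4 : 0 <= N / 4 by lra.
apply: (rconv_ge (A := square (- (N / 8)) (- (N / 8)) (N / 4)) integrable_density_hat
  (measurable_amplitude 0) density_hat_ge0 (amplitude_bound 0) (measurable_square _ _ _) (leb2_square _ _ n4)).
  by rewrite !mulr_ge0 ?c0_ge0 ?sqr_ge0.
move=> eta /in_square[/andP[h1 h2] /andP[h3 h4]]; rewrite shiftE amplitude_on; last first.
  by apply/data_square0E => /=; split; apply/andP; split; lra.
by rewrite ler_wpM2r// density_hat_ge//; apply/andP; split; lra.
Qed.

(** The transform of the density is large on a neighbourhood of the origin of
    size N, so its product with the first component returns to the square of
    the first component. All transforms are nonnegative, so nothing cancels. *)
Lemma pair_cubic_ge : c ^+ 2 * d ^+ 3 * N ^+ 6 / 256 <=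
  complex.Re (pair (fun xi => (\1_(data_square N 0) xi : R)%:C) (cubic f0)).
Proof.
have cm := cmeasurable_indic (measurable_data_square N 0).
have cc : 0 <= c := c0_ge0 R.
rewrite (pair_rep cm rep_cubic).
have i1 : mu.-integrable setT (EFin \o (fun xi => c * rconv density_hat (amplitude 0) xi)).
  by have [[]] := rep_cubic.
have g0 xi : 0 <= c * rconv density_hat (amplitude 0) xi.
  by rewrite mulr_ge0// rconv_ge0//; [exact: density_hat_ge0|exact: amplitude_ge0].
have -> : complex.Re (integralC mu setT (fun xi =>
    (\1_(data_square N 0) xi : R)%:C * (c * rconv density_hat (amplitude 0) xi)%:C)) =
    \int[mu]_xi (\1_(data_square N 0) xi * (c * rconv density_hat (amplitude 0) xi)).
  by rewrite /=; apply: eq_Rintegral => xi _; rewrite mul0r subr0.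
have n2 : 0 <= N / 2 by rewrite divr_ge0.
have -> : c ^+ 2 * d ^+ 3 * N ^+ 6 / 256 =
    c * (c * (d ^+ 2 * (N / 2) ^+ 2) * d * (N / 4) ^+ 2) * (N / 2) ^+ 2 by field.
apply: (integral_ge (A := square (5 / 4 * N) (N / 4) (N / 2)) _ (measurable_square _ _ _)
  (leb2_square _ _ n2)).
- apply: (integrable_le _ _ i1) => //.
    apply: measurable_funM; first exact: measurable_indic (measurable_data_square N 0).
    by apply/measurable_EFinP; exact: measurable_int i1.
  move=> xi _; rewrite normrM (ger0_norm (g0 xi)).
  by case: (indic01 (data_square N 0) xi) => [->|[-> _]]; rewrite ?normr0 ?normr1 ?mul0r ?mul1r.
- by rewrite !mulr_ge0 ?sqr_ge0.
- by move=> xi; rewrite mulr_ge0.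
move=> xi xiQ; have Q0 : data_square N 0 xi.
  move: xiQ => /in_square[/andP[x1 x2] /andP[x3 x4]].
  by apply/data_square0E => /=; split; apply/andP; split; lra.
by rewrite indicE mem_set// mul1r ler_wpM2l// rconv_density_hat_ge.
Qed.

End Data.

(** * Testing the solution *)

Section Expansion.
Variable R : realType.
Local Notation plane := (plane R).
Local Notation mu := (leb2 R).
Local Notation c := (c0 R).

(** The functional that looks at the square of the first component. *)
Definition window (N : R) (xi : plane) : R[i] := (\1_(data_square N 0) xi : R)%:C.

Lemma bounded_window N : bounded_symbol (window N) 1.
Proof. by split; [exact: cmeasurable_indic (measurable_data_square N 0)|exact: nc_indic]. Qed.

(** The data of size d are d times the data of size 1. In terms of the latter,
    with L = d N^2 and the final time e/N, the estimate of [pair_solution] has a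
    linear and a cubic term and an error that is cubic in d and small with e
    compared with the cubic term. *)
Lemma expansion (T sigma N e d : R) (g0 : Hs sigma) (f : curve T (Hs sigma)) :
  1 < sigma -> 0 < T -> 1 <= N -> 0 < e -> e <= 1 -> e / N <= T -> 0 < d ->
  {ae mu, forall xi, hat g0 xi = hat_data N xi} ->
  100 * 100 * 600 * (c * N * e) ^+ 2 * d ^+ 2 <= e ->
  integral_equation T (pointwise (d *: g0)) (fun t => pointwise (f t)) ->
  nc (pair (window N) (component (f (e / N)) 0) - d%:C * pair (window N) (linear_part g0 (e / N) 0) -
      (d ^+ 3 * (e / N) ^+ 2)%:C * pair (window N) (cubic g0)) <=
  100 * 100 * 2000 * (e * (c ^+ 2 * N ^+ 6)) * (e / N) ^+ 2 * d ^+ 3.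
Proof.
move=> s1 T0 N1 e0 e1 eT d0 hg small eqn.
have N0 : 0 < N by exact: lt_le_trans N1.
have hd : {ae mu, forall xi, hat (d *: g0) xi = d%:C *: hat_data N xi}.
  by apply: filterS2 (hatZ d g0) hg => xi -> ->.
have ecomp i : component (d *: g0) i = (fun x => d%:C * component g0 i x).
  have [_ ->] := rep_data_comp s1 hd i.
  have hg1 : {ae mu, forall xi, hat g0 xi = 1%:C *: hat_data N xi}.
    by apply: filterS hg => xi ->; rewrite scale1r.
  have [_ ->] := repZ d%:C (rep_data_comp s1 hg1 i).
  by congr (inv_fourier _); apply/funext => xi; rewrite /amplitude mul1r rmorphM.
have wg i : wiener (component g0 i) := rep_wiener (rep_component g0 i s1).
have elin : linear_part (d *: g0) (e / N) 0 = (fun x => d%:C * linear_part g0 (e / N) 0 x).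
  apply/funext => x; rewrite /linear_part mulr_sumr; apply: eq_bigr => b _.
  rewrite mulr_sumr; apply: eq_bigr => k _; rewrite ecomp.
  exact: (congr1 (fun h => h x) (multiplierZ d%:C (bounded_propagator b (e / N) 0 k) (wg k))).
have wlin : wiener (linear_part g0 (e / N) 0).
  by apply: wiener_sum => b; apply: wiener_sum => k; exact: wiener_multiplier (wg k) (bounded_propagator b _ _ _).
have ecub : cubic (d *: g0) = (fun x => (d ^+ 3)%:C * cubic g0 x).
  apply/funext => x; rewrite /cubic !ecomp conj_realM !rmorphM /=; ring.
have wcub : wiener (cubic g0) by apply: wienerM => //; apply: wienerM => //; exact: wiener_conj.
have L0 : 0 < d * N ^+ 2 by rewrite mulr_gt0// exprn_gt0.
have a0 : 0 < e / N by rewrite divr_gt0.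
have sm : 100 * 100 * 600 * (c * (d * N ^+ 2) * (e / N)) ^+ 2 <= e.
  have -> // : c * (d * N ^+ 2) * (e / N) = c * N * e * d by field; rewrite gt_eqF.
  by rewrite exprMn mulrA.
have aN : e / N * N <= e by rewrite divfK// gt_eqF.
have wN i : wn (component (d *: g0) i) <= d * N ^+ 2 by rewrite (wn_data_comp N0 (ltW d0) s1 hd).
have m3 xi : window N xi != 0 -> plane_norm xi <= 3 * N.
  rewrite /window; case: (indic01 (data_square N 0) xi) => [->|[_ h]]; first by rewrite eqxx.
  by move=> _; case/andP: (plane_norm_data_square (ltW N0) h).
have := @pair_solution R T sigma N (d *: g0) f (d * N ^+ 2) e (e / N) s1 (ltW T0) N0
  (far_data s1 hd) eqn L0 wN (supported_data N0 s1 hd) (supported_data_eps_cur N0 s1 hd)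
  (ltW a0) eT (ltW e0) e1 aN sm (window N) (bounded_window N) m3 (e / N) a0 (lexx _).
rewrite elin ecub (pairZ _ (bounded_window N) wlin) (pairZ _ (bounded_window N) wcub).
by rewrite mulrA -rmorphM (mulrC ((e / N) ^+ 2)) => /le_trans; apply; rewrite le_eqVlt;
  apply/orP; left; apply/eqP; ring.
Qed.

End Expansion.

Section Functional.
Variable R : realType.
Local Notation plane := (plane R).
Local Notation mu := (leb2 R).

(** [window] as a real functional on Sobolev spaces of negative order, where
    the elements are not functions. *)
Definition probe s (N : R) (v : Hs s) : R :=
  complex.Re (integralC mu setT (fun xi => (\1_(data_square N 0) xi : R)%:C * hat v xi 0 0)).

Lemma probe_integrable s N (v : Hs s) : s < 0 -> 1 <= N ->
  cintegrable mu setT (fun xi => (\1_(data_square N 0) xi : R)%:C * hat v xi 0 0) /\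
  `|probe N v| <= (4 * N) `^ (- s) * N * `|v|.
Proof.
move=> s0 N1; have N0 : 0 < N by exact: lt_le_trans N1.
have G0 : 0 <= (4 * N) `^ (- s) * N by rewrite mulr_ge0 ?powR_ge0// ltW.
have [|ci hc] := @sobolev_pairing R s v (\1_(data_square N 0)) _ 0
  (measurable_indic (measurable_data_square N 0)) (fun _ => ler0n _ _) G0.
  have [i1 e1] := Rintegral_indic (measurable_data_square N 0) (leb2_data_square 0 (ltW N0)).
  have i2 := rintegrableZ (((4 * N) `^ (- s)) ^+ 2) measurableT i1.
  have e2 : \int[mu]_xi (((4 * N) `^ (- s)) ^+ 2 * (\1_(data_square N 0) xi : R)) = ((4 * N) `^ (- s) * N) ^+ 2.
    by rewrite (RintegralZl _ measurableT i1) e1 exprMn.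
  rewrite -e2 /Rintegral fineK; last exact: integrable_fin_num.
  apply: ge0_le_integral => //=.
  - by move=> x _; rewrite lee_fin sqr_ge0.
  - apply/measurable_EFinP/measurable_funX/measurable_funM.
      exact: measurable_indic (measurable_data_square N 0).
    apply: (measurableT_comp (measurable_powR _)); apply: measurable_funD => //.
    exact: measurable_plane_norm.
  - by case/integrableP: i2.
  move=> xi _; rewrite lee_fin.
  case: (indic01 (data_square N 0) xi) => [->|[-> h]]; first by rewrite mul0r mulr0 expr0n.
  rewrite mul1r mulr1 lerXn2r ?nnegrE ?powR_ge0//.
  have /andP[h1 h2] := plane_norm_data_square (ltW N0) h.
  have x0 := plane_norm_ge0 xi.
  by apply: ge0_ler_powR; rewrite ?nnegrE ?oppr_ge0 ?(ltW s0)//; lra.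
split => //; apply: le_trans (Re_le_nc _) _.
by apply: le_trans (nc_cintegral measurableT ci) _.
Qed.

Lemma probe_linear s N (a : R) (u v : Hs s) : s < 0 -> 1 <= N ->
  probe N (a *: u + v) = a * probe N u + probe N v.
Proof.
move=> s0 N1; have [iu _] := probe_integrable u s0 N1; have [iv _] := probe_integrable v s0 N1.
have [iw _] := probe_integrable (a *: u + v) s0 N1.
rewrite /probe.
have -> : integralC mu setT (fun xi => (\1_(data_square N 0) xi : R)%:C * hat (a *: u + v) xi 0 0) =
    integralC mu setT (fun xi => a%:C * ((\1_(data_square N 0) xi : R)%:C * hat u xi 0 0) +
      (\1_(data_square N 0) xi : R)%:C * hat v xi 0 0).
  apply: ae_eq_cintegral; first exact: cintegrable_meas iw.
    exact: (cintegrable_meas (cintegrableD measurableT (cintegrableZ a%:C measurableT iu) iv)).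
  have a1 := hatD (a *: u) v; have a2 := hatZ a u.
  by near=> xi; rewrite (near a1 xi)// !mxE (near a2 xi)// !mxE mulrDr mulrCA.
rewrite (cintegralD measurableT (cintegrableZ a%:C measurableT iu) iv).
by rewrite (cintegralZ a%:C measurableT iu) ReD ReM /= mul0r subr0.
Unshelve. all: by end_near. Qed.

Lemma probe_pair s sigma N (v : Hs s) (w : Hs sigma) : 1 < sigma ->
  same_distribution v w -> probe N v = complex.Re (pair (window N) (component w 0)).
Proof.
move=> s1 vw; have mm := (bounded_window N).1.
rewrite (pair_rep mm (rep_component w 0 s1)) /probe; congr (complex.Re _).
apply: ae_eq_cintegral.
- by apply: cmeasurableM => //; exact: cmeasurable_hat.
- by apply: cmeasurableM => //; exact: cmeasurable_hat.
- by apply: filterS vw => xi ->.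
Qed.

Lemma small_parameter (x1 x2 X r1 r2 e : R) : 0 <= x1 -> 0 <= x2 -> 0 <= X ->
  0 < r1 -> 0 < r2 -> 0 < e -> e <= 1 ->
  exists2 d : R, 0 < d & [/\ x1 * d < r1, x2 * d < r2 & X * d ^+ 2 <= e].
Proof.
move=> h1 h2 hX p1 p2 pe e1.
have small (x r : R) : 0 <= x -> 0 < r -> x * (r / (x + 1)) < r.
  move=> x0 r0; rewrite mulrA ltr_pdivrMr ?ltr_wpDl// mulrC ltr_pM2l//; lra.
pose d := Num.min (Num.min (r1 / (x1 + 1)) (r2 / (x2 + 1))) (e / (X + 1)).
have d1 : d <= r1 / (x1 + 1) by rewrite /d !ge_min lexx.
have d2 : d <= r2 / (x2 + 1) by rewrite /d !ge_min lexx orbT.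
have d3 : d <= e / (X + 1) by rewrite /d !ge_min lexx !orbT.
have d0 : 0 < d by rewrite /d !lt_min !divr_gt0// ltr_wpDl.
have dle1 : d <= 1.
  by apply: le_trans d3 _; rewrite ler_pdivrMr ?ltr_wpDl//; lra.
exists d => //; split.
- by apply: le_lt_trans (small _ _ h1 p1); rewrite ler_wpM2l.
- by apply: le_lt_trans (small _ _ h2 p2); rewrite ler_wpM2l.
- apply: (@le_trans _ _ (X * d)); first by rewrite ler_wpM2l// expr2 ler_piMr// ltW.
  by apply: ltW; apply: le_lt_trans (small _ _ hX pe); rewrite ler_wpM2l.
Qed.

Lemma large_frequency (b X e N1 : R) : 0 < b -> 0 <= X -> 0 < e ->
  exists2 N : R, N1 <= N /\ 1 <= N & X * N `^ (- b) < e.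
Proof.
move=> b0 X0 e0.
have := powR_decay b0 => /cvgrPdist_lt /(_ (e / (X + 1))).
rewrite divr_gt0 ?ltr_wpDl// => /(_ isT) hn.
near (pinfty_nbhs R) => x.
have x0 : 0 <= x by near: x; exact: nbhs_pinfty_ge.
have x1 : N1 <= x by near: x; apply: nbhs_pinfty_ge; exact: num_real.
exists (1 + x); first by split; lra.
have := near hn x _; rewrite sub0r normrN ger0_norm ?powR_ge0// => h.
apply: le_lt_trans (_ : X * (e / (X + 1)) < e); first by rewrite ler_wpM2l// ltW// h.
rewrite mulrA ltr_pdivrMr ?ltr_wpDl// mulrC ltr_pM2l//; lra.
Unshelve. all: by end_near. Qed.

Definition square_data (sigma N W : R) (N0 : 0 <= N) (W0 : 0 <= W)
    (hW : forall i xi, data_square N i xi -> (1 + plane_norm xi) `^ sigma <= W) : Hs sigma :=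
  ofhat (sobolev_hat_data N0 W0 hW).1.

Lemma square_data_norm (sigma N W : R) (N0 : 0 <= N) (W0 : 0 <= W)
    (hW : forall i xi, data_square N i xi -> (1 + plane_norm xi) `^ sigma <= W) :
  `|square_data N0 W0 hW| <= 2 * W * N.
Proof.
have := (sobolev_hat_data N0 W0 hW).2.
rewrite -(sobolev_norm_ae sigma _ _ (hat_ofhat (sobolev_hat_data N0 W0 hW).1)).
- by rewrite -Hs_normE lee_fin.
- exact: (hatP _).1.
- exact: measurable_hat_data.
Qed.

Lemma weight_pos (sigma N : R) i xi : 0 <= sigma -> 1 <= N -> data_square N i xi ->
  (1 + plane_norm xi) `^ sigma <= (4 * N) `^ sigma.
Proof.
move=> s0 N1 h; have N0 : 0 <= N by lra.
have /andP[h1 h2] := plane_norm_data_square N0 h; have x0 := plane_norm_ge0 xi.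
by apply: ge0_ler_powR; rewrite ?nnegrE//; lra.
Qed.

Lemma weight_neg (s N : R) i xi : s < 0 -> 1 <= N -> data_square N i xi ->
  (1 + plane_norm xi) `^ s <= N `^ s.
Proof.
move=> s0 N1 h; have N0 : 0 < N by lra.
have /andP[h1 h2] := plane_norm_data_square (ltW N0) h; have x0 := plane_norm_ge0 xi.
rewrite -(opprK s) !(powRN _ (- s)) lef_pV2 ?posrE ?powR_gt0//; last by lra.
by apply: ge0_ler_powR; rewrite ?nnegrE ?oppr_ge0 ?(ltW s0)//; lra.
Qed.

(** The third difference removes the linear part A and maps k^3 q to 6 q; the
    errors add up to 64 + 3 * 27 + 3 * 8 + 1 = 170 times [Er]. *)
Lemma third_difference_cubic (x1 x2 x3 x4 A q Er : R) :
  `|x1 - A - q| <= Er -> `|x2 - 2 * A - 8 * q| <= 8 * Er ->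
  `|x3 - 3 * A - 27 * q| <= 27 * Er -> `|x4 - 4 * A - 64 * q| <= 64 * Er ->
  6 * q - 170 * Er <= `|x4 - 3 * x3 + 3 * x2 - x1|.
Proof.
rewrite !ler_norml => /andP[? ?] /andP[? ?] /andP[? ?] /andP[? ?].
apply: le_trans (ler_norm _); lra.
Qed.

End Functional.

(** * Growth as the frequency increases *)

Section Growth.
Variable R : realType.
Local Notation c := (c0 R).
Variables (s T : R) (S : Hs s -> curve T (Hs s)).
Hypotheses (hs : s < 0) (hT : 0 < T).

(** The cubic term has size t^2 N^6 with t = e/N, that is e^2 N^4, while the
    bound from third derivatives has size N^(1 - s) N^(3 (1 + s)) =
    N^(4 + 2 s). The value of e makes 170 times the error at most a sixth
    of 6 q. *)
Lemma frequency_balance (N e M d w h q Er P : R) : 0 < N -> 0 <= M -> 0 < d -> 0 < e ->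
  100 * 100 * 2000 * 170 * 256 * e = 1 -> w = d ^+ 3 * (e / N) ^+ 2 ->
  q = w * P -> Er = 100 * 100 * 2000 * (e * (c ^+ 2 * N ^+ 6)) * w ->
  c ^+ 2 * N ^+ 6 / 256 <= P -> h <= (2 * N `^ s * N) ^+ 3 ->
  6 * q - 170 * Er <= (4 * N) `^ (- s) * N * M * h * d ^+ 3 ->
  5 / 256 * c ^+ 2 * e ^+ 2 <= 8 * M * 4 `^ (- s) * N `^ (- (- (2 * s))).
Proof.
move=> N0 M0 d0 e0 eZ ew eq eEr hP hh H.
have d3 : 0 < d ^+ 3 by rewrite exprn_gt0.
have w0 : 0 <= w by rewrite ew mulr_ge0 ?sqr_ge0// ltW.
have low : 5 / 256 * (c ^+ 2 * N ^+ 6 * w) <= 6 * q - 170 * Er.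
  have h1 := ler_wpM2l w0 hP; rewrite -eq in h1.
  have h2 : 170 * 256 * Er = c ^+ 2 * N ^+ 6 * w.
    have -> : 170 * 256 * Er = 100 * 100 * 2000 * 170 * 256 * e * (c ^+ 2 * N ^+ 6 * w).
      by rewrite eEr; ring.
    by rewrite eZ mul1r.
  have h3 : w * (c ^+ 2 * N ^+ 6 / 256) = c ^+ 2 * N ^+ 6 * w / 256 by ring.
  rewrite h3 in h1; move: h1 h2; set z := c ^+ 2 * N ^+ 6 * w => h1 h2; lra.
have n1 : N `^ (- s) * N `^ s = 1.
  by rewrite -powRD ?addNr ?powRr0// (gt_eqF N0) implybT.
have n2 : N `^ (- (- (2 * s))) = (N `^ s) ^+ 2.
  by rewrite opprK mulrC powRrM powR_mulrn// powR_ge0.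
have n4 : (4 * N) `^ (- s) = 4 `^ (- s) * N `^ (- s) by rewrite powRM// ltW.
have C0 : 0 <= (4 * N) `^ (- s) * N * M by rewrite !mulr_ge0 ?powR_ge0// ltW.
have up : (4 * N) `^ (- s) * N * M * h * d ^+ 3 <=
    8 * M * 4 `^ (- s) * N `^ (- (- (2 * s))) * N ^+ 4 * d ^+ 3.
  rewrite ler_pM2r//; apply: le_trans (ler_wpM2l C0 hh) _; rewrite n4 n2.
  have -> : 4 `^ (- s) * N `^ (- s) * N * M * (2 * N `^ s * N) ^+ 3 =
      8 * M * 4 `^ (- s) * (N `^ s) ^+ 2 * N ^+ 4 * (N `^ (- s) * N `^ s) by ring.
  by rewrite n1 mulr1.
have := le_trans low (le_trans H up); rewrite ew.
have -> : 5 / 256 * (c ^+ 2 * N ^+ 6 * (d ^+ 3 * (e / N) ^+ 2)) =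
    5 / 256 * c ^+ 2 * e ^+ 2 * N ^+ 4 * d ^+ 3 by field; rewrite gt_eqF.
by rewrite ler_pM2r// ler_pM2r// exprn_gt0.
Qed.

(** The size d of the data is chosen last, depending on N: small enough for
    the existence of the smooth solution, for the range of [third_difference]
    and for the bootstrap. It cancels from the conclusion, as both sides are
    cubic in d. *)
Lemma growth (M rho sigma r N e : R) : 1 < sigma -> 0 < r -> 0 <= M -> 0 < rho ->
  (forall f0 : Hs sigma, `|f0| < r -> exists f : curve T (Hs sigma),
     integral_equation T (pointwise f0) (fun t => pointwise (f t)) /\
     forall psi0 : Hs s, same_distribution psi0 f0 ->
       forall t, t \in `[- T, T] -> same_distribution (S psi0 t) (f t)) ->
  (forall (h : Hs s) (d : R), 0 < d -> 4 * d * `|h| < rho ->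
    forall (Lam : curve T (Hs s) -> R) (C : R),
      (forall a u v, Lam (a *: u + v) = a * Lam u + Lam v) ->
      0 <= C -> (forall v, `|Lam v| <= C * `|v|) ->
    `|Lam (S ((4 * d) *: h)) - 3 * Lam (S ((3 * d) *: h)) +
      3 * Lam (S ((2 * d) *: h)) - Lam (S (d *: h))| <= C * M * `|h| ^+ 3 * d ^+ 3) ->
  1 <= N -> 0 < e -> e <= 1 -> e / N <= T -> 100 * 100 * 2000 * 170 * 256 * e = 1 ->
  5 / 256 * c ^+ 2 * e ^+ 2 <= 8 * M * 4 `^ (- s) * N `^ (- (- (2 * s))).
Proof.
move=> s1 r0 M0 rho0 HF HT N1 e0 e1 eT eZ.
have N0 : 0 < N by lra.
have sg0 : 0 <= sigma by lra.
pose g0 : Hs sigma := square_data (ltW N0) (powR_ge0 (4 * N) sigma) (fun i xi => weight_pos sg0 N1).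
pose h : Hs s := square_data (ltW N0) (powR_ge0 N s) (fun i xi => weight_neg hs N1).
have hg : {ae leb2 R, forall xi, hat g0 xi = hat_data N xi} := hat_ofhat _.
have hh : {ae leb2 R, forall xi, hat h xi = hat_data N xi} := hat_ofhat _.
have k6 : 0 <= 100 * 100 * 600 :> R by lra.
have X0 := mulr_ge0 (mulr_ge0 k6 (sqr_ge0 (c * N * e))) (sqr_ge0 (4 : R)).
have [d d0 [d1 d2 d3]] := small_parameter (mulr_ge0 (ler0n R 4) (normr_ge0 h))
  (mulr_ge0 (ler0n R 4) (normr_ge0 g0)) X0 rho0 r0 e0 e1.
pose t := e / N.
have t0 : 0 < t by rewrite divr_gt0.
have tI : t \in `[- T, T].
  by rewrite in_itv/=; apply/andP; split; [apply: le_trans (ltW t0); rewrite oppr_le0 ltW|].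
pose A := pair (window N) (linear_part g0 t 0).
pose P := pair (window N) (cubic g0).
pose Er := 100 * 100 * 2000 * (e * (c ^+ 2 * N ^+ 6)) * t ^+ 2 * d ^+ 3.
pose q := d ^+ 3 * t ^+ 2 * complex.Re P.
pose Lam (v : curve T (Hs s)) := probe N (v t).
have step (k : R) : 0 < k -> k <= 4 ->
    `|Lam (S ((k * d) *: h)) - k * (d * complex.Re A) - k ^+ 3 * q| <= k ^+ 3 * Er.
  move=> k0 k4; have kd : 0 < k * d by rewrite mulr_gt0.
  have small : `|(k * d) *: g0| < r.
    rewrite normrZ (ger0_norm (ltW kd)); apply: le_lt_trans d2.
    by rewrite [leRHS]mulrAC ler_wpM2r// ler_wpM2r// ltW.
  have [f [eqn same]] := HF _ small.
  have sd : same_distribution ((k * d) *: h) ((k * d) *: g0).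
    have a1 := hatZ (k * d) h; have a2 := hatZ (k * d) g0.
    near=> xi.
    by rewrite (near a1 xi)// (near a2 xi)// (near hg xi)// (near hh xi).
  rewrite /Lam (probe_pair N s1 (same _ sd t tI)).
  have sm : 100 * 100 * 600 * (c * N * e) ^+ 2 * (k * d) ^+ 2 <= e.
    apply: le_trans d3; rewrite -(mulrA _ (4 ^+ 2)) -exprMn.
    have kd4 : k * d <= 4 * d by rewrite ler_wpM2r// ltW.
    apply: ler_wpM2l; first exact: mulr_ge0 k6 (sqr_ge0 _).
    by rewrite lerXn2r ?nnegrE ?mulr_ge0// ltW.
  have := expansion s1 hT N1 e0 e1 eT kd hg sm eqn.
  rewrite -/t -/A -/P => H.
  have := le_trans (Re_le_nc _) H.
  have ReB (z w : R[i]) : complex.Re (z - w) = complex.Re z - complex.Re w by case: z; case: w.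
  have ReZ (x : R) (w : R[i]) : complex.Re (x%:C * w) = x * complex.Re w.
    by rewrite ReM /= mul0r subr0.
  rewrite !ReB !ReZ.
  have -> : (k * d) ^+ 3 * t ^+ 2 * complex.Re P = k ^+ 3 * q by rewrite /q; ring.
  have -> : k * d * complex.Re A = k * (d * complex.Re A) by ring.
  by move=> /le_trans; apply; rewrite le_eqVlt; apply/orP; left; apply/eqP; rewrite /Er; ring.
have LamL a u v : Lam (a *: u + v) = a * Lam u + Lam v.
  by rewrite /Lam /= !fctE; exact: probe_linear.
pose C := (4 * N) `^ (- s) * N.
have C0 : 0 <= C by rewrite mulr_ge0 ?powR_ge0// ltW.
have LamC v : `|Lam v| <= C * `|v|.
  apply: le_trans (probe_integrable (v t) hs N1).2 _.
  by rewrite ler_wpM2l//; exact: curve_norm_ub.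
have dh : 4 * d * `|h| < rho by rewrite mulrAC.
have TD := HT h d d0 dh Lam C LamL C0 LamC.
have s1' := step 1 ltr01 (ler1n _ 4).
have s2 := step 2 (ltr0n _ 2) (ler_nat _ 2 4).
have s3 := step 3 (ltr0n _ 3) (ler_nat _ 3 4).
have s4 := step 4 (ltr0n _ 4) (lexx _).
rewrite !mul1r expr1n !mul1r in s1'.
have low : 6 * q - 170 * Er <= `|Lam (S ((4 * d) *: h)) - 3 * Lam (S ((3 * d) *: h)) +
      3 * Lam (S ((2 * d) *: h)) - Lam (S (d *: h))|.
  have e2 : 2 ^+ 3 = 8 :> R by ring.
  have e3 : 3 ^+ 3 = 27 :> R by ring.
  have e4 : 4 ^+ 3 = 64 :> R by ring.
  rewrite e2 in s2; rewrite e3 in s3; rewrite e4 in s4.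
  exact: (third_difference_cubic s1' s2 s3 s4).
have main := le_trans low TD.
have hg1 : {ae leb2 R, forall xi, hat g0 xi = 1%:C *: hat_data N xi}.
  by apply: filterS hg => xi ->; rewrite scale1r.
have PR := pair_cubic_ge N0 ler01 s1 hg1.
rewrite -/(window N) -/P expr1n mulr1 in PR.
have hn : `|h| ^+ 3 <= (2 * N `^ s * N) ^+ 3.
  by rewrite lerXn2r ?nnegrE ?mulr_ge0 ?powR_ge0 ?square_data_norm// ltW.
rewrite /C in main.
have ErE : Er = 100 * 100 * 2000 * (e * (c ^+ 2 * N ^+ 6)) * (d ^+ 3 * t ^+ 2).
  by rewrite /Er -(mulrA _ (t ^+ 2)) (mulrC (t ^+ 2)).
exact: (frequency_balance N0 M0 d0 e0 eZ erefl erefl ErE PR hn main).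
Unshelve. all: by end_near. Qed.

End Growth.

Theorem theorem1p3 (R : realType) (s T : R) (hs : s < 0) (hT : 0 < T)
    (S : Hs s -> curve T (Hs s)) (hS : flow_map S) :
  ~ C3_at S 0.
Proof.
move=> C3; have [M [rho [M0 rho0 HT]]] := third_difference C3.
have [sigma [r [s1 r0 HF]]] := hS.
(* The time of observation is e/N, where e is the reciprocal of Z: the errors of
   the expansion then do not exceed a fixed part of the cubic term. *)
pose Z : R := 100 * 100 * 2000 * 170 * 256.
have Z1 : 1 <= Z by rewrite /Z; lra.
have Z0 : 0 < Z by apply: lt_le_trans Z1.
have e0 : 0 < Z^-1 by rewrite invr_gt0.
have e1 : Z^-1 <= 1 by rewrite invf_le1.
have eZ : Z * Z^-1 = 1 by rewrite mulfV// gt_eqF.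
have b0 : 0 < - (2 * s) by rewrite oppr_gt0 pmulr_rlt0.
have X0 : 0 <= 8 * M * 4 `^ (- s) by rewrite !mulr_ge0 ?powR_ge0.
have th : 0 < 5 / 256 * c0 R ^+ 2 * Z^-1 ^+ 2.
  have k5 : 0 < 5 / 256 :> R by lra.
  exact: mulr_gt0 (mulr_gt0 k5 (exprn_gt0 2 (c0_gt0 R))) (exprn_gt0 2 e0).
have [N [N1 N2] hN] := large_frequency (Z^-1 / T) b0 X0 th.
have N0 : 0 < N by apply: lt_le_trans N2.
have eT : Z^-1 / N <= T by rewrite ler_pdivrMr// mulrC -ler_pdivrMr.
have := growth hs hT s1 r0 M0 rho0 HF HT N2 e0 e1 eT eZ.
by rewrite leNgt hN.
Qed.
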